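(* Consider the bivariate renewal risk model with surplus process $$U_1(t)=x+\int_{0-}^te^{-rs}C_1(ds)-D^{(1)}_r(t),\qquad U_2(t)=y+\int_{0-}^te^{-rs}C_2(ds)-D^{(2)}_r(t),\quad t\ge0,$$ with constant interest rate $r\ge0$ and initial capitals $x,y$. Assume: $\{(X_i,Y_i)\}_{i\ge1}$, $\{(C_1(t),C_2(t))\}_{t\ge0}$ and $\{N(t)\}_{t\ge0}$ are mutually independent; the pairs $(X_i,Y_i)$ are identically distributed with non-negative marginals with distributions $F\in\mathcal{D}\cap\mathcal{L}$ and $G\in\mathcal{D}\cap\mathcal{L}$; each pair $(X_i,Y_i)$ is SAI with common constant $C>0$; $X_i,Y_j$ are independent for $i\neq j$; and for every $n\in\mathbb{N}$ the variables $X_1,\ldots,X_n,Y_1,\ldots,Y_n$ are GTAI. Then for every finite $T>0$ with $\lambda(T)>0$, $$\psi_{\max}(x,y;T)\sim\psi_{\mathrm{and}}(x,y;T)\sim\Delta(x,y;T),\qquad x\wedge y\to\infty,$$ where $$\Delta(x,y;T)=\iint_{s,t\ge0,\;s+t\le T}\Big[\overline F(xe^{r(t+s)})\overline G(ye^{rt})+\overline F(xe^{rt})\overline G(ye^{r(t+s)})\Big]\lambda(ds)\lambda(dt)+C\int_0^T\overline F(xe^{rt})\overline G(ye^{rt})\lambda(dt).$$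
   Context: Model: claims $(X_i,Y_i)$, $i\ge1$, arrive at times $T_1<T_2<\cdots$, $T_1=\theta_1$, $T_i-T_{i-1}=\theta_i$, with $\{\theta_i\}$ i.i.d. positive; $N(t)=\sum_{i\ge1}\mathbf 1_{\{T_i\le t\}}$, $\lambda(t)=\mathbb{E}N(t)$. $D^{(1)}_r(t)=\sum_{i=1}^{N(t)}X_ie^{-rT_i}$, $D^{(2)}_r(t)=\sum_{j=1}^{N(t)}Y_je^{-rT_j}$. $(C_1(t),C_2(t))$ has non-decreasing càdlàg paths with $C_1(0)=C_2(0)=0$. Ruin probabilities: $\psi_*(x,y;T)=\mathbb{P}(T_*\le T\mid (U_1(0),U_2(0))=(x,y))$ for $*\in\{\max,\mathrm{and}\}$, where $T_{\max}=\inf\{t>0: U_1(t)\vee U_2(t)<0\}$ (both lines simultaneously negative) and $T_{\mathrm{and}}=\inf\{t>0:\inf_{0\le s\le t}U_1(s)<0,\ \inf_{0\le s\le t}U_2(s)<0\}$ (both lines negative, not necessarily simultaneously). All distributions have infinite right endpoint; $\overline V=1-V$. $V\in\mathcal{D}$ if $\limsup_{x\to\infty}\overline V(tx)/\overline V(x)<\infty$ for some (equivalently all) $t\in(0,1)$; $V\in\mathcal{L}$ if $\lim_{x\to\infty}\overline V(x-a)/\overline V(x)=1$ for all $a>0$. SAI (for non-negative $X,Y$ with distributions $F,G$): $\mathbb{P}(X>x,Y>y)\sim C\overline F(x)\overline G(y)$ as $x\wedge y\to\infty$. GTAI: random variables $X_1,\ldots,X_n,Y_1,\ldots,Y_m$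 with supports unbounded above are GTAI if $\lim_{x_i\wedge x_k\wedge y_j\to\infty}\mathbb{P}(|X_i|>x_i\mid X_k>x_k,Y_j>y_j)=0$ for all $1\le i\neq k\le n$, $1\le j\le m$, and $\lim_{x_i\wedge y_j\wedge y_k\to\infty}\mathbb{P}(|Y_j|>y_j\mid X_i>x_i,Y_k>y_k)=0$ for all $1\le j\neq k\le m$, $1\le i\le n$. *)

(* Defs.v *)
From HB Require Import structures.
From mathcomp Require Import all_boot all_order all_algebra.
From mathcomp Require Import all_classical all_reals all_analysis.
Set Implicit Arguments. Unset Strict Implicit. Unset Printing Implicit Defensive.
Import Order.TTheory GRing.Theory Num.Theory.
Import numFieldNormedType.Exports.
Local Open Scope classical_set_scope.
Local Open Scope ring_scope.

Section RiskDefs.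
Context {d : measure_display} {Omega : measurableType d} {R : realType}.
Variable P : probability Omega R.

Definition tail (X : Omega -> R) (x : R) : R := fine (P [set w | x < X w]).

Definition asymp {U : Type} (F : set_system U) (f g : U -> R) : Prop :=
  (fun u => f u / g u) @ F --> (1 : R).

Definition xy_infty : set_system (R * R) := filter_prod (pinfty_nbhs R) (pinfty_nbhs R).
Definition xyz_infty : set_system ((R * R) * R) := filter_prod xy_infty (pinfty_nbhs R).

(* class D and class L, for a tail function Vb = 1 - V *)
Definition classD (Vb : R -> R) : Prop :=
  exists t : R, 0 < t < 1 /\
    exists M : R, \forall x \near +oo, Vb (t * x) / Vb x <= M.
Definition classL (Vb : R -> R) : Prop :=
  forall a : R, 0 < a -> (fun x => Vb (x - a) / Vb x) @ +oo --> (1 : R).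

Definition arrival (theta : nat -> Omega -> R) (i : nat) (w : Omega) : R :=
  \sum_(1 <= k < i.+1) theta k w.

Definition Ncount (theta : nat -> Omega -> R) (t : R) (w : Omega) : \bar R :=
  (\sum_(1 <= i <oo) (if (arrival theta i w <= t)%R then 1%R else 0%R)%:E)%E.

Definition renewal_fun (theta : nat -> Omega -> R) (t : R) : \bar R :=
  (\int[P]_w Ncount theta t w)%E.

(* the renewal measure lambda(ds):  lambda(A) = E #{i >= 1 : T_i in A};
   lambda((-oo,t]) = lambda(t) *)
Definition renewal_measure (theta : nat -> Omega -> R) (A : set R) : \bar R :=
  (\sum_(1 <= i <oo) P (arrival theta i @^-1` A))%E.

(* D_r(t) = sum_{i=1}^{N(t)} X_i e^{-r T_i} *)
Definition disc_claims (r : R) (X theta : nat -> Omega -> R) (t : R) (w : Omega) : \bar R :=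
  (\sum_(1 <= i <oo)
     ((if (arrival theta i w <= t)%R then 1 else 0) * X i w * expR (- r * arrival theta i w))%:E)%E.

Definition disc_premium (r : R) (Cw : cumulative R R) (t : R) : \bar R :=
  (\int[lebesgue_stieltjes_measure Cw]_(s in `[0%R, t]) (expR (- r * s))%:E)%E.

Definition surplus (u r : R) (Cp : Omega -> cumulative R R) (X theta : nat -> Omega -> R)
  (t : R) (w : Omega) : \bar R :=
  (u%:E + disc_premium r (Cp w) t - disc_claims r X theta t w)%E.

Definition T_max (U1 U2 : R -> Omega -> \bar R) (w : Omega) : \bar R :=
  ereal_inf [set t%:E | t in [set t : R | 0 < t /\ (maxe (U1 t w) (U2 t w) < 0)%E]].

Definition T_and (U1 U2 : R -> Omega -> \bar R) (w : Omega) : \bar R :=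
  ereal_inf [set t%:E | t in [set t : R | 0 < t /\
     (ereal_inf [set U1 s w | s in `[0%R, t]] < 0)%E /\
     (ereal_inf [set U2 s w | s in `[0%R, t]] < 0)%E]].

Definition psi_max (x y r : R) (C1 C2 : Omega -> cumulative R R)
  (X Y theta : nat -> Omega -> R) (T : R) : R :=
  fine (P [set w | (T_max (surplus x r C1 X theta) (surplus y r C2 Y theta) w
                     <= T%:E)%E]).

Definition psi_and (x y r : R) (C1 C2 : Omega -> cumulative R R)
  (X Y theta : nat -> Omega -> R) (T : R) : R :=
  fine (P [set w | (T_and (surplus x r C1 X theta) (surplus y r C2 Y theta) w
                     <= T%:E)%E]).

Definition Delta (lam : set R -> \bar R) (Fb Gb : R -> R) (C r x y T : R) : \bar R :=
  (\int[lam]_(t in `[0%R, T])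
     (\int[lam]_(s in `[0%R, (T - t)%R])
        ((Fb (x * expR (r * (t + s))) * Gb (y * expR (r * t))
          + Fb (x * expR (r * t)) * Gb (y * expR (r * (t + s))))%:E))
   + C%:E * \int[lam]_(t in `[0%R, T]) ((Fb (x * expR (r * t)) * Gb (y * expR (r * t)))%:E))%E.

Definition sigma_claims (X Y : nat -> Omega -> R) : set (set Omega) :=
  <<s [set A | exists i : nat, (1 <= i)%N /\ exists B : set R, measurable B /\
          (A = X i @^-1` B \/ A = Y i @^-1` B)] >>.
Definition sigma_premium (C1 C2 : Omega -> cumulative R R) : set (set Omega) :=
  <<s [set A | exists t : R, 0 <= t /\ exists B : set R, measurable B /\
          (A = (fun w => C1 w t) @^-1` B \/ A = (fun w => C2 w t) @^-1` B)] >>.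
Definition sigma_interarrival (theta : nat -> Omega -> R) : set (set Omega) :=
  <<s [set A | exists i : nat, (1 <= i)%N /\ exists B : set R, measurable B /\
          A = theta i @^-1` B] >>.

Definition indep3 (S1 S2 S3 : set (set Omega)) : Prop :=
  forall A1 A2 A3, S1 A1 -> S2 A2 -> S3 A3 ->
    P (A1 `&` A2 `&` A3) = (P A1 * P A2 * P A3)%E.

Definition indep_seq (theta : nat -> Omega -> R) : Prop :=
  forall (s : seq nat) (B : nat -> set R), uniq s -> all (leq 1) s ->
    (forall i, measurable (B i)) ->
    P (\big[setI/setT]_(i <- s) (theta i @^-1` B i)) =
    (\prod_(i <- s) P (theta i @^-1` B i))%E.

(* GTAI for X_1..X_n, Y_1..Y_n;  P(A | B) = P(A & B) / P(B) *)
Definition GTAI (n : nat) (X Y : nat -> Omega -> R) : Prop :=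
  (forall i k j : nat, (1 <= i <= n)%N -> (1 <= k <= n)%N -> (1 <= j <= n)%N -> i <> k ->
     (fun p : (R * R) * R =>
        fine (P ([set w | p.1.1 < `|X i w|] `&` [set w | p.1.2 < X k w] `&` [set w | p.2 < Y j w]))
        / fine (P ([set w | p.1.2 < X k w] `&` [set w | p.2 < Y j w])))
       @ xyz_infty --> (0 : R)) /\
  (forall j k i : nat, (1 <= j <= n)%N -> (1 <= k <= n)%N -> (1 <= i <= n)%N -> j <> k ->
     (fun p : (R * R) * R =>
        fine (P ([set w | p.1.1 < `|Y j w|] `&` [set w | p.1.2 < X i w] `&` [set w | p.2 < Y k w]))
        / fine (P ([set w | p.1.2 < X i w] `&` [set w | p.2 < Y k w])))
       @ xyz_infty --> (0 : R)).

End RiskDefs.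

(* Main.v *)
Require Import Defs.
From HB Require Import structures.
From mathcomp Require Import all_boot all_order all_algebra.
From mathcomp Require Import all_classical all_reals all_analysis.
From mathcomp Require Import measurable_realfun ring lra.
Import Order.TTheory GRing.Theory Num.Theory.
Import numFieldNormedType.Exports.
Set Implicit Arguments. Unset Strict Implicit. Unset Printing Implicit Defensive.
Local Open Scope classical_set_scope.
Local Open Scope ring_scope.

(** Ruin of both lines before T forces, up to negligible events, a pair of claims X_i, Y_j
    with arrivals T_i, T_j <= T such that X_i e^{-r T_i} > x and Y_j e^{-r T_j} > y: the class L
    makes the premium income and the remaining claims invisible, and GTAI discards the
    scenarios with three large claims. Conversely a single such pair ruins both lines at
    time T on the event that the premiums are bounded, and by Bonferroni and GTAI the
    probability of the union over the pairs is the sum of the probabilities. By SAI for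
    i = j and independence for i <> j that sum is asymptotic to
      sum_(i, j) c_ij E[1_{T_i, T_j <= T} Fbar(x e^{r T_i}) Gbar(y e^{r T_j})],
    with c_ii = C and c_ij = 1 otherwise; since T_(i+m) - T_i is independent of T_i and
    distributed like T_m, this is Delta(x, y; T). Many claims are negligible because
    P(T_m <= T) decays faster than every geometric sequence, whereas the class D costs only a
    factor K^m when the thresholds are divided by m. *)

(** The thresholds beyond which GTAI takes effect depend on the number n of claims, while Delta
    carries all pairs; so n must be fixed before x and y grow, and what it discards must be small
    uniformly in x and y. Every error is therefore measured in one unit, Fbar(x) Gbar(y): truncating
    Delta and discarding the event of more than n arrivals both cost a constant times 2^-n of that
    unit. The class D and lambda(T) > 0 bound the unit by a constant times Delta, through the single
    term i = j = 1, and so turn these errors into relative ones. Simultaneous ruin being a case of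
    ruin of both lines, a lower bound for psi_max and an upper bound for psi_and suffice. Comparing
    probabilities takes measurable events: ruin is an uncountable union over times, reduced to
    rational times by right continuity, and the discounted premium is an integral against a random
    measure. *)

(** * Real-valued probabilities: union bound and Bonferroni inequality *)

Section RealProbability.
Context d (Omega : measurableType d) (R : realType) (P : probability Omega R).
Implicit Types A B : set Omega.

Definition pr A : R := fine (P A).

Lemma prE A : measurable A -> P A = (pr A)%:E.
Proof. by move=> mA; rewrite fineK // fin_num_measure. Qed.

Lemma pr_ge0 A : measurable A -> 0 <= pr A.
Proof. by move=> mA; rewrite fine_ge0. Qed.

Lemma pr_le1 A : measurable A -> pr A <= 1.
Proof. by move=> mA; rewrite -lee_fin -prE // probability_le1. Qed.

Lemma pr_set0 : pr set0 = 0.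
Proof. by rewrite /pr measure0. Qed.

Lemma le_pr A B : measurable A -> measurable B -> A `<=` B -> pr A <= pr B.
Proof. by move=> mA mB AB; rewrite -lee_fin -!prE // le_measure // inE. Qed.

Lemma pr_setID A B : measurable A -> measurable B ->
  pr A = pr (A `&` B) + pr (A `\` B).
Proof.
move=> mA mB; apply: EFin_inj.
have mI := measurableI _ _ mA mB; have mD := measurableD mA mB.
by rewrite EFinD -!prE // addeC -measureDI.
Qed.

Lemma pr_bigcup_le (I : eqType) (s : seq I) (A : I -> set Omega) B :
  (forall i, measurable (A i)) -> measurable B ->
  (forall w, B w -> exists2 i, i \in s & A i w) ->
  pr B <= \sum_(i <- s) pr (A i).
Proof.
move=> mA; elim: s B => [|i s IHs] B mB sub.
  rewrite big_nil; suff -> : B = set0 by rewrite pr_set0.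
  by apply/seteqP; split => // w /sub[].
rewrite big_cons (pr_setID mB (mA i)); apply: lerD.
  by apply: le_pr => //; exact: measurableI.
apply: IHs => [|w [/sub[j]]]; first exact: measurableD.
by rewrite inE => /orP[/eqP-> //|js] Aj _; exists j.
Qed.

(** Removing [A i] from the other sets and from [B] leaves the same inequality for a shorter list;
    the overlaps with [A i] lost on the way are terms of the double sum. That sum runs over ordered
    pairs and counts each overlap twice, which is harmless for a term to be shown negligible. *)
Lemma pr_bonferroni (I : eqType) (s : seq I) (A : I -> set Omega) B :
  uniq s -> (forall i, measurable (A i)) -> measurable B ->
  (forall i, A i `<=` B) ->
  \sum_(i <- s) pr (A i) <=
    pr B + \sum_(i <- s) \sum_(j <- s | j != i) pr (A i `&` A j).
Proof.
elim: s A B => [|i s IHs] A B /=; first by rewrite !big_nil addr0 => *; exact: pr_ge0.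
move=> /andP[si us] mA mB AB.
have mI j k : measurable (A j `&` A k) by exact: measurableI.
have mD j : measurable (A j `\` A i) by exact: measurableD.
have sum_ge0 (r : seq I) (Q : pred I) (f : I -> I) (g : I -> I) :
  0 <= \sum_(j <- r | Q j) pr (A (f j) `&` A (g j)).
  by apply: sumr_ge0 => j _; exact: pr_ge0.
rewrite !big_cons eqxx /= (pr_setID mB (mA i)).
have -> : B `&` A i = A i by apply/setIidr/AB.
have -> : \sum_(j <- s) pr (A j) =
    \sum_(j <- s) pr (A j `&` A i) + \sum_(j <- s) pr (A j `\` A i).
  by rewrite -big_split; apply: eq_bigr => j _; exact: pr_setID.
have {}IHs := IHs (fun j => A j `\` A i) (B `\` A i) us mD (measurableD mB (mA i))
  (fun j => setSD (AB j)).
have le1 : \sum_(j <- s) \sum_(k <- s | k != j) pr ((A j `\` A i) `&` (A k `\` A i))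
    <= \sum_(j <- s) \sum_(k <- s | k != j) pr (A j `&` A k).
  apply: ler_sum => j _; apply: ler_sum => k _; apply: le_pr => //.
    exact: measurableI.
  by move=> w [[? _] [? _]].
have -> : \sum_(j <- s) \sum_(k <- i :: s | k != j) pr (A j `&` A k) =
    \sum_(j <- s) pr (A j `&` A i) + \sum_(j <- s) \sum_(k <- s | k != j) pr (A j `&` A k).
  rewrite -big_split /= big_seq_cond [RHS]big_seq_cond; apply: eq_bigr => j /andP[js _].
  by rewrite big_cons; case: eqP => // ij; move: si; rewrite ij js.
have := sum_ge0 s (fun j => j != i) (fun=> i) id.
lra.
Qed.

End RealProbability.

(** * Quantitative forms of the classes D and L *)

Section Tails.
Context {R : realType} (V : R -> R).
Hypothesis V_gt0 : forall x, 0 < V x.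
Hypothesis V_le1 : forall x, V x <= 1.
Hypothesis V_ni : forall x y, x <= y -> V y <= V x.

(** The class D gives one ratio [t], near infinity only. Powers of [t] reach below 1/2, and on the
    remaining range [u <= x0] the tail is bounded below by its value at [u0], so that a constant
    absorbs it. *)
Lemma classD_half : classD V ->
  exists2 K, 1 <= K & forall u, 0 <= u -> V (u / 2) <= K * V u.
Proof.
case=> t [/andP[t0 t1] [M [x0 [_ hM]]]].
pose u0 := Num.max x0 0 + 1.
(* [M] serves above [x0] and [(V u0)^-1] below it, since [V <= 1]; the 1 makes the powers of [K1] at
   least 1. *)
pose K1 := Num.max (Num.max M (V u0)^-1) 1.
have K1_ge1 : 1 <= K1 by rewrite le_max lexx orbT.
have step u : 0 <= u -> V (t * u) <= K1 * V u.
  move=> u_ge0; have [ux0|ux0] := ltP x0 u.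
    have := hM _ ux0; rewrite ler_pdivrMr // => /le_trans; apply.
    by rewrite ler_pM2r // !le_max lexx.
  have : (V u0)^-1 * V u <= K1 * V u by rewrite ler_pM2r // !le_max lexx orbT.
  apply: le_trans; rewrite ler_pdivlMl //.
  have uu0 : u <= u0 by apply: le_trans ux0 _; rewrite /u0 ler_wpDr // le_max lexx.
  by rewrite (le_trans _ (V_ni uu0)) // ler_piMr // ltW.
have iter a u : 0 <= u -> V (t ^+ a * u) <= K1 ^+ a * V u.
  elim: a u => [|a IHa] u u_ge0; first by rewrite !expr0 !mul1r.
  rewrite !exprS -!mulrA; apply: le_trans (step _ _) _.
    by rewrite mulr_ge0 // exprn_ge0 // ltW.
  by rewrite ler_pM2l ?IHa // (lt_le_trans ltr01).
have [a ta] : exists a, t ^+ a <= 2^-1.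
  have : t ^+ n @[n --> \oo] --> (0 : R).
    by apply: cvg_expr; rewrite gtr0_norm.
  move=> /cvgr_le /(_ 2^-1); rewrite invr_gt0 ltr0n => /(_ isT).
  by case=> a _ /(_ a (leqnn a)) ?; exists a.
exists (K1 ^+ a); first exact: exprn_ege1.
move=> u u_ge0; apply: le_trans (iter a u u_ge0); apply: V_ni.
by rewrite mulrC ler_wpM2l.
Qed.

(** m halvings divide by 2^m >= m. About log2 m of them would do, but the geometric cost [K ^+ m] is
    affordable against the superexponential decay of P(T_m <= T). *)
Lemma tail_divn K m u :
  (forall u, 0 <= u -> V (u / 2) <= K * V u) -> 0 <= K -> (0 < m)%N -> 0 <= u ->
  V (u / m%:R) <= K ^+ m * V u.
Proof.
move=> hK K_ge0 m_gt0 u_ge0.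
have iter a v : 0 <= v -> V (v / 2 ^+ a) <= K ^+ a * V v.
  elim: a v => [|a IHa] v v_ge0; first by rewrite !expr0 mul1r invr1 mulr1.
  have -> : v / 2 ^+ a.+1 = v / 2 ^+ a / 2 by rewrite exprSr invfM mulrA.
  apply: le_trans (hK _ _) _; first by rewrite divr_ge0 // exprn_ge0.
  by rewrite exprS -mulrA ler_wpM2l // IHa.
apply: le_trans (iter m u u_ge0); apply: V_ni.
rewrite ler_wpM2l // lef_pV2 ?posrE ?exprn_gt0 ?ltr0n //.
by rewrite -natrX ler_nat ltnW // ltn_expl.
Qed.

(** Meant for [b] = e^{rT}, the largest factor by which discounting up to T raises a threshold. *)
Lemma tail_scale b : classD V ->
  exists2 K, 1 <= K & forall u, 0 <= u -> V u <= K * V (b * u).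
Proof.
case/classD_half => K K_ge1 hK.
pose m := (Num.bound b).+1.
exists (K ^+ m); first exact: exprn_ege1.
move=> u u_ge0.
have mu : 0 <= m%:R * u by rewrite mulr_ge0.
have := tail_divn hK (le_trans ler01 K_ge1) (ltn0Sn (Num.bound b)) mu.
rewrite mulrAC divff ?pnatr_eq0 // mul1r => /le_trans; apply.
rewrite ler_wpM2l // ?exprn_ge0 ?(le_trans ler01) //; apply: V_ni.
by rewrite ler_wpM2r // ltW // (lt_le_trans (unstable.ltr_bound b)) // ler_nat leqnSn.
Qed.

Lemma classL_shift a e : classL V -> 0 <= a -> 0 < e ->
  exists x0, forall x, x0 <= x -> V x <= (1 + e) * V (x + a).
Proof.
move=> VL; rewrite le_eqVlt => /orP[/eqP<- e_gt0|a_gt0 e_gt0].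
  by exists 0 => x _; rewrite addr0 ler_peMl ?lerDl // ltW.
have /cvgr_le/(_ (1 + e)) := VL a a_gt0.
rewrite ltrDl => /(_ e_gt0) [x0 [_ h]].
exists x0 => x xx0; have := h (x + a).
rewrite addrK ler_pdivrMr //; apply; apply: le_lt_trans xx0 _.
by rewrite ltrDl.
Qed.

End Tails.

(** * Joint laws are determined by rectangles *)

Lemma rectangle_measure_unique d1 d2 (T1 : measurableType d1) (T2 : measurableType d2)
    (R : realType) (m m' : {measure set (T1 * T2) -> \bar R}) :
  (m setT < +oo)%E ->
  (forall A B, measurable A -> measurable B -> m (A `*` B) = m' (A `*` B)) ->
  forall E, measurable E -> m E = m' E.
Proof.
move=> m_fin mm' E mE.
pose G : set (set (T1 * T2)) :=
  [set C | exists A, measurable A /\ exists B, measurable B /\ C = A `*` B].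
apply: (measure_unique G (fun=> setT)) => //.
- rewrite measurable_prod_measurableType //; congr (<<s _ >>).
  rewrite predeqE; split => [[A mA [B mB <-]]|[A [mA [B [mB ->]]]]].
    by exists A; split => //; exists B.
  by exists A => //; exists B.
- move=> _ _ [A1 [mA1 [B1 [mB1 ->]]]] [A2 [mA2 [B2 [mB2 ->]]]].
  rewrite -setXI; exists (A1 `&` A2); split; first exact: measurableI.
  by exists (B1 `&` B2); split => //; exact: measurableI.
- by move=> _; exists setT; split => //; exists setT; rewrite setXTT.
- by rewrite bigcup_const.
- by move=> _ [A [mA [B [mB ->]]]]; exact: mm'.
Qed.

Section PairLaw.
Context d d' d1 d2 (T : measurableType d) (T' : measurableType d')
  (T1 : measurableType d1) (T2 : measurableType d2) (R : realType).

(** The two pairs may live on different spaces, so that a factorization on rectangles identifies a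
    joint law with one built on a product space. *)
Lemma pair_law_unique (mu : {measure set T -> \bar R}) (mu' : {measure set T' -> \bar R})
    (f : T -> T1) (g : T -> T2) (f' : T' -> T1) (g' : T' -> T2) :
  measurable_fun setT f -> measurable_fun setT g ->
  measurable_fun setT f' -> measurable_fun setT g' -> (mu setT < +oo)%E ->
  (forall A B, measurable A -> measurable B ->
    mu (f @^-1` A `&` g @^-1` B) = mu' (f' @^-1` A `&` g' @^-1` B)) ->
  forall E, measurable E ->
    mu ((fun w => (f w, g w)) @^-1` E) = mu' ((fun w => (f' w, g' w)) @^-1` E).
Proof.
move=> mf mg mf' mg' mu_fin mumu'.
have mfg := measurable_fun_pair mf mg; have mfg' := measurable_fun_pair mf' mg'.
pose m := measure_function_pushforward__canonical__measure_function_Measure mu mfg.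
pose m' := measure_function_pushforward__canonical__measure_function_Measure mu' mfg'.
exact: (@rectangle_measure_unique _ _ _ _ _ m m').
Qed.

End PairLaw.

(** * Arrival times: independence of increments and decay of P(T_m <= t) *)

Section Arrivals.
Context d (Omega : measurableType d) (R : realType) (P : probability Omega R).
Variable theta : nat -> Omega -> R.
Hypothesis mtheta : forall i, measurable_fun setT (theta i).
Hypothesis theta_pos : forall i w, 0 < theta i w.
Hypothesis theta_indep : indep_seq P theta.
Hypothesis theta_id : forall i (B : set R), (1 <= i)%N -> measurable B ->
  P (theta i @^-1` B) = P (theta 1%N @^-1` B).

(** The increment T_(a+m-1) - T_(a-1); [block_sum 1 m] is convertible to [arrival theta m]. *)
Definition block_sum a m w := \sum_(a <= k < a + m) theta k w.

Lemma measurable_block_sum a m : measurable_fun setT (block_sum a m).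
Proof. by apply: measurable_sum => k. Qed.

Let measurable_preimage (f : Omega -> R) (B : set R) :
  measurable_fun setT f -> measurable B -> measurable (f @^-1` B).
Proof. by move=> mf mB; rewrite -[_ @^-1` _]setTI; exact: mf. Qed.

Let cylinder (s : seq nat) (B : nat -> set R) :=
  \big[setI/setT]_(i <- s) (theta i @^-1` B i).

Let measurable_cylinder s B :
  (forall i, measurable (B i)) -> measurable (cylinder s B).
Proof.
by move=> mB; apply: bigsetI_measurable => i _; exact: measurable_preimage.
Qed.

(** Up to its total mass, [mu] makes the interarrival times of the block i.i.d. with the law of
    [theta 1]. Allowing any finite measure lets [P] restricted to an event be treated like [P]
    itself. *)
Let product_form (mu : set Omega -> \bar R) (a m : nat) :=
  forall s B, uniq s -> all (fun k => a <= k < a + m)%N s ->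
    (forall i, measurable (B i)) ->
    mu (cylinder s B) = (mu setT * \prod_(i <- s) P (theta 1%N @^-1` B i))%E.

Let product_form_prob a m : (1 <= a)%N -> product_form P a m.
Proof.
move=> a_gt0 s B us /allP sa mB; rewrite probability_setT mul1e.
have s1 : all (leq 1) s.
  by apply/allP => k /sa /andP[+ _]; exact: leq_trans.
rewrite /cylinder theta_indep // big_seq [RHS]big_seq.
by apply: eq_bigr => i /(allP s1) i1; rewrite theta_id.
Qed.

Lemma block_sumS a m w : block_sum a m.+1 w = theta a w + block_sum a.+1 m w.
Proof. by rewrite /block_sum addnS big_ltn ?addSn // ltnS leq_addr. Qed.

(** Induction peeling off the first interarrival time: restricting [mu] to an event on [theta a]
    preserves the product form on the rest of the block. This gives the law of the pair (first time,
    remaining sum) on rectangles, hence that of its sum. The induction only closes because [mu] and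
    [a] are general. *)
Let block_sum_law m : forall a (mu : {measure set Omega -> \bar R}),
  (mu setT < +oo)%E -> product_form mu a m -> forall B, measurable B ->
  mu (block_sum a m @^-1` B) = (mu setT * P (block_sum 1 m @^-1` B))%E.
Proof.
elim: m => [|m IHm] a mu mu_fin muH B mB.
  have bE b : block_sum b 0 = cst 0.
    by apply/funext => w; rewrite /block_sum addn0 big_geq.
  rewrite !bE !preimage_cst; case: ifP => _.
    by rewrite probability_setT mule1.
  by rewrite !measure0 mule0.
have muE : forall b (nu : {measure set Omega -> \bar R}), (nu setT < +oo)%E ->
  product_form nu b m.+1 -> forall A1 A2, measurable A1 -> measurable A2 ->
  nu (theta b @^-1` A1 `&` block_sum b.+1 m @^-1` A2) =
  (nu setT * (P (theta 1%N @^-1` A1) * P (block_sum 1 m @^-1` A2)))%E.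
  move=> b nu nu_fin nuH A1 A2 mA1 mA2.
  have mD : measurable (theta b @^-1` A1) by exact: measurable_preimage.
  have nuA1 : nu (theta b @^-1` A1) = (nu setT * P (theta 1%N @^-1` A1))%E.
    have := nuH [:: b] (fun=> A1) isT.
    rewrite /= leqnn addnS ltnS leq_addr => /(_ isT (fun=> mA1)).
    by rewrite /cylinder !big_seq1.
  have := IHm b.+1 (mrestr nu mD).
  rewrite /= /mrestr setTI setIC => ->//.
  - by rewrite nuA1 muleA.
  - by rewrite (le_lt_trans _ nu_fin) // le_measure // inE.
  - move=> s C us sb mC; rewrite /= setTI nuA1.
    pose C' k := if k == b then A1 else C k.
    have bs : b \notin s by apply/negP => /(allP sb); rewrite ltnn.
    have := nuH (b :: s) C'; rewrite /= bs us leqnn addnS ltnS leq_addr /=.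
    have -> : all (fun k => b <= k < (b + m).+1)%N s.
      by apply/allP => k /(allP sb); rewrite addSn => /andP[/ltnW -> ->].
    have mC' i : measurable (C' i) by rewrite /C'; case: ifP.
    move=> /(_ isT isT mC'); rewrite /cylinder !big_cons {1 3}/C' eqxx setIC muleA.
    have C'C k : k \in s -> C' k = C k.
      by rewrite /C'; case: eqP => // -> ; rewrite (negbTE bs).
    rewrite big_seq [in RHS]big_seq.
    under eq_bigr do rewrite C'C //.
    under [in RHS]eq_bigr do rewrite C'C //.
    by rewrite -!big_seq.
have c_ge0 : 0 <= fine (mu setT) by rewrite fine_ge0.
have cE : (fine (mu setT))%:E = mu setT by rewrite fineK // ge0_fin_numE.
pose E : set (R * R) := (fun u => u.1 + u.2) @^-1` B.
have mE : measurable E by rewrite -[E]setTI; apply: measurable_funD.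
have blockE b : block_sum b m.+1 @^-1` B = (fun w => (theta b w, block_sum b.+1 m w)) @^-1` E.
  by apply/seteqP; split => w; rewrite /E /= block_sumS.
rewrite !blockE -cE.
have mS b := measurable_block_sum b m.
rewrite (pair_law_unique (mu' := mscale (NngNum c_ge0) P) (f' := theta 1%N)
  (g' := block_sum 2 m)) // => A1 A2 mA1 mA2.
rewrite muE // /= /mscale /= cE muE //.
- by congr (_ * _)%E; rewrite -[LHS]mul1e; congr (_ * _)%E; exact/esym/probability_setT.
- by apply: (@le_lt_trans _ _ 1%E); [exact: probability_le1 | rewrite ltry].
- exact: product_form_prob.
Qed.

(** The law of the later block is computed under [P] restricted to the event that T_i lies in [A];
    what remains is the product form of that restricted measure. *)
Lemma arrival_split i m A B : measurable A -> measurable B ->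
  P (arrival theta i @^-1` A `&` block_sum i.+1 m @^-1` B) =
  (P (arrival theta i @^-1` A) * P (arrival theta m @^-1` B))%E.
Proof.
move=> mA mB.
have mD : measurable (arrival theta i @^-1` A).
  exact: (measurable_preimage (measurable_block_sum 1 i) mA).
have := @block_sum_law m i.+1 (mrestr P mD).
rewrite /= /mrestr setTI setIC => -> //.
  by rewrite (le_lt_trans (probability_le1 P mD)) ?ltry.
move=> s C us si mC; rewrite /= setTI.
have mS := measurable_cylinder s mC.
(* Roles exchanged: under [P] restricted to a cylinder of the later block, the same lemma gives the
   law of T_i. Its product form is the independence of the indices [s' ++ s]. *)
have := @block_sum_law i 1 (mrestr P mS).
rewrite /= /mrestr setTI => H; rewrite setIC [LHS]H //; first last.
- move=> s' C' us' si' mC'; rewrite /= setTI.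
  pose C'' k := if k \in s then C k else C' k.
  have mC'' k : measurable (C'' k) by rewrite /C''; case: ifP.
  have ss' k : k \in s' -> (k \in s) = false.
    move=> /(allP si'); rewrite add1n => /andP[_ ki]; apply/negP => /(allP si).
    by rewrite leqNgt ki.
  have us's : uniq (s' ++ s).
    rewrite cat_uniq us us' andbT /=; apply/hasPn => k ks /=.
    by apply/negP => /ss'; rewrite ks.
  have s's : all (leq 1) (s' ++ s).
    apply/allP => k; rewrite mem_cat => /orP[/(allP si')/andP[]//|/(allP si)/andP[+ _]].
    exact: leq_trans.
  have e1 : \big[setI/setT]_(k <- s') (theta k @^-1` C' k) =
            \big[setI/setT]_(k <- s') (theta k @^-1` C'' k).
    by rewrite big_seq [RHS]big_seq; apply: eq_bigr => k /ss' ks; rewrite /C'' ks.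
  have e2 : \big[setI/setT]_(k <- s) (theta k @^-1` C k) =
            \big[setI/setT]_(k <- s) (theta k @^-1` C'' k).
    by rewrite big_seq [RHS]big_seq; apply: eq_bigr => k ks; rewrite /C'' ks.
  have e3 : (\prod_(k <- s') P (theta 1%N @^-1` C' k) =
            \prod_(k <- s') P (theta k @^-1` C'' k))%E.
    rewrite big_seq [RHS]big_seq; apply: eq_bigr => k ks.
    have /andP[k1 _] := allP si' _ ks.
    by rewrite theta_id // /C'' ss'.
  have := theta_indep us's s's mC''; rewrite !big_cat /= -e1 -e2 -e3 => ->.
  have := theta_indep (subseq_uniq (suffix_subseq s' s) us's) _ mC''.
  rewrite -e2 => ->; first by rewrite muleC.
  by move: s's; rewrite all_cat => /andP[].
- by rewrite (le_lt_trans (probability_le1 P mS)) ?ltry.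
- rewrite muleC; congr (_ * _)%E.
  have := @product_form_prob i.+1 m isT s C us si mC.
  by rewrite probability_setT mul1e.
Qed.

Let count_tail t i := pr P [set w | arrival theta i w <= t].

Let mle (f : Omega -> R) t : measurable_fun setT f -> measurable [set w | f w <= t].
Proof.
move=> mf; have := measurable_preimage mf (measurable_itv `]-oo, t]).
by congr (measurable _); apply/seteqP; split => w /=; rewrite in_itv.
Qed.

Lemma measurable_arrival i : measurable_fun setT (arrival theta i).
Proof. exact: (measurable_block_sum 1 i). Qed.

Lemma arrival_ge0 i w : 0 <= arrival theta i w.
Proof. by apply: sumr_ge0 => k _; exact: ltW. Qed.

Lemma arrivalS i w : arrival theta i.+1 w = arrival theta i w + theta i.+1 w.
Proof. by rewrite /arrival big_nat_recr. Qed.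

Lemma arrival_gt0 i w : (0 < i)%N -> 0 < arrival theta i w.
Proof. by case: i => // i _; rewrite arrivalS ltr_wpDl ?arrival_ge0. Qed.

(** The events theta_1 <= 1/(n+1) decrease to the empty set because theta_1 is positive. *)
Let exists_small_gap q : 0 < q -> exists2 a, 0 < a & pr P [set w | theta 1%N w <= a] <= q.
Proof.
move=> q0; pose F n := [set w | theta 1%N w <= n.+1%:R^-1].
have mF n : measurable (F n) by exact: mle.
have F0 : \bigcap_n F n = set0.
  apply/seteqP; split => // w Fw; have := theta_pos 1%N w.
  rewrite -[0]/(0 : R); apply/negP; rewrite -leNgt.
  apply/ler_addgt0Pr => e e0; rewrite add0r.
  have [n] : exists n, n.+1%:R^-1 < e.
    exists (Num.bound e^-1); rewrite invf_plt ?posrE //.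
    by rewrite (lt_trans (unstable.ltr_bound _)) // ltr_nat.
  by move/ltW; apply: le_trans; exact: Fw.
have : (P \o F) n @[n --> \oo] --> P (\bigcap_n F n).
  apply: nonincreasing_cvg_mu => //.
  - by rewrite (le_lt_trans (probability_le1 P (mF 0%N))) ?ltry.
  - by rewrite F0.
  - move=> m n mn; apply/subsetPset => w /= /le_trans; apply.
    by rewrite lef_pV2 ?posrE // ler_nat ltnS.
rewrite F0 measure0 => /fine_cvgP[_] /cvgr_le /(_ q q0) [n _ /(_ n (leqnn n)) Fq].
by exists n.+1%:R^-1.
Qed.

(* With [P(theta <= a) <= rho / 2], splitting on the last interarrival time gives
   [P(T_(m+1) <= t) <= rho/2 P(T_m <= t) + P(T_m <= t - a)]; iterate in units of [a]. *)
Lemma arrival_superexponential t rho : 0 < rho <= 1 ->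
  exists2 K, 0 < K & forall m, pr P [set w | arrival theta m w <= t] <= K * rho ^+ m.
Proof.
case/andP=> rho0 rho1.
have [a a0 aq] : exists2 a, 0 < a & pr P [set w | theta 1%N w <= a] <= rho / 2.
  by apply: exists_small_gap; rewrite divr_gt0.
have mA m u : measurable [set w | arrival theta m w <= u].
  exact/mle/measurable_arrival.
have rec u m : count_tail u m.+1 <= rho / 2 * count_tail u m + count_tail (u - a) m.
  pose B := [set w | arrival theta m w <= u] `&` [set w | theta m.+1 w <= a].
  have mth : measurable [set w | theta m.+1 w <= a] by exact: mle.
  have prB : pr P B <= rho / 2 * count_tail u m.
    have := @arrival_split m 1 `]-oo, u]%classic `]-oo, a]%classic.
    have -> : arrival theta m @^-1` `]-oo, u] `&` block_sum m.+1 1 @^-1` `]-oo, a] = B.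
      apply/seteqP; split => w; rewrite /B /= !in_itv /= /block_sum addn1 big_nat1 //.
    have -> : arrival theta m @^-1` `]-oo, u] = [set w | arrival theta m w <= u].
      by apply/seteqP; split => w; rewrite /= in_itv.
    have -> : arrival theta 1 @^-1` `]-oo, a] = [set w | theta 1%N w <= a].
      by apply/seteqP; split => w; rewrite /= in_itv /= /arrival big_nat1.
    move=> /(_ (measurable_itv _) (measurable_itv _)) PB.
    have mth1 : measurable [set w | theta 1%N w <= a] by exact: mle.
    have -> : pr P B = count_tail u m * pr P [set w | theta 1%N w <= a].
      by apply: EFin_inj; rewrite EFinM -!prE //; exact: measurableI.
    by rewrite mulrC ler_wpM2r // pr_ge0.
  apply: (@le_trans _ _ (pr P B + count_tail (u - a) m)); last by rewrite lerD2r.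
  have := @pr_bigcup_le _ _ _ P _ [:: true; false]
    (fun b : bool => if b then B else [set w | arrival theta m w <= u - a])
    [set w | arrival theta m.+1 w <= u].
  rewrite !big_cons big_nil addr0; apply => //.
    by case=> //; exact: measurableI.
  move=> w /=; rewrite arrivalS => uw.
  have := theta_pos m.+1 w; have [tha|tha] := leP (theta m.+1 w) a => th0.
    by exists true; rewrite ?inE //; split => //=; lra.
  by exists false; rewrite ?inE //=; lra.
have r2 : 1 <= 2 / rho by rewrite ler_pdivlMr // mul1r (le_trans rho1) // ler1n.
(* Induction on the number [J] of units of [a] in the time, then on [m]. The factor (2/rho)^J is
   tuned so that each of the two terms of the recursion is half of the new bound; for J = 0
   positivity of the arrivals leaves only m = 0. *)
have main J : forall u, u <= a * J%:R -> forall m, count_tail u m <= (2 / rho) ^+ J * rho ^+ m.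
  elim: J => [|J IHJ] u uJ.
    case=> [|m]; first by rewrite !expr0 mulr1 pr_le1.
    rewrite /count_tail (_ : [set _ | _] = set0) ?pr_set0.
      by rewrite expr0 mul1r exprn_ge0 // ltW.
    apply/seteqP; split => // w /= Tu; have := @arrival_gt0 m.+1 w isT.
    by rewrite mulr0 in uJ; lra.
  elim=> [|m IHm].
    by rewrite expr0 mulr1 (le_trans (pr_le1 P (mA _ _))) // exprn_ege1.
  apply: le_trans (rec u m) _.
  have uaJ : u - a <= a * J%:R by move: uJ; rewrite -natr1 mulrDr mulr1; lra.
  have := IHJ _ uaJ m; move: IHm; rewrite !exprS.
  set x := count_tail u m; set y := count_tail _ m; set p := (2 / rho) ^+ J.
  set z := rho ^+ m => hx hy.
  have -> : 2 / rho * p * (rho * z) = rho / 2 * (2 / rho * p * z) + p * z.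
    by field; rewrite gt_eqF.
  by rewrite lerD // ler_wpM2l // divr_ge0 // ltW.
exists ((2 / rho) ^+ Num.bound (t / a)).
  by rewrite exprn_gt0 // divr_gt0.
apply: main; rewrite mulrC -ler_pdivrMr //; exact/ltW/unstable.ltr_bound.
Qed.

End Arrivals.

(** * The discounted premium: measurability and increments *)

Section Premium.
Context (R : realType).
Implicit Type C : cumulative R R.

Lemma lebesgue_stieltjes_itvoc C (a b : R) : a <= b ->
  lebesgue_stieltjes_measure C `]a, b]%classic = (C b - C a)%:E.
Proof.
move=> ab; rewrite /lebesgue_stieltjes_measure /measure_extension.
rewrite measurable_mu_extE; last exact: is_ocitv.
rewrite /= wlength_itv /= lte_fin; case: ltgtP ab => // -> _.
by rewrite subrr.
Qed.

Lemma lebesgue_stieltjes_itvoc_cond C (a b : R) :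
  lebesgue_stieltjes_measure C `]a, b]%classic = (if a <= b then C b - C a else 0)%:E.
Proof.
case: leP => ab; first exact: lebesgue_stieltjes_itvoc.
by rewrite set_itv_ge ?measure0 // bnd_simp -leNgt ltW.
Qed.

(** The sets whose mass within ]-n, n] depends measurably on [w] form a Dynkin class, the finite
    mass there giving complements by subtraction. Half-open intervals belong to it through the
    explicit mass C(b) - C(a); n tends to infinity at the end. *)
Lemma measurable_lebesgue_stieltjes d (T : measurableType d) (C : T -> cumulative R R)
    (U : set (measurableTypeR R)) :
  (forall t, measurable_fun setT (fun w => C w t)) -> measurable U ->
  measurable_fun setT (fun w => lebesgue_stieltjes_measure (C w) U).
Proof.
move=> mC mU.
pose D n : set (measurableTypeR R) := `]- n%:R, n%:R]%classic.
have mD n : measurable (D n) by exact: (measurable_itv `]- n%:R, n%:R]).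
have D_fin w n : lebesgue_stieltjes_measure (C w) (D n) = (C w n%:R - C w (- n%:R))%:E.
  by rewrite lebesgue_stieltjes_itvoc // (@le_trans _ _ 0) // oppr_le0.
have mDU n (V : set (measurableTypeR R)) : measurable V ->
    measurable_fun setT (fun w => lebesgue_stieltjes_measure (C w) (V `&` D n)).
  have gE : @measurable _ (measurableTypeR R) = <<s @ocitv R >> by [].
  move=> mV; have := mV; rewrite gE.
  apply: (@dynkin_induction _ (measurableTypeR R) (@ocitv R)
    (fun V => measurable_fun setT
      (fun w => lebesgue_stieltjes_measure (C w) (V `&` D n)))) => //.
  - exact: ocitvI.
  - under eq_fun do rewrite setTI D_fin.
    by apply/measurable_EFinP/measurable_funB.
  - move=> _ [[a b] _ <-] /=.
    have -> : `]a, b]%classic `&` D n =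
        `](Num.max a (- n%:R)), (Num.min b n%:R)]%classic :> set R.
      by apply/seteqP; split => x; rewrite /D /= !in_itv /= gt_max le_min;
        [move=> [/andP[-> ->] /andP[-> ->]] | move=> /andP[/andP[-> ->] /andP[-> ->]]].
    under eq_fun do rewrite lebesgue_stieltjes_itvoc_cond.
    apply/measurable_EFinP.
    case: (Num.max _ _ <= _); last exact: measurable_cst.
    exact: measurable_funB.
  - move=> S mS mSD.
    have E w : lebesgue_stieltjes_measure (C w) (~` S `&` D n) =
        ((C w n%:R - C w (- n%:R))%:E - lebesgue_stieltjes_measure (C w) (S `&` D n))%E.
      have D_lty : (lebesgue_stieltjes_measure (C w) (D n) < +oo)%E.
        by rewrite D_fin ltry.
      rewrite -D_fin setIC -setDE [S `&` _]setIC; exact: measureD.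
    under eq_fun do rewrite E.
    apply: emeasurable_funB => //; apply/measurable_EFinP.
    exact: measurable_funB.
  - move=> F mF tF mFD; under eq_fun do rewrite setI_bigcupl.
    have E w : lebesgue_stieltjes_measure (C w) (\bigcup_i (F i `&` D n)) =
        (\sum_(0 <= i <oo) lebesgue_stieltjes_measure (C w) (F i `&` D n))%E.
      apply: measure_semi_bigcup => //.
      - by move=> i; exact: measurableI.
      - exact: trivIset_setIr.
      - by apply: bigcup_measurable => i _; exact: measurableI.
    under eq_fun do rewrite E.
    by apply: ge0_emeasurable_sum => // i w _ _; exact: measure_ge0.
apply: (@emeasurable_fun_cvg _ _ _ _
  (fun n w => lebesgue_stieltjes_measure (C w) (U `&` D n))).
  by move=> n; exact: mDU.
move=> w _.
have UE : U = \bigcup_n (U `&` D n).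
  apply/seteqP; split => [x Ux|x [n _ []//]].
  exists (Num.bound x) => //; split => //; rewrite /D /= in_itv /=.
  by rewrite ltrNl unstable.ltrNbound ltW // unstable.ltr_bound.
rewrite {2}UE; apply: nondecreasing_cvg_mu.
- by move=> n; exact: measurableI.
- by apply: bigcup_measurable => n _; exact: measurableI.
- move=> m n mn; apply/subsetPset => x [Ux]; rewrite /D /= !in_itv /=.
  move=> /andP[xm xm']; split => //; apply/andP; split.
    by rewrite (le_lt_trans _ xm) // lerN2 ler_nat.
  by rewrite (le_trans xm') // ler_nat.
Qed.

Let mexp (r : R) (D : set (measurableTypeR R)) : measurable_fun D (fun s => (expR (- r * s))%:E).
Proof. exact/measurable_EFinP/measurable_funTS/measurableT_comp. Qed.

Lemma measurable_disc_premium d (T : measurableType d) (C : T -> cumulative R R) (r t : R) :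
  (forall t, measurable_fun setT (fun w => C w t)) ->
  measurable_fun setT (fun w => disc_premium r (C w) t).
Proof.
move=> mC; rewrite /disc_premium; under eq_fun do rewrite integral_mkcond.
apply: (@measurable_fun_integral_kernel _ _ _ _ _
  (fun w => lebesgue_stieltjes_measure (C w))).
- by move=> U mU; exact: measurable_lebesgue_stieltjes.
- by move=> s; rewrite patchE; case: ifP => // _; rewrite lee_fin expR_ge0.
- apply/(measurable_restrictT _ _).1; last exact: mexp.
  exact: measurable_itv.
Qed.

Section Path.
Variables (C : cumulative R R) (r : R).
Hypothesis C0 : forall t, t <= 0 -> C t = 0.
Hypothesis r_ge0 : 0 <= r.

Let exp_le1 (s : R) : 0 <= s -> expR (- r * s) <= 1.
Proof. by move=> s0; rewrite -expR0 ler_expR mulNr oppr_le0 mulr_ge0. Qed.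

Lemma disc_premium_ge0 t : (0 <= disc_premium r C t)%E.
Proof. by apply: integral_ge0 => s _; rewrite lee_fin expR_ge0. Qed.

Let premium_bound (a b : R) (I : interval R) : a <= b ->
  {subset I <= `]a, b]} -> {subset I <= `[0, b]} ->
  (\int[lebesgue_stieltjes_measure C]_(s in [set` I]) (expR (- r * s))%:E <= (C b - C a)%:E)%E.
Proof.
move=> ab Iab I0; rewrite -lebesgue_stieltjes_itvoc //.
have mI : measurable ([set` I] : set (measurableTypeR R)) by exact: measurable_itv.
apply: (@le_trans _ _ (\int[lebesgue_stieltjes_measure C]_(s in [set` I]) cst 1 s)%E).
  apply: ge0_le_integral => //.
  by move=> s /I0; rewrite in_itv /= lee_fin => /andP[s0 _]; exact: exp_le1.
rewrite integral_cst // mul1e le_measure ?inE //; exact: (measurable_itv `]a, b]).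
Qed.

Lemma disc_premium_le t : 0 <= t -> (disc_premium r C t <= (C t)%:E)%E.
Proof.
(* The integral includes the point 0, which ]0, t] would miss; ]-1, t] covers it, and [C] vanishes
   at -1. *)
move=> t0; have := @premium_bound (-1) t `[0, t].
rewrite (C0 (t := -1)) ?lerN10 // subr0; apply.
- by rewrite (le_trans _ t0) // lerN10.
- move=> s; rewrite !in_itv /= => /andP[s0 ->]; rewrite andbT.
  by rewrite (lt_le_trans _ s0) // ltrN10.
- by [].
Qed.

Lemma disc_premium_fin t : 0 <= t -> disc_premium r C t \is a fin_num.
Proof.
move=> t0; rewrite ge0_fin_numE ?disc_premium_ge0 //.
by rewrite (le_lt_trans (disc_premium_le t0)) // ltry.
Qed.

(** Passes the right continuity of [C] on to the discounted premium, the discount factor being at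
    most 1. *)
Lemma disc_premium_increment s t : 0 <= s -> s <= t ->
  (disc_premium r C t <= disc_premium r C s + (C t - C s)%:E)%E.
Proof.
move=> s0 st.
have -> : disc_premium r C t = (disc_premium r C s +
    \int[lebesgue_stieltjes_measure C]_(u in `]s, t]) (expR (- r * u))%:E)%E.
  rewrite /disc_premium -ge0_integral_setU //.
  - congr (integral _ _ _); apply/seteqP; split => u /=; rewrite !in_itv /=.
      by move=> /andP[-> ut]; case: (leP u s) => us; [left|right].
    move=> [/andP[-> us]|/andP[su ->]]; first by rewrite (le_trans us).
    by rewrite andbT ltW // (le_lt_trans s0).
  - apply/disj_setPS => u []; rewrite /= !in_itv /= => /andP[_ us] /andP[su _].
    by move: su; rewrite ltNge us.
rewrite leeD2l // premium_bound // => u; rewrite !in_itv /= => /andP[su ->].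
by rewrite andbT ltW // (le_lt_trans s0).
Qed.

End Path.
End Premium.

(** * Hitting times through rational times *)

Section HittingTime.
Context (R : realType).

(** The shape of {t : U(t) < 0} for a right-continuous path U. *)
Definition right_open (Q : set R) :=
  forall t, 0 <= t -> Q t -> exists2 e, 0 < e & forall s, t <= s < t + e -> Q s.

Definition hitting_time (Q : set R) : \bar R :=
  ereal_inf [set t%:E | t in [set t : R | 0 < t /\ Q t]].

(** The infimum may be approached only from above, so [<= T] amounts to a hit before T + 1/(n+1) for
    every [n]; right openness moves that hit to a rational time. *)
Lemma hitting_time_leP (Q : set R) (T : R) : right_open Q ->
  (hitting_time Q <= T%:E)%E <->
  forall n : nat, exists2 q : rat, 0 < (ratr q : R) < T + n.+1%:R^-1 & Q (ratr q).
Proof.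
move=> Qopen; split => [QT n|QT].
  have : (hitting_time Q < (T + n.+1%:R^-1)%:E)%E.
    by rewrite (le_lt_trans QT) // lte_fin ltrDl invr_gt0.
  move=> /ereal_inf_lt[_ [t [t0 Qt] <-]]; rewrite lte_fin => tT.
  have [e e0 Qe] := Qopen t (ltW t0) Qt.
  have : t < Num.min (t + e) (T + n.+1%:R^-1) by rewrite lt_min tT ltrDl e0.
  move/rat_in_itvoo => [q]; rewrite in_itv /= lt_min => /and3P[tq qe qT].
  by exists q; [rewrite (lt_trans t0 tq) | apply: Qe; rewrite ltW].
apply/lee_addgt0Pr => e e0.
pose n := Num.bound e^-1.
have [q /andP[q0 qT] Qq] := QT n.
apply: (@le_trans _ _ (ratr q)%:E).
  by apply: ereal_inf_lbound; exists (ratr q).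
rewrite -EFinD lee_fin (le_trans (ltW qT)) // lerD2l ltW // invf_plt ?posrE //.
by rewrite (lt_trans (unstable.ltr_bound _)) // ltr_nat.
Qed.

Lemma measurable_hitting_time d (Omega : measurableType d) (Q : Omega -> set R) (T : R) :
  (forall w, right_open (Q w)) ->
  (forall t, 0 < t -> measurable [set w | Q w t]) ->
  measurable [set w | (hitting_time (Q w) <= T%:E)%E].
Proof.
move=> Qopen mQ.
rewrite (_ : [set _ | _] = \bigcap_(n : nat) \bigcup_(q : rat)
    if 0 < (ratr q : R) < T + n.+1%:R^-1 then [set w | Q w (ratr q)] else set0).
  apply: bigcapT_measurable => n; apply: bigcupT_measurable_rat => q.
  by case: ifP => // /andP[q0 _]; exact: mQ.
apply/seteqP; split => w /=; rewrite hitting_time_leP // => QT n.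
  by move=> _; have [q qT Qq] := QT n; exists q => //; rewrite qT.
by have [q _] := QT n I; case: ifP => // qT Qq; exists q.
Qed.

End HittingTime.

(** * Ruin events: measurability and their description by claims *)

Section Ruin.
Context d (Omega : measurableType d) (R : realType).
Variables (theta : nat -> Omega -> R) (r : R).
Hypothesis mtheta : forall i, measurable_fun setT (theta i).
Hypothesis theta_pos : forall i w, 0 < theta i w.
Hypothesis r_ge0 : 0 <= r.

Let marrival i : measurable_fun setT (arrival theta i).
Proof. exact: measurable_arrival. Qed.

Lemma arrival_le i j w : (i <= j)%N -> arrival theta i w <= arrival theta j w.
Proof.
move=> /subnKC <-; elim: (j - i)%N => [|k IHk]; first by rewrite addn0.
by rewrite addnS arrivalS (le_trans IHk) // lerDl ltW.
Qed.

Section OneLine.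
Variables (X : nat -> Omega -> R) (C : Omega -> cumulative R R).
Hypothesis mX : forall i, measurable_fun setT (X i).
Hypothesis mC : forall t, measurable_fun setT (fun w => C w t).
Hypothesis X_ge0 : forall i w, 0 <= X i w.
Hypothesis C0 : forall w t, t <= 0 -> C w t = 0.

Let claim i t w : R := (if arrival theta i w <= t then 1 else 0) * X i w * expR (- r * arrival theta i w).

Let claim_ge0 i t w : 0 <= claim i t w.
Proof. by rewrite /claim; case: ifP => _; rewrite ?mul0r // mul1r mulr_ge0 ?expR_ge0. Qed.

Let disc_claimsE t w : disc_claims r X theta t w = (\sum_(1 <= i <oo) (claim i t w)%:E)%E.
Proof. by []. Qed.

Lemma disc_claims_ge0 t w : (0 <= disc_claims r X theta t w)%E.
Proof. by rewrite disc_claimsE; apply: nneseries_ge0 => i _ _; rewrite lee_fin. Qed.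

Lemma disc_claims_before m t w : t < arrival theta m.+1 w ->
  disc_claims r X theta t w = (\sum_(1 <= i < m.+1) claim i t w)%:E.
Proof.
move=> tm; rewrite disc_claimsE (nneseries_split 1 m) => [|i _]; last by rewrite lee_fin.
rewrite eseries0 ?adde0 ?sumEFin ?add1n // => i mi _.
rewrite /claim ifF ?mul0r //; apply/negbTE; rewrite -ltNge.
exact/(lt_le_trans tm)/arrival_le.
Qed.

Lemma disc_claims_ge i t w : (0 < i)%N -> arrival theta i w <= t ->
  ((X i w * expR (- r * arrival theta i w))%:E <= disc_claims r X theta t w)%E.
Proof.
move=> i0 it; rewrite disc_claimsE.
apply: (@le_trans _ _ (\sum_(1 <= j < i.+1) (claim j t w)%:E)%E).
  rewrite big_nat_recr //= -[leLHS]add0e leeD //.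
    by apply: sume_ge0 => j _; rewrite lee_fin.
  by rewrite /claim it mul1r.
by apply: nneseries_lim_ge => j _ _; rewrite lee_fin.
Qed.

(** If some arrival lies beyond [t], no claim is added before the first such arrival; otherwise all
    claims are already counted at [t] and the series no longer changes. *)
Lemma disc_claims_right_cst t w : exists2 e, 0 < e &
  forall s, t <= s < t + e -> disc_claims r X theta s w = disc_claims r X theta t w.
Proof.
have [tm|tm] := pselect (exists m, t < arrival theta m.+1 w); last first.
  exists 1 => // s /andP[ts _]; rewrite !disc_claimsE; apply/congr_lim/funext => n.
  apply: eq_big_nat => -[//|i] _; rewrite /claim.
  have it : arrival theta i.+1 w <= t.
    by rewrite leNgt; apply/negP => it; apply: tm; exists i.
  by rewrite it (le_trans it ts).
case: (ex_minnP tm) => m {}tm m_min; exists (arrival theta m.+1 w - t).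
  by rewrite subr_gt0.
move=> s /andP[ts]; rewrite addrCA subrr addr0 => sm.
rewrite (disc_claims_before sm) (disc_claims_before tm); congr EFin.
apply: eq_big_nat => -[//|i] /andP[_ im]; rewrite /claim.
have it : arrival theta i.+1 w <= t.
  rewrite leNgt; apply/negP => /m_min; rewrite leqNgt; apply/negP.
  by rewrite negbK -ltnS.
by rewrite it (le_trans it ts).
Qed.

Let mexp i : measurable_fun setT (fun w => expR (- r * arrival theta i w)).
Proof. by apply: measurableT_comp => //; exact: measurable_funM. Qed.

Lemma measurable_disc_claims t : measurable_fun setT (disc_claims r X theta t).
Proof.
rewrite /disc_claims; under eq_fun do rewrite eseries_cond.
apply: (@ge0_emeasurable_sum _ _ _ _ (fun i w => (claim i t w)%:E)).
  by move=> i w _ _; rewrite lee_fin.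
move=> i _; apply/measurable_EFinP/measurable_funM; last exact: mexp.
apply: measurable_funM => //; apply: measurable_fun_if => //.
rewrite (_ : (fun w => _) = (fun w => arrival theta i w <= t)) //.
by apply: measurable_fun_ler.
Qed.

Lemma measurable_surplus u t : measurable_fun setT (surplus u r C X theta t).
Proof.
apply: emeasurable_funB; last exact: measurable_disc_claims.
by apply: emeasurable_funD => //; exact: measurable_disc_premium.
Qed.

Lemma measurable_surplus_lt0 u t : measurable [set w | (surplus u r C X theta t w < 0)%E].
Proof.
have := measurable_surplus u t measurableT (emeasurable_itv `]-oo, 0%E[).
by rewrite setTI; congr (measurable _); apply/seteqP; split => w; rewrite /= in_itv.
Qed.

(** The claims may sum to +oo but the premium is finite, which legitimates moving terms across in
    the extended reals. *)
Lemma surplus_lt0 u t w : 0 <= t -> (surplus u r C X theta t w < 0)%E =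
  (u%:E + disc_premium r (C w) t < disc_claims r X theta t w)%E.
Proof.
move=> t0; have := disc_premium_fin (C0 w) r_ge0 t0.
rewrite /surplus; case: (disc_premium r (C w) t) => // c _.
have := disc_claims_ge0 t w; case: (disc_claims r X theta t w) => //= [c'|] _.
  by rewrite !lte_fin subr_lt0.
by rewrite ltry ltNyr.
Qed.

(** Claims stay constant just after [t], and by right continuity of [C] the premium cannot fill the
    gap [g] immediately. *)
Lemma surplus_right_open u w : right_open [set t | (surplus u r C X theta t w < 0)%E].
Proof.
move=> t t0 /=; rewrite surplus_lt0 // => ut.
have [e1 e1_gt0 De1] := disc_claims_right_cst t w.
have [g g_gt0 ug] : exists2 g : R, 0 < g &
    (u%:E + disc_premium r (C w) t + g%:E < disc_claims r X theta t w)%E.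
  move: ut; have := disc_premium_fin (C0 w) r_ge0 t0.
  case: (disc_premium r (C w) t) => // c _.
  have := disc_claims_ge0 t w; case: (disc_claims r X theta t w) => //= [c'|] _.
    rewrite -EFinD lte_fin => uc; exists ((c' - (u + c)) / 2).
      by rewrite divr_gt0 // subr_gt0.
    by rewrite -EFinD lte_fin; lra.
  by move=> _; exists 1 => //; rewrite -EFinD ltry.
have [e2 he2] := nondecreasing_right_continuousP t (C w) g_gt0.
exists (Num.min e1 e2%:num); first by rewrite lt_min e1_gt0 /=.
move=> s /andP[ts]; rewrite -ltrBlDl lt_min => /andP[se1 se2].
have s0 : 0 <= s by rewrite (le_trans t0).
rewrite surplus_lt0 // De1; last by rewrite ts -ltrBlDl.
apply: le_lt_trans ug; rewrite -addeA leeD2l //.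
apply: (le_trans (disc_premium_increment (C w) r_ge0 t0 ts)).
rewrite leeD2l // lee_fin lerBlDl (le_trans _ he2) //.
by apply: cumulative_is_nondecreasing; rewrite -lerBlDl ltW.
Qed.

(** The condition on one line inside [T_and]. *)
Definition ruined u (t : R) w :=
  (ereal_inf [set surplus u r C X theta s w | s in `[0%R, t]] < 0)%E.

Lemma ruinedP u t w : ruined u t w <->
  exists2 s, 0 <= s <= t & (surplus u r C X theta s w < 0)%E.
Proof.
split=> [/ereal_inf_lt[_ [s +] <-]|[s st Us]]; first by rewrite /= in_itv; exists s.
apply: le_lt_trans Us; apply: ereal_inf_lbound.
by exists s => //=; rewrite in_itv.
Qed.

Lemma ruined_right_open u w : right_open [set t | ruined u t w].
Proof.
move=> t _ /ruinedP[s /andP[s0 st] Us]; exists 1 => // t' /andP[tt' _].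
by apply/ruinedP; exists s => //; rewrite s0 (le_trans st).
Qed.

(** Strictly before [t], right openness replaces a time by a rational one still below [t]; the
    endpoint [t] is kept as a separate event. *)
Lemma measurable_ruined u t : 0 < t -> measurable [set w | ruined u t w].
Proof.
move=> t0; pose N s := [set w | (surplus u r C X theta s w < 0)%E].
rewrite (_ : [set _ | _] = N t `|` \bigcup_(q : rat)
    if 0 <= (ratr q : R) < t then N (ratr q) else set0).
  apply: measurableU; first exact: measurable_surplus_lt0.
  apply: bigcupT_measurable_rat => q; case: ifP => // _.
  exact: measurable_surplus_lt0.
apply/seteqP; split => w.
  move=> /ruinedP[s /andP[s0]]; rewrite le_eqVlt => /orP[/eqP-> Us|st Us]; first by left.
  have [e e0 Ue] := surplus_right_open s0 Us; right.
  have : s < Num.min (s + e) t by rewrite lt_min st ltrDl e0.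
  move/rat_in_itvoo => [q]; rewrite in_itv /= lt_min => /and3P[sq qe qt].
  exists q => //; rewrite (le_trans s0 (ltW sq)) qt; apply: Ue.
  by rewrite ltW.
move=> H; change (ruined u t w); apply/ruinedP.
case: H => [Ut|[q _]]; first by exists t => //; rewrite lexx ltW.
by case: ifP => // /andP[q0 qt] Uq; exists (ratr q) => //; rewrite q0 ltW.
Qed.

(* Only the claims up to the m-th have arrived before T_(m+1). *)
Lemma ruined_claims u m (T t : R) w : ruined u t w -> arrival theta m w <= T ->
  t < arrival theta m.+1 w ->
  u < \sum_(1 <= i < m.+1) X i w * expR (- r * arrival theta i w).
Proof.
move=> /ruinedP[s /andP[s0 st]]; rewrite surplus_lt0 // => us mT tm.
rewrite -lte_fin; apply: (@le_lt_trans _ _ (u%:E + disc_premium r (C w) s)%E).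
  by rewrite leeDl // disc_premium_ge0.
apply: (lt_le_trans us); rewrite (disc_claims_before (le_lt_trans st tm)) lee_fin.
apply: ler_sum => i _; rewrite /claim; case: ifP => _; first by rewrite mul1r.
by rewrite !mul0r mulr_ge0 ?expR_ge0.
Qed.

Lemma surplus_lt0_claim u t i w : 0 <= t -> (0 < i)%N -> arrival theta i w <= t ->
  u + C w t < X i w * expR (- r * arrival theta i w) ->
  (surplus u r C X theta t w < 0)%E.
Proof.
move=> t0 i0 it uX; rewrite surplus_lt0 //.
apply: (lt_le_trans _ (disc_claims_ge i0 it)).
apply: (@le_lt_trans _ _ (u + C w t)%:E); last by rewrite lte_fin.
by rewrite EFinD leeD2l //; exact: (disc_premium_le (C0 w) r_ge0 t0).
Qed.

End OneLine.

Section TwoLines.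
Variables (X Y : nat -> Omega -> R) (C1 C2 : Omega -> cumulative R R).
Hypothesis mX : forall i, measurable_fun setT (X i).
Hypothesis mY : forall i, measurable_fun setT (Y i).
Hypothesis mC1 : forall t, measurable_fun setT (fun w => C1 w t).
Hypothesis mC2 : forall t, measurable_fun setT (fun w => C2 w t).
Hypothesis X_ge0 : forall i w, 0 <= X i w.
Hypothesis Y_ge0 : forall i w, 0 <= Y i w.
Hypothesis C1_0 : forall w t, t <= 0 -> C1 w t = 0.
Hypothesis C2_0 : forall w t, t <= 0 -> C2 w t = 0.
Variables (x y T : R).

Definition event_max := [set w |
  (T_max (surplus x r C1 X theta) (surplus y r C2 Y theta) w <= T%:E)%E].
Definition event_and := [set w |
  (T_and (surplus x r C1 X theta) (surplus y r C2 Y theta) w <= T%:E)%E].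

Let right_openI (Q1 Q2 : set R) : right_open Q1 -> right_open Q2 ->
  right_open (Q1 `&` Q2).
Proof.
move=> o1 o2 t t0 [/(o1 t t0)[e1 e10 h1] /(o2 t t0)[e2 e20 h2]].
exists (Num.min e1 e2); first by rewrite lt_min e10 e20.
move=> s /andP[ts]; rewrite -ltrBlDl lt_min => /andP[se1 se2].
by split; [apply: h1|apply: h2]; rewrite ts -ltrBlDl.
Qed.

Lemma measurable_event_max : measurable event_max.
Proof.
rewrite /event_max /T_max; apply: measurable_hitting_time => [w|t t0].
  rewrite (_ : (fun t => _) = [set t | (surplus x r C1 X theta t w < 0)%E] `&`
      [set t | (surplus y r C2 Y theta t w < 0)%E]).
    by apply: right_openI; exact: surplus_right_open.
  by apply/seteqP; split => t /=; rewrite gt_max; [move=> /andP|move/andP].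
rewrite (_ : [set _ | _] = [set w | (surplus x r C1 X theta t w < 0)%E] `&`
    [set w | (surplus y r C2 Y theta t w < 0)%E]).
  by apply: measurableI; exact: measurable_surplus_lt0.
by apply/seteqP; split => w /=; rewrite gt_max; [move=> /andP|move/andP].
Qed.

Lemma measurable_event_and : measurable event_and.
Proof.
rewrite /event_and /T_and; apply: measurable_hitting_time => [w|t t0].
  by apply: right_openI; exact: ruined_right_open.
by apply: measurableI; exact: measurable_ruined.
Qed.

Lemma event_max_sub_and : event_max `<=` event_and.
Proof.
move=> w max_w; apply: le_trans max_w; apply: le_ereal_inf => z [t [t0]].
rewrite gt_max => /andP[U1 U2] <-; exists t => //; split => //.
split; [change (ruined X C1 x t w)|change (ruined Y C2 y t w)];
  by apply/ruinedP; exists t => //; rewrite lexx ltW.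
Qed.

(** [T_and <= T] yields ruin times only below bounds beyond [T]. T_(m+1) is such a bound, and no
    claim arrives between [T] and T_(m+1). *)
Lemma event_and_claims m w : event_and w -> arrival theta m w <= T ->
  T < arrival theta m.+1 w ->
  x < \sum_(1 <= i < m.+1) X i w * expR (- r * arrival theta i w) /\
  y < \sum_(1 <= i < m.+1) Y i w * expR (- r * arrival theta i w).
Proof.
move=> and_w mT Tm.
have : (T_and (surplus x r C1 X theta) (surplus y r C2 Y theta) w <
    (arrival theta m.+1 w)%:E)%E by rewrite (le_lt_trans and_w) // lte_fin.
move=> /ereal_inf_lt[_ [t [t0 [r1 r2]] <-]]; rewrite lte_fin => tm.
split; first exact: (ruined_claims X_ge0 C1_0 r1 mT tm).
exact: (ruined_claims Y_ge0 C2_0 r2 mT tm).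
Qed.

Lemma event_max_claims i j w : 0 < T -> (0 < i)%N -> (0 < j)%N ->
  arrival theta i w <= T -> arrival theta j w <= T ->
  x + C1 w T < X i w * expR (- r * arrival theta i w) ->
  y + C2 w T < Y j w * expR (- r * arrival theta j w) ->
  event_max w.
Proof.
move=> T0 i0 j0 iT jT xX yY; apply: ereal_inf_lbound; exists T => //; split => //.
rewrite gt_max (surplus_lt0_claim X_ge0 C1_0 (ltW T0) i0 iT xX).
exact: (surplus_lt0_claim Y_ge0 C2_0 (ltW T0) j0 jT yY).
Qed.

End TwoLines.
End Ruin.

(** * Integrals against joint laws and against the renewal measure *)

Section PairIntegral.
Context d d' d1 d2 (T : measurableType d) (T' : measurableType d')
  (T1 : measurableType d1) (T2 : measurableType d2) (R : realType).

Lemma pair_integral (mu : {measure set T -> \bar R}) (mu' : {measure set T' -> \bar R})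
    (f : T -> T1) (g : T -> T2) (f' : T' -> T1) (g' : T' -> T2) :
  measurable_fun setT f -> measurable_fun setT g ->
  measurable_fun setT f' -> measurable_fun setT g' -> (mu setT < +oo)%E ->
  (forall A B, measurable A -> measurable B ->
    mu (f @^-1` A `&` g @^-1` B) = mu' (f' @^-1` A `&` g' @^-1` B)) ->
  forall K : T1 * T2 -> \bar R, (forall u, 0 <= K u)%E -> measurable_fun setT K ->
    (\int[mu]_w K (f w, g w) = \int[mu']_w K (f' w, g' w))%E.
Proof.
move=> mf mg mf' mg' mu_fin mumu' K K0 mK.
have mfg := measurable_fun_pair mf mg; have mfg' := measurable_fun_pair mf' mg'.
have := @ge0_integral_pushforward _ _ _ _ R _ mfg mu setT K measurableT mK (fun u _ => K0 u).
have := @ge0_integral_pushforward _ _ _ _ R _ mfg' mu' setT K measurableT mK (fun u _ => K0 u).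
rewrite !preimage_setT => <- <-.
pose m := measure_function_pushforward__canonical__measure_function_Measure mu mfg.
pose m' := measure_function_pushforward__canonical__measure_function_Measure mu' mfg'.
apply: (@eq_measure_integral _ _ _ setT m' m) => E mE _.
exact: (pair_law_unique mf mg mf' mg' mu_fin mumu').
Qed.

End PairIntegral.

Section RenewalIntegral.
Context d (Omega : measurableType d) (R : realType) (P : probability Omega R).
Variable theta : nat -> Omega -> R.
Hypothesis mtheta : forall i, measurable_fun setT (theta i).
Hypothesis theta_indep : indep_seq P theta.
Hypothesis theta_id : forall i (B : set R), (1 <= i)%N -> measurable B ->
  P (theta i @^-1` B) = P (theta 1%N @^-1` B).

Let marrival i : measurable_fun setT (arrival theta i).
Proof. exact: measurable_arrival. Qed.

(** [renewal_measure] is a bare set function; it is convertible to the series, from index 1, of the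
    laws of the arrival times, which carries the measure structure. *)
Lemma renewal_integral_mkcond (D : set R) (g : R -> \bar R) :
  (\int[renewal_measure P theta]_(t in D) g t =
   \int[renewal_measure P theta]_t (g \_ D) t)%E.
Proof.
pose m n : {measure set R -> \bar R} :=
  measure_function_pushforward__canonical__measure_function_Measure P (marrival n).
exact: (integral_mkcond (mu := mseries m 1)).
Qed.

(** Campbell's formula for the arrival process. *)
Lemma renewal_integral (g : R -> \bar R) : (forall t, 0 <= g t)%E -> measurable_fun setT g ->
  (\int[renewal_measure P theta]_t g t =
   \sum_(0 <= n <oo) \int[P]_w g (arrival theta n.+1 w))%E.
Proof.
move=> g0 mg.
pose m n : {measure set R -> \bar R} :=
  measure_function_pushforward__canonical__measure_function_Measure P (marrival n).
pose m' n := m n.+1.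
transitivity (\int[mseries m' 0]_t g t)%E.
  apply: (@eq_measure_integral _ _ _ setT (mseries m' 0) (mseries m 1)) => A mA _.
  change (\sum_(1 <= n <oo) m n A = \sum_(0 <= n <oo) m n.+1 A)%E.
  rewrite -nneseries_addn => [|n]; last exact: measure_ge0.
  by apply: eq_eseriesr => n _; rewrite addn1.
rewrite ge0_integral_measure_series //; apply: eq_eseriesr => n _.
by rewrite /m' /m /= ge0_integral_pushforward.
Qed.

Let measurable_shift_section i (K : R * R -> \bar R) : (forall u, 0 <= K u)%E ->
  measurable_fun setT K -> measurable_fun setT (fun t => \int[P]_w K (t, arrival theta i w))%E.
Proof.
move=> K0 mK.
apply: (measurable_fun_fubini_tonelli_F (fun u : R * Omega => K (u.1, arrival theta i u.2))).
  apply: (measurableT_comp mK); apply: measurable_fun_pair => //.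
  exact: measurableT_comp.
by move=> u; exact: K0.
Qed.

(** By [arrival_split], T_(i+1) and T_(i+m+2) - T_(i+1) have the joint law of T_(i+1) and T_(m+1) on
    the two coordinates of [P \x P], so Tonelli collapses the two renewal integrals into one
    expectation. *)
Lemma renewal_double_integral (K : R * R -> \bar R) : (forall u, 0 <= K u)%E ->
  measurable_fun setT K ->
  (\int[renewal_measure P theta]_t \int[renewal_measure P theta]_s K (t, s) =
   \sum_(0 <= i <oo) \sum_(0 <= m <oo)
     \int[P]_w K (arrival theta i.+1 w, block_sum theta i.+2 m.+1 w))%E.
Proof.
move=> K0 mK.
have innerE t : (\int[renewal_measure P theta]_s K (t, s) =
    \sum_(0 <= m <oo) \int[P]_w K (t, arrival theta m.+1 w))%E.
  rewrite renewal_integral //; apply: measurableT_comp mK _.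
  exact: measurable_fun_pair.
transitivity (\int[renewal_measure P theta]_t
    \sum_(0 <= m <oo) \int[P]_w K (t, arrival theta m.+1 w))%E.
  by congr integral; apply/funext => t; exact: innerE.
have I0 t m : (0 <= \int[P]_w K (t, arrival theta m.+1 w))%E by exact: integral_ge0.
rewrite renewal_integral; first last.
- apply: (@ge0_emeasurable_sum _ _ _ _
    (fun m t => \int[P]_w K (t, arrival theta m.+1 w))%E) => // m _.
  exact: measurable_shift_section.
- by move=> t; apply: nneseries_ge0.
apply: eq_eseriesr => i _.
rewrite integral_nneseries //; last first.
  move=> m; apply: (measurableT_comp (measurable_shift_section m.+1 K0 mK)).
  exact: marrival.
apply: eq_eseriesr => m _.
have mK2 : measurable_fun setT
    (fun z : Omega * Omega => K (arrival theta i.+1 z.1, arrival theta m.+1 z.2)).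
  apply: (measurableT_comp mK); apply: measurable_fun_pair; exact: measurableT_comp.
have := @fubini_tonelli1 _ _ _ _ _ P P _ mK2 (fun _ => K0 _).
rewrite /fubini_F /= => <-; apply/esym.
apply: (pair_integral (f := arrival theta i.+1) (g := block_sum theta i.+2 m.+1)
  (f' := fun z : Omega * Omega => arrival theta i.+1 z.1)
  (g' := fun z : Omega * Omega => arrival theta m.+1 z.2)) => //.
- exact: measurable_block_sum.
- exact: measurableT_comp.
- exact: measurableT_comp.
- by rewrite [ltLHS]probability_setT ltry.
- move=> A B mA mB.
  have mpre i' (D : set R) : measurable D -> measurable (arrival theta i' @^-1` D).
    by move=> mD; rewrite -[_ @^-1` _]setTI; exact: marrival.
  rewrite (_ : _ `&` _ = (arrival theta i.+1 @^-1` A) `*` (arrival theta m.+1 @^-1` B)) //.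
  rewrite [RHS](product_measure1E P P (mpre _ _ mA) (mpre _ _ mB)).
  exact: arrival_split.
Qed.

End RenewalIntegral.

(** * Series with geometric domination and reindexing of pairs *)

Section GeometricTails.
Context (R : realType).

Lemma sum_half_le n : \sum_(0 <= i < n) (2^-1 : R) ^+ i <= 2.
Proof.
suff -> : \sum_(0 <= i < n) (2^-1 : R) ^+ i = 2 - 2 * 2^-1 ^+ n.
  by rewrite lerBlDr lerDl mulr_ge0 // exprn_ge0.
elim: n => [|n IHn]; first by rewrite big_geq // expr0 mulr1 subrr.
by rewrite big_nat_recr //= IHn exprS; lra.
Qed.

(** The tail of the dominating series from [n] on is 2 k 2^-n, so finiteness and an explicit
    remainder come together. *)
Lemma geometric_series_bounds (a : nat -> R) k :
  (forall m, 0 <= a m <= k * 2^-1 ^+ m) ->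
  exists2 S, (\sum_(0 <= m <oo) (a m)%:E)%E = S%:E &
  forall n, \sum_(0 <= m < n) a m <= S <= \sum_(0 <= m < n) a m + 2 * k * 2^-1 ^+ n.
Proof.
move=> ak; have a0 m : 0 <= a m by have /andP[] := ak m.
have k0 : 0 <= k by have /andP[/le_trans ak0 /ak0] := ak 0%N; rewrite expr0 mulr1.
have tail n N : \sum_(0 <= m < N) a m <= \sum_(0 <= m < n) a m + 2 * k * 2^-1 ^+ n.
  apply: (@le_trans _ _ (\sum_(0 <= m < n + N) a m)).
    rewrite addnC (big_cat_nat (leq0n N) (leq_addr n N)) /= lerDl.
    by apply: sumr_ge0.
  rewrite (big_cat_nat (leq0n n) (leq_addr N n)) /= lerD2l.
  rewrite -{1}[n]add0n big_addn addKn.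
  apply: (@le_trans _ _ (k * 2^-1 ^+ n * \sum_(0 <= m < N) 2^-1 ^+ m)).
    rewrite mulr_sumr; apply: ler_sum => m _; have /andP[_] := ak (m + n)%N.
    by rewrite exprD; congr (_ <= _); ring.
  have := @sum_half_le N; have : 0 <= k * 2^-1 ^+ n by rewrite mulr_ge0 // exprn_ge0.
  by move=> h1 h2; have := ler_wpM2l h1 h2; congr (_ <= _); ring.
have S_le n : (\sum_(0 <= m <oo) (a m)%:E <= (\sum_(0 <= m < n) a m + 2 * k * 2^-1 ^+ n)%:E)%E.
  apply: lime_le; first by apply: is_cvg_nneseries => m _ _; rewrite lee_fin.
  by apply: nearW => N; rewrite sumEFin lee_fin.
have S_ge n : ((\sum_(0 <= m < n) a m)%:E <= \sum_(0 <= m <oo) (a m)%:E)%E.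
  by rewrite -sumEFin; apply: nneseries_lim_ge => m _ _; rewrite lee_fin.
exists (fine (\sum_(0 <= m <oo) (a m)%:E)%E).
  rewrite fineK // fin_numE -ltNye -ltey.
  by rewrite (lt_le_trans _ (S_ge 0%N)) ?(le_lt_trans (S_le 0%N)) // ?ltry ?ltNyr.
have Sfin : (\sum_(0 <= m <oo) (a m)%:E)%E \is a fin_num.
  rewrite fin_numE -ltNye -ltey.
  by rewrite (lt_le_trans _ (S_ge 0%N)) ?(le_lt_trans (S_le 0%N)) // ?ltry ?ltNyr.
by move=> n; rewrite -!lee_fin fineK // S_ge S_le.
Qed.

(** The outer remainder and the accumulated inner remainders contribute at most 4 k 2^-n each. *)
Lemma double_geometric_series_bounds (a : nat -> nat -> R) k :
  (forall i m, 0 <= a i m <= k * 2^-1 ^+ i * 2^-1 ^+ m) ->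
  exists2 S, (\sum_(0 <= i <oo) \sum_(0 <= m <oo) (a i m)%:E)%E = S%:E &
  forall n, \sum_(0 <= i < n) \sum_(0 <= m < n) a i m <= S <=
    \sum_(0 <= i < n) \sum_(0 <= m < n) a i m + 8 * k * 2^-1 ^+ n.
Proof.
move=> ak; have /choice[s hs] : forall i, exists S,
    (\sum_(0 <= m <oo) (a i m)%:E)%E = S%:E /\
    forall n, \sum_(0 <= m < n) a i m <= S <=
      \sum_(0 <= m < n) a i m + 2 * (k * 2^-1 ^+ i) * 2^-1 ^+ n.
  by move=> i; have [S ? ?] := geometric_series_bounds (ak i); exists S.
have sk i : 0 <= s i <= (2 * k) * 2^-1 ^+ i.
  have [_ /(_ 0%N)] := hs i.
  by rewrite big_geq // add0r expr0 mulr1 mulrA.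
have [S SE Sn] := geometric_series_bounds sk.
exists S; first by rewrite -SE; apply: eq_eseriesr => i _; have [] := hs i.
move=> n; have /andP[Sn1 Sn2] := Sn n; apply/andP; split.
  apply: le_trans Sn1; apply: ler_sum => i _.
  by have [_ /(_ n)/andP[]] := hs i.
apply: (le_trans Sn2).
have : \sum_(0 <= i < n) s i <= \sum_(0 <= i < n) \sum_(0 <= m < n) a i m +
    2 * k * 2^-1 ^+ n * \sum_(0 <= i < n) 2^-1 ^+ i.
  rewrite mulr_sumr -big_split; apply: ler_sum => i _.
  have [_ /(_ n)/andP[_]] := hs i.
  by congr (_ <= _ + _); ring.
have k0 : 0 <= k.
  have /andP[/le_trans ak0 /ak0] := ak 0%N 0%N; by rewrite !expr0 !mulr1.
have h1 : 0 <= 2 * k * 2^-1 ^+ n by rewrite !mulr_ge0 // exprn_ge0.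
have := ler_wpM2l h1 (sum_half_le n).
lra.
Qed.

(** An off-diagonal pair is coded by its smaller index [i] and a gap, the larger index being
    [m + i.+1]: the indexing by arrival and waiting time that the double renewal integral
    produces. *)
Lemma sum_square_split n (f : nat -> nat -> R) :
  \sum_(0 <= i < n) \sum_(0 <= j < n) f i j =
  \sum_(0 <= i < n) \sum_(0 <= m < n | (m + i.+1 < n)%N)
    (f (m + i.+1)%N i + f i (m + i.+1)%N) + \sum_(0 <= i < n) f i i.
Proof.
have upper (g : nat -> nat -> R) : \sum_(0 <= i < n) \sum_(0 <= j < n | (i < j)%N) g i j =
    \sum_(0 <= i < n) \sum_(0 <= m < n | (m + i.+1 < n)%N) g i (m + i.+1)%N.
  apply: eq_bigr => i _.
  rewrite -[LHS](big_nat_widenl i.+1 0 n predT) // -{1}[i.+1]add0n big_addn.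
  rewrite (big_nat_widen 0 (n - i.+1) n) ?leq_subr //=.
  by apply: eq_bigl => m; rewrite ltn_subRL addnC.
transitivity (\sum_(0 <= i < n) \sum_(0 <= j < n | (i < j)%N) f j i +
    \sum_(0 <= i < n) \sum_(0 <= j < n | (i < j)%N) f i j + \sum_(0 <= i < n) f i i).
  have -> : \sum_(0 <= i < n) \sum_(0 <= j < n | (i < j)%N) f j i =
      \sum_(0 <= i < n) \sum_(0 <= j < n | (j < i)%N) f i j.
    under eq_bigr do rewrite big_mkcond.
    by rewrite exchange_big_nat /=; apply: eq_bigr => i _; rewrite [RHS]big_mkcond.
  rewrite -!big_split; apply: eq_big_nat => i /andP[_ ltin] /=.
  rewrite (bigID (fun j => (j < i)%N)) /= -addrA; congr (_ + _).
  rewrite (bigID (fun j => (i < j)%N)) /=; congr (_ + _).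
    by apply: eq_bigl => j; case: ltngtP.
  rewrite (eq_bigl (fun j => j == i)) => [|j]; last by case: ltngtP.
  by rewrite big_nat1_eq ltin.
by rewrite !upper -big_split; congr (_ + _); apply: eq_bigr => i _; rewrite -big_split.
Qed.

End GeometricTails.

(** * Delta as a series over pairs of arrivals *)

Section DeltaExpansion.
Context d (Omega : measurableType d) (R : realType) (P : probability Omega R).
Variable theta : nat -> Omega -> R.
Hypothesis mtheta : forall i, measurable_fun setT (theta i).
Hypothesis theta_pos : forall i w, 0 < theta i w.
Hypothesis theta_indep : indep_seq P theta.
Hypothesis theta_id : forall i (B : set R), (1 <= i)%N -> measurable B ->
  P (theta i @^-1` B) = P (theta 1%N @^-1` B).
Variables (Fb Gb : R -> R) (r C T : R).
Hypothesis Fb_gt0 : forall x, 0 < Fb x.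
Hypothesis Gb_gt0 : forall x, 0 < Gb x.
Hypothesis Fb_le1 : forall x, Fb x <= 1.
Hypothesis Gb_le1 : forall x, Gb x <= 1.
Hypothesis Fb_ni : forall x y, x <= y -> Fb y <= Fb x.
Hypothesis Gb_ni : forall x y, x <= y -> Gb y <= Gb x.
Hypothesis r_ge0 : 0 <= r.
Hypothesis C_gt0 : 0 < C.

Let marrival i : measurable_fun setT (arrival theta i).
Proof. exact: measurable_arrival. Qed.

Definition both_arrived i j w := (arrival theta i w <= T) && (arrival theta j w <= T).

Definition pair_weight i j x y w : R := if both_arrived i j w then
  Fb (x * expR (r * arrival theta i w)) * Gb (y * expR (r * arrival theta j w)) else 0.

Definition pair_mass i j x y : R := fine (\int[P]_w (pair_weight i j x y w)%:E).

Lemma measurable_both_arrived i j : measurable_fun setT (both_arrived i j).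
Proof. by apply: measurable_and; exact: measurable_fun_ler. Qed.

Let mscaled (V : R -> R) d' (S : measurableType d') (h : S -> R) x :
  (forall u v, u <= v -> V v <= V u) ->
  measurable_fun setT h -> measurable_fun setT (fun w => V (x * expR (r * h w))).
Proof.
move=> V_ni mh; apply: (measurableT_comp (f := V)).
  exact: nonincreasing_measurable.
by apply: measurable_funM => //; apply: measurableT_comp => //; exact: measurable_funM.
Qed.

Lemma pair_weight_ge0 i j x y w : 0 <= pair_weight i j x y w.
Proof. by rewrite /pair_weight; case: ifP => // _; rewrite mulr_ge0 // ltW. Qed.

Lemma measurable_pair_weight i j x y : measurable_fun setT (pair_weight i j x y).
Proof.
apply: measurable_fun_ifT => //; first exact: measurable_both_arrived.
by apply: measurable_funM; apply: mscaled.
Qed.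

Let arrived i := [set w | arrival theta i w <= T].

Let marrived i : measurable (arrived i).
Proof.
have := marrival i measurableT (measurable_itv `]-oo, T]).
by rewrite setTI; congr (measurable _); apply/seteqP; split => w /=; rewrite in_itv.
Qed.

Let scale_ge (x u : R) : 0 <= x -> 0 <= u -> x <= x * expR (r * u).
Proof. by move=> x0 u0; rewrite ler_peMr // -expR0 ler_expR mulr_ge0. Qed.

Let pair_weight_le k i j x y w : 0 <= x -> 0 <= y -> (k == i) || (k == j) ->
  pair_weight i j x y w <= Fb x * Gb y * \1_(arrived k) w.
Proof.
move=> x0 y0 kij; rewrite /pair_weight /both_arrived.
case: ifP => [/andP[iT jT]|_]; last by rewrite !mulr_ge0 // ltW.
rewrite indicE mem_set ?mulr1.
  by apply: ler_pM; rewrite ?(ltW (Fb_gt0 _)) ?(ltW (Gb_gt0 _)) ?Fb_ni ?Gb_ni ?scale_ge ?arrival_ge0.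
by case/orP: kij => /eqP->.
Qed.

Let integral_pair_weight_le k i j x y : 0 <= x -> 0 <= y -> (k == i) || (k == j) ->
  (\int[P]_w (pair_weight i j x y w)%:E <= (Fb x * Gb y * pr P (arrived k))%:E)%E.
Proof.
move=> x0 y0 kij.
rewrite EFinM -prE // -[X in P X]setIT -integral_indic // -ge0_integralZl //.
- apply: ge0_le_integral => //.
  + by move=> w _; rewrite lee_fin pair_weight_ge0.
  + exact/measurable_EFinP/measurable_pair_weight.
  + by apply: emeasurable_funM => //; exact/measurable_EFinP.
  + by move=> w _; rewrite -EFinM lee_fin pair_weight_le.
- exact/measurable_EFinP.
- by rewrite lee_fin mulr_ge0 // ltW.
Qed.

Let integral_pair_weight_ge0 i j x y : (0 <= \int[P]_w (pair_weight i j x y w)%:E)%E.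
Proof. by apply: integral_ge0 => w _; rewrite lee_fin pair_weight_ge0. Qed.

Lemma pair_massE i j x y : 0 <= x -> 0 <= y ->
  (\int[P]_w (pair_weight i j x y w)%:E)%E = (pair_mass i j x y)%:E.
Proof.
move=> x0 y0; rewrite fineK // ge0_fin_numE //.
by rewrite (le_lt_trans (@integral_pair_weight_le i i j x y x0 y0 _)) ?eqxx // ltry.
Qed.

Lemma pair_mass_ge0 i j x y : 0 <= pair_mass i j x y.
Proof. exact: fine_ge0. Qed.

(** [k] may be either index of the pair; the larger one brings the decay of P(T_k <= T). *)
Lemma pair_mass_le k i j x y : 0 <= x -> 0 <= y -> (k == i) || (k == j) ->
  pair_mass i j x y <= Fb x * Gb y * pr P (arrived k).
Proof. by move=> x0 y0 kij; rewrite -lee_fin -pair_massE // integral_pair_weight_le. Qed.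

(** Arrivals by [T] raise the thresholds by a factor e^{rT} at most, and equal indices leave a
    single arrival constraint. *)
Lemma pair_mass_diag_ge i x y : 0 <= x -> 0 <= y ->
  Fb (expR (r * T) * x) * Gb (expR (r * T) * y) * pr P (arrived i) <= pair_mass i i x y.
Proof.
move=> x0 y0; rewrite -lee_fin -pair_massE // EFinM -prE // -[X in P X]setIT.
rewrite -integral_indic // -ge0_integralZl //; first last.
- by rewrite lee_fin mulr_ge0 // ltW.
- exact/measurable_EFinP.
apply: ge0_le_integral => //.
- by move=> w _; rewrite -EFinM lee_fin !mulr_ge0 // ltW.
- by apply: emeasurable_funM => //; exact/measurable_EFinP.
- exact/measurable_EFinP/measurable_pair_weight.
move=> w _; rewrite -EFinM lee_fin indicE.
case: (boolP (w \in arrived i)); rewrite ?mulr0 ?pair_weight_ge0 // inE => iT.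
rewrite mulr1 /pair_weight /both_arrived iT /=.
have eT : expR (r * arrival theta i w) <= expR (r * T) by rewrite ler_expR ler_wpM2l.
by apply: ler_pM; rewrite ?(ltW (Fb_gt0 _)) ?(ltW (Gb_gt0 _)) //;
  [apply: Fb_ni | apply: Gb_ni]; rewrite mulrC ler_wpM2r.
Qed.

Lemma Delta_series x y : 0 <= x -> 0 <= y ->
  Delta (renewal_measure P theta) Fb Gb C r x y T =
  (\sum_(0 <= i <oo) \sum_(0 <= m <oo)
     (pair_mass (m + i.+2) i.+1 x y + pair_mass i.+1 (m + i.+2) x y)%:E +
   C%:E * \sum_(0 <= i <oo) (pair_mass i.+1 i.+1 x y)%:E)%E.
Proof.
move=> x0 y0; rewrite /Delta; congr (_ + _ * _)%E.
  pose k (t s : R) := Fb (x * expR (r * (t + s))) * Gb (y * expR (r * t)) +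
    Fb (x * expR (r * t)) * Gb (y * expR (r * (t + s))).
  (* Extension by zero off the triangle; at an arrival T_i and a waiting time T_j - T_i its
     constraints say that both arrivals occur by [T], the signs being automatic. *)
  pose K (u : R * R) : \bar R :=
    (if (0 <= u.1 <= T) && (0 <= u.2 <= T - u.1) then k u.1 u.2 else 0)%:E.
  have k0 t s : 0 <= k t s by rewrite addr_ge0 // mulr_ge0 // ltW.
  have mK : measurable_fun setT K.
    apply/measurable_EFinP; apply: measurable_fun_ifT => //.
      apply: measurable_and; apply: measurable_and; apply: measurable_fun_ler => //.
      exact: measurable_funB.
    have m12 : measurable_fun setT (fun u : R * R => u.1 + u.2) by exact: measurable_funD.
    by apply: measurable_funD; apply: measurable_funM; apply: mscaled.
  transitivity (\int[renewal_measure P theta]_t \int[renewal_measure P theta]_s K (t, s))%E.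
    rewrite renewal_integral_mkcond //; congr integral; apply/funext => t.
    rewrite patchE; case: ifPn => [|tT].
      rewrite inE /= in_itv /= => tT; rewrite renewal_integral_mkcond //; congr integral.
      apply/funext => s; rewrite patchE /K /= tT; case: ifPn => [|sT].
        by rewrite inE /= in_itv /= => ->.
      by rewrite ifF //; apply: contraNF sT => sT; rewrite inE /= in_itv.
    have -> : (fun s => K (t, s)) = cst 0%E.
      apply/funext => s; rewrite /K /=.
      case: (boolP (0 <= t <= T)) => //= t_in; exfalso; move/negP: tT; apply.
      by rewrite inE /= in_itv.
    rewrite renewal_integral //.
    by apply/esym/eseries0 => n _ _; rewrite integral0.
  rewrite renewal_double_integral //; last first.
    by move=> u; rewrite /K lee_fin; case: ifP.
  apply: eq_eseriesr => i _; apply: eq_eseriesr => m _.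
  rewrite EFinD -!pair_massE // -ge0_integralD //; last 4 first.
  - by move=> w _; rewrite lee_fin pair_weight_ge0.
  - exact/measurable_EFinP/measurable_pair_weight.
  - by move=> w _; rewrite lee_fin pair_weight_ge0.
  - exact/measurable_EFinP/measurable_pair_weight.
  apply: eq_integral => w _; rewrite /K /=.
  (* Series indices start at 0: the term [i], [m] concerns the arrivals [i.+1] and [m + i.+2],
     separated by [m.+1] interarrival times. *)
  have TS : arrival theta i.+1 w + block_sum theta i.+2 m.+1 w = arrival theta (m + i.+2) w.
    rewrite /arrival /block_sum -(big_cat_nat (n := i.+2)) //=; last by rewrite leq_addr.
    by congr (\sum_(1 <= k < _) theta k w); rewrite addnS addnC.
  have S0 : 0 <= block_sum theta i.+2 m.+1 w by apply: sumr_ge0 => *; exact: ltW.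
  have A0 := arrival_ge0 theta_pos i.+1 w.
  rewrite /pair_weight /both_arrived [in RHS]andbC A0 S0 /= lerBrDl TS -EFinD.
  by case: ifP => _; rewrite ?addr0 // /k TS.
rewrite renewal_integral_mkcond // renewal_integral //; first last.
- apply/(measurable_restrictT _ _).1; first exact: measurable_itv.
  by apply/measurable_EFinP/measurable_funTS/measurable_funM; exact: mscaled.
- move=> t; rewrite patchE; case: ifP => // _; rewrite lee_fin.
  by rewrite mulr_ge0 // ltW.
apply: eq_eseriesr => n _; rewrite -pair_massE //; apply: eq_integral => w _.
rewrite patchE /pair_weight /both_arrived andbb.
case: ifPn => [|nT]; first by rewrite inE /= in_itv /= => /andP[_ ->].
rewrite ifF //; apply: contraNF nT => nT; rewrite inE /= in_itv /= nT andbT.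
exact: arrival_ge0.
Qed.

End DeltaExpansion.

(** * Conditioning claims on arrival times and premiums *)

Section Mixing.
Context d (Omega : measurableType d) (R : realType) (P : probability Omega R).
Variables (X Y theta : nat -> Omega -> R) (C1 C2 : Omega -> cumulative R R) (r T : R).
Hypothesis mX : forall i, measurable_fun setT (X i).
Hypothesis mY : forall i, measurable_fun setT (Y i).
Hypothesis mtheta : forall i, measurable_fun setT (theta i).
Hypothesis indep : indep3 P (sigma_claims X Y) (sigma_premium C1 C2) (sigma_interarrival theta).

Let marrival i : measurable_fun setT (arrival theta i).
Proof. exact: measurable_arrival. Qed.

Lemma sigma_interarrival_arrivals i j (A : set (R * R)) : measurable A ->
  sigma_interarrival theta ((fun w => (arrival theta i w, arrival theta j w)) @^-1` A).
Proof.
move=> mA.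
pose G : set (set Omega) := [set A | exists i : nat, (1 <= i)%N /\
  exists B : set R, measurable B /\ A = theta i @^-1` B].
(* [sigma_interarrival] carries no information on [theta 0], which enters no arrival time; a
   constant takes its place so that every index is measurable. *)
pose theta' k : g_sigma_algebraType G -> R := if k is 0%N then cst 0 else theta k.
have mth k : measurable_fun setT (theta' k).
  case: k => [|k]; first exact: measurable_cst.
  move=> _ B mB; rewrite setTI; apply: sub_sigma_algebra.
  by exists k.+1; split => //; exists B.
have mar k : measurable_fun setT (arrival theta k : g_sigma_algebraType G -> R).
  rewrite (_ : arrival theta k = arrival theta' k); first exact: measurable_arrival.
  by apply/funext => w; apply: eq_big_nat => -[].
have := measurable_fun_pair (mar i) (mar j) measurableT mA.
by rewrite setTI.
Qed.

Lemma sigma_claims_pair i j (A : set (R * R)) : (1 <= i)%N -> (1 <= j)%N -> measurable A ->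
  sigma_claims X Y ((fun w => (X i w, Y j w)) @^-1` A).
Proof.
move=> i1 j1 mA.
pose G : set (set Omega) := [set A | exists i : nat, (1 <= i)%N /\
  exists B : set R, measurable B /\ (A = X i @^-1` B \/ A = Y i @^-1` B)].
have mXi : measurable_fun setT (X i : g_sigma_algebraType G -> R).
  move=> _ B mB; rewrite setTI; apply: sub_sigma_algebra.
  by exists i; split => //; exists B; split => //; left.
have mYj : measurable_fun setT (Y j : g_sigma_algebraType G -> R).
  move=> _ B mB; rewrite setTI; apply: sub_sigma_algebra.
  by exists j; split => //; exists B; split => //; right.
have := measurable_fun_pair mXi mYj measurableT mA.
by rewrite setTI.
Qed.

(** Undiscounted form of X_i e^{-r T_i} > u: the random factor sits in the threshold, which is
    independent of the claim. *)
Definition claim_event i j (u v : R) := [set w |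
  both_arrived theta T i j w /\
  u * expR (r * arrival theta i w) < X i w /\ v * expR (r * arrival theta j w) < Y j w].

Definition joint_tail i j (u v : R) : R := pr P [set w | u < X i w /\ v < Y j w].

Lemma measurable_joint i j u v : measurable [set w | u < X i w /\ v < Y j w].
Proof.
apply: measurableI.
  have := mX i measurableT (measurable_itv `]u, +oo[); rewrite setTI.
  by congr (measurable _); apply/seteqP; split => w /=; rewrite in_itv /= andbT.
have := mY j measurableT (measurable_itv `]v, +oo[); rewrite setTI.
by congr (measurable _); apply/seteqP; split => w /=; rewrite in_itv /= andbT.
Qed.

Let E (u v : R) : set ((R * R) * (R * R)) :=
  [set z | (z.1.1 <= T) && (z.1.2 <= T) &&
    ((u * expR (r * z.1.1) < z.2.1) && (v * expR (r * z.1.2) < z.2.2))].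

Let measurable_bool (d' : measure_display) (S : measurableType d') (f : S -> bool) :
  measurable_fun setT f -> measurable [set z | f z].
Proof. by move=> mf; have := mf measurableT [set true] I; rewrite setTI. Qed.

Let mE u v : measurable (E u v).
Proof.
have m11 : measurable_fun setT (fun z : (R * R) * (R * R) => z.1.1) by exact: measurableT_comp.
have m12 : measurable_fun setT (fun z : (R * R) * (R * R) => z.1.2) by exact: measurableT_comp.
have m21 : measurable_fun setT (fun z : (R * R) * (R * R) => z.2.1) by exact: measurableT_comp.
have m22 : measurable_fun setT (fun z : (R * R) * (R * R) => z.2.2) by exact: measurableT_comp.
apply: measurable_bool; apply: measurable_and; apply: measurable_and.
- exact: measurable_fun_ler.
- exact: measurable_fun_ler.
- apply: measurable_fun_ltr => //; apply: measurable_funM => //.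
  by apply: measurableT_comp => //; exact: measurable_funM.
- apply: measurable_fun_ltr => //; apply: measurable_funM => //.
  by apply: measurableT_comp => //; exact: measurable_funM.
Qed.

Let claim_eventE i j u v : claim_event i j u v =
  (fun w => ((arrival theta i w, arrival theta j w), (X i w, Y j w))) @^-1` E u v.
Proof.
apply/seteqP; split => w; rewrite /claim_event /E /both_arrived /=.
  by move=> [-> [-> ->]].
by move=> /andP[-> /andP[-> ->]].
Qed.

Let mpairT i j : measurable_fun setT (fun w => (arrival theta i w, arrival theta j w)).
Proof. exact: measurable_fun_pair. Qed.

Let mpairX i j : measurable_fun setT (fun w => (X i w, Y j w)).
Proof. exact: measurable_fun_pair. Qed.

Lemma measurable_claim_event i j u v : measurable (claim_event i j u v).
Proof.
rewrite claim_eventE -[_ @^-1` _]setTI.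
exact: (measurable_fun_pair (mpairT i j) (mpairX i j)).
Qed.

(* Conditioning on the arrival times and on the premium event B. *)
Lemma claim_event_mixture B i j u v : (1 <= i)%N -> (1 <= j)%N ->
  measurable B -> sigma_premium C1 C2 B ->
  P (claim_event i j u v `&` B) = (P B * \int[P]_w (if both_arrived theta T i j w then
     joint_tail i j (u * expR (r * arrival theta i w)) (v * expR (r * arrival theta j w))
     else 0)%:E)%E.
Proof.
move=> i1 j1 mB sB.
have pB0 : 0 <= pr P B by exact: pr_ge0.
(* On [B], arrivals and claims behave like the independent coordinates of [P \x P] with total mass
   P(B), by independence of the three sigma-algebras. *)
have law : forall A A' : set (R * R), measurable A -> measurable A' ->
  mrestr P mB ((fun w => (arrival theta i w, arrival theta j w)) @^-1` A `&`
    (fun w => (X i w, Y j w)) @^-1` A') =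
  mscale (NngNum pB0) (P \x P)%E
    ((fun z : Omega * Omega => (arrival theta i z.1, arrival theta j z.1)) @^-1` A `&`
     (fun z : Omega * Omega => (X i z.2, Y j z.2)) @^-1` A').
  move=> A A' mA mA'.
  have mTA : measurable ((fun w => (arrival theta i w, arrival theta j w)) @^-1` A).
    by rewrite -[_ @^-1` _]setTI; exact: mpairT.
  have mXA : measurable ((fun w => (X i w, Y j w)) @^-1` A').
    by rewrite -[_ @^-1` _]setTI; exact: mpairX.
  rewrite /= /mrestr /mscale /= -prE //.
  rewrite [X in (_ * X)%E](_ : _ =
      P ((fun w => (arrival theta i w, arrival theta j w)) @^-1` A) *
      P ((fun w => (X i w, Y j w)) @^-1` A'))%E; last exact: product_measure1E.
  rewrite -setIA setIC.
  rewrite (indep (sigma_claims_pair i1 j1 mA') sB (sigma_interarrival_arrivals i j mA)).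
  by rewrite [X in (X * _)%E]muleC -muleA; congr (_ * _)%E; exact: muleC.
have mf' : measurable_fun setT
    (fun z : Omega * Omega => (arrival theta i z.1, arrival theta j z.1)).
  by apply: measurable_fun_pair; exact: measurableT_comp.
have mg' : measurable_fun setT (fun z : Omega * Omega => (X i z.2, Y j z.2)).
  by apply: measurable_fun_pair; exact: measurableT_comp.
have Pfin : (mrestr P mB setT < +oo)%E.
  by rewrite /mrestr setTI (le_lt_trans (probability_le1 P mB)) ?ltry.
have := pair_law_unique (mpairT i j) (mpairX i j) mf' mg' Pfin law (mE u v).
rewrite /= {1}/mrestr -claim_eventE => ->.
rewrite /mscale /= -prE //; congr (_ * _)%E.
apply: eq_integral => w _ /=; rewrite /xsection /=.
case: ifP => [ij|ij].
  rewrite /joint_tail -prE; last exact: measurable_joint.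
  congr (P _); apply/seteqP; split => z /=; rewrite inE /E /=.
    by rewrite -[_ && (_ <= T)]/(both_arrived theta T i j w) ij /= => /andP.
  by rewrite -[_ && (_ <= T)]/(both_arrived theta T i j w) ij /= => -[-> ->].
rewrite [X in P X](_ : _ = set0) ?measure0 //.
apply/seteqP; split => z //=; rewrite inE /E /=.
by rewrite -[_ && (_ <= T)]/(both_arrived theta T i j w) ij.
Qed.

End Mixing.


(** * Limits in terms of thresholds *)

Section Asymptotics.
Context (R : realType).
Implicit Types (x y z e : R).

Lemma xy_inftyP (Q : set (R * R)) :
  @xy_infty R Q <-> exists x0, forall x y, x0 <= x -> x0 <= y -> Q (x, y).
Proof.
split.
  case=> -[A B] [[a [_ aA]] [b [_ bB]]] AB.
  exists (Num.max a b + 1) => x y hx hy; apply: AB; split => /=.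
    by apply: aA; rewrite (lt_le_trans _ hx) // ltr_pwDr // le_max lexx.
  by apply: bB; rewrite (lt_le_trans _ hy) // ltr_pwDr // le_max lexx orbT.
case=> x0 hQ; exists ([set t | x0 < t], [set t | x0 < t]) => /=.
  by split; exists x0; split => //; exact: num_real.
by move=> [x y] /= [/ltW hx /ltW hy]; exact: hQ.
Qed.

Lemma xyz_inftyP (Q : set ((R * R) * R)) : @xyz_infty R Q ->
  exists x0, forall x y z, x0 <= x -> x0 <= y -> x0 <= z -> Q ((x, y), z).
Proof.
case=> -[A B] [/xy_inftyP[a aA] [b [_ bB]]] AB.
exists (Num.max a (b + 1)) => x y z hx hy hz; apply: AB; split => /=.
  by apply: aA; [move: hx|move: hy]; rewrite ge_max => /andP[].
by apply: bB; move: hz; rewrite ge_max => /andP[_]; apply: lt_le_trans; rewrite ltrDl.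
Qed.

Lemma asymp_xyP (f g : R * R -> R) : (forall x y, 0 <= x -> 0 <= y -> 0 < g (x, y)) ->
  asymp (@xy_infty R) f g <-> forall e, 0 < e -> exists x0, forall x y, x0 <= x -> x0 <= y ->
    `|f (x, y) - g (x, y)| <= e * g (x, y).
Proof.
move=> g0.
have E x y e : 0 <= x -> 0 <= y ->
    (`|1 - f (x, y) / g (x, y)| <= e) = (`|f (x, y) - g (x, y)| <= e * g (x, y)).
  move=> x0 y0; have gxy := g0 x y x0 y0.
  have -> : 1 - f (x, y) / g (x, y) = (g (x, y) - f (x, y)) / g (x, y).
    by rewrite mulrBl divff ?gt_eqF.
  by rewrite normrM normfV (gtr0_norm gxy) distrC ler_pdivrMr.
split => [/cvgrPdist_le h e /h|h].
  move=> /xy_inftyP[x0 hx0]; exists (Num.max 0 x0) => x y.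
  by rewrite !ge_max => /andP[x_ge0 hx] /andP[y_ge0 hy]; rewrite -E //; exact: hx0.
apply/cvgrPdist_le => e /h [x0 hx0]; apply/xy_inftyP; exists (Num.max 0 x0) => x y /=.
by rewrite !ge_max => /andP[x_ge0 hx] /andP[y_ge0 hy]; rewrite E //; exact: hx0.
Qed.

Lemma cvg0_xyz (f : (R * R) * R -> R) e : f @ @xyz_infty R --> (0 : R) -> 0 < e ->
  exists x0, forall x y z, x0 <= x -> x0 <= y -> x0 <= z -> `|f ((x, y), z)| <= e.
Proof. by move=> /cvgr0Pnorm_le h /h /xyz_inftyP. Qed.

End Asymptotics.

(** * Joint tails of two claims and triples of large claims *)

Section ClaimTails.
Context d (Omega : measurableType d) (R : realType) (P : probability Omega R).
Variables (X Y : nat -> Omega -> R) (C : R).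
Hypothesis mX : forall i, measurable_fun setT (X i).
Hypothesis mY : forall i, measurable_fun setT (Y i).
Hypothesis XY_id : forall i (B : set (R * R)), (1 <= i)%N -> measurable B ->
  P ((fun w => (X i w, Y i w)) @^-1` B) = P ((fun w => (X 1%N w, Y 1%N w)) @^-1` B).
Hypothesis X_ge0 : forall i w, 0 <= X i w.
Hypothesis Y_ge0 : forall i w, 0 <= Y i w.
Let Fb := tail P (X 1%N).
Let Gb := tail P (Y 1%N).
Hypothesis F_inf : forall x, 0 < tail P (X 1%N) x.
Hypothesis G_inf : forall y, 0 < tail P (Y 1%N) y.
Hypothesis C_gt0 : 0 < C.
Hypothesis SAI : forall i, (1 <= i)%N -> asymp (@xy_infty R)
  (fun p : R * R => fine (P [set w | p.1 < X i w /\ p.2 < Y i w]))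
  (fun p : R * R => C * tail P (X 1%N) p.1 * tail P (Y 1%N) p.2).
Hypothesis XY_indep : forall i j (A B : set R), (1 <= i)%N -> (1 <= j)%N -> i <> j ->
  measurable A -> measurable B ->
  P (X i @^-1` A `&` Y j @^-1` B) = (P (X i @^-1` A) * P (Y j @^-1` B))%E.
Hypothesis gtai : forall n : nat, GTAI P n X Y.

Definition coef (i j : nat) : R := if i == j then C else 1.

Lemma coef_gt0 i j : 0 < coef i j.
Proof. by rewrite /coef; case: eqP. Qed.

Lemma measurable_exceed (Z : Omega -> R) u : measurable_fun setT Z ->
  measurable [set w | u < Z w].
Proof.
move=> mZ; have := mZ measurableT `]u, +oo[%classic (measurable_itv _).
by rewrite setTI; congr (measurable _); apply/seteqP; split => w /=; rewrite in_itv /= andbT.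
Qed.

Let exceedE (Z : Omega -> R) u : [set w | u < Z w] = Z @^-1` `]u, +oo[%classic.
Proof. by apply/seteqP; split => w /=; rewrite in_itv /= andbT. Qed.

Lemma tail_noninc (Z : Omega -> R) : measurable_fun setT Z ->
  forall u v, u <= v -> tail P Z v <= tail P Z u.
Proof.
move=> mZ u v uv; apply: le_pr; try exact: measurable_exceed.
by move=> w /=; exact: le_lt_trans.
Qed.

Lemma tail_le1 (Z : Omega -> R) u : measurable_fun setT Z -> tail P Z u <= 1.
Proof. by move=> mZ; apply/pr_le1/measurable_exceed. Qed.

Lemma tailX_id i u : (1 <= i)%N -> tail P (X i) u = Fb u.
Proof.
move=> i1; have := XY_id i1 (measurableX (measurable_itv `]u, +oo[) measurableT).
rewrite /Fb /tail !exceedE => h.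
by congr fine; move: h; congr (P _ = P _); apply/seteqP; split => w //= -[].
Qed.

Lemma tailY_id i u : (1 <= i)%N -> tail P (Y i) u = Gb u.
Proof.
move=> i1; have := XY_id i1 (measurableX measurableT (measurable_itv `]u, +oo[)).
rewrite /Gb /tail !exceedE => h.
by congr fine; move: h; congr (P _ = P _); apply/seteqP; split => w //= -[].
Qed.

Lemma joint_tail_indep i j u v : (1 <= i)%N -> (1 <= j)%N -> i <> j ->
  joint_tail P X Y i j u v = Fb u * Gb v.
Proof.
move=> i1 j1 ij; rewrite -(tailX_id u i1) -(tailY_id v j1); apply: EFin_inj.
rewrite EFinM /joint_tail /tail -/(pr P _) -/(pr P _) -!prE; try exact: measurable_exceed.
  by rewrite !exceedE -XY_indep // -!exceedE.
exact: measurable_joint.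
Qed.

Lemma joint_tail_diag i u v : (1 <= i)%N ->
  joint_tail P X Y i i u v = joint_tail P X Y 1 1 u v.
Proof.
move=> i1.
have := XY_id i1 (measurableX (measurable_itv `]u, +oo[) (measurable_itv `]v, +oo[)).
rewrite /joint_tail /pr => h; congr fine; move: h.
by congr (P _ = P _); apply/seteqP; split => w; rewrite /= !in_itv /= !andbT.
Qed.

(** One threshold serves all pairs: off the diagonal independence makes the product exact, and on it
    every pair has the law of the first. *)
Lemma joint_tail_asymp e : 0 < e -> exists x0, forall u v i j, x0 <= u -> x0 <= v ->
  (1 <= i)%N -> (1 <= j)%N ->
  (1 - e) * (coef i j * (Fb u * Gb v)) <= joint_tail P X Y i j u v <=
  (1 + e) * (coef i j * (Fb u * Gb v)).
Proof.
move=> e0.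
pose g (p : R * R) := C * Fb p.1 * Gb p.2.
have g_gt0 x y : 0 <= x -> 0 <= y -> 0 < g (x, y) by rewrite !mulr_gt0 ?F_inf ?G_inf.
have [x0 h] := (asymp_xyP _ g_gt0).1 (SAI (leqnn 1)) e e0; exists x0 => u v i j hu hv i1 j1.
rewrite /coef; case: eqP => [<-|ij]; last first.
  rewrite joint_tail_indep // mul1r.
  have : 0 <= e * (Fb u * Gb v) by rewrite !mulr_ge0 // ltW // ?F_inf ?G_inf.
  by rewrite mulrBl mulrDl mul1r => ?; apply/andP; split; lra.
rewrite joint_tail_diag //; have := h u v hu hv; rewrite /g /= ler_distl.
rewrite -/(pr P _) -/(joint_tail P X Y 1 1 u v) mulrBl mulrDl mul1r mulrA.
by case/andP => ? ?; apply/andP; split; lra.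
Qed.

(** When one argument is below the threshold [x0], the other marginal alone bounds the joint tail,
    the missing factor being at least its value at [x0]: hence the inverses in [K]. The 2 and 2 C
    come from relative error 1 with coefficient 1 or C. *)
Lemma joint_tail_le : exists2 K, 1 <= K & forall i j u v, (1 <= i)%N -> (1 <= j)%N ->
  joint_tail P X Y i j u v <= K * (Fb u * Gb v).
Proof.
have [x0 h] := @joint_tail_asymp 1 ltr01.
pose K := Num.max (Num.max 2 (2 * C)) (Num.max (Fb x0)^-1 (Gb x0)^-1).
have K1 : 1 <= K by rewrite !le_max ler1n.
exists K => // i j u v i1 j1.
have F0 : 0 <= Fb u by apply/ltW/F_inf.
have G0 : 0 <= Gb v by apply/ltW/G_inf.
have [ux0|/ltW ux0] := leP x0 u; last first.
  apply: (@le_trans _ _ (Gb v)).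
    rewrite -(tailY_id v j1); apply: le_pr; [exact: measurable_joint|exact: measurable_exceed|].
    by move=> w [].
  rewrite mulrA -[leLHS]mul1r ler_wpM2r //.
  have Fx : Fb x0 <= Fb u by exact: tail_noninc.
  have : (Fb x0)^-1 * Fb u <= K * Fb u by rewrite ler_wpM2r // !le_max lexx !orbT.
  by apply: le_trans; rewrite ler_pdivlMl ?F_inf // mulr1.
have [vx0|/ltW vx0] := leP x0 v; last first.
  apply: (@le_trans _ _ (Fb u)).
    rewrite -(tailX_id u i1); apply: le_pr; [exact: measurable_joint|exact: measurable_exceed|].
    by move=> w [].
  rewrite mulrCA -[leLHS]mulr1 ler_wpM2l //.
  have Gx : Gb x0 <= Gb v by exact: tail_noninc.
  have : (Gb x0)^-1 * Gb v <= K * Gb v by rewrite ler_wpM2r // !le_max lexx !orbT.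
  by apply: le_trans; rewrite ler_pdivlMl ?G_inf // mulr1.
have /andP[_ /le_trans] := h u v i j ux0 vx0 i1 j1; apply.
rewrite [leLHS]mulrA ler_wpM2r ?mulr_ge0 // !le_max /coef.
case: eqP => _; first by rewrite lexx orbT.
by rewrite mulr1 lexx.
Qed.

Definition triple_X i k j a u v := [set w | a < X i w /\ u < X k w /\ v < Y j w].
Definition triple_Y j i k a u v := [set w | a < Y j w /\ u < X i w /\ v < Y k w].

Lemma measurable_triple_X i k j a u v : measurable (triple_X i k j a u v).
Proof. by apply: measurableI; [|apply: measurableI]; exact: measurable_exceed. Qed.

Lemma measurable_triple_Y j i k a u v : measurable (triple_Y j i k a u v).
Proof. by apply: measurableI; [|apply: measurableI]; exact: measurable_exceed. Qed.

(** GTAI gives a limit for each triple of indices; finitely many triples share a threshold. *)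
Let uniform_threshold n (Q : nat -> nat -> nat -> R -> Prop) :
  (forall i j k a b, a <= b -> Q i j k a -> Q i j k b) ->
  (forall i j k, (1 <= i <= n)%N -> (1 <= j <= n)%N -> (1 <= k <= n)%N -> exists a, Q i j k a) ->
  exists a, forall i j k, (1 <= i <= n)%N -> (1 <= j <= n)%N -> (1 <= k <= n)%N -> Q i j k a.
Proof.
move=> Qmon.
have unif (S : nat -> R -> Prop) : (forall i a b, a <= b -> S i a -> S i b) ->
    (forall i, (1 <= i <= n)%N -> exists a, S i a) ->
    exists a, forall i, (1 <= i <= n)%N -> S i a.
  move=> Smon; elim: n => [|m IHm] h; first by exists 0 => -[].
  have [a ha] : exists a, forall i, (1 <= i <= m)%N -> S i a.
    by apply: IHm => i /andP[i1 im]; apply: h; rewrite i1 leqW.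
  have [b hb] := h m.+1 (leqnn _); exists (Num.max a b) => i /andP[i1].
  rewrite leq_eqVlt => /orP[/eqP->|im]; first by apply: Smon hb; rewrite le_max lexx orbT.
  by apply: (Smon _ a); [rewrite le_max lexx|apply: ha; rewrite i1 -ltnS].
move=> h.
have [i a b ab hi j k j1 k1|i i1|a ha] :=
    unif (fun i a => forall j k, (1 <= j <= n)%N -> (1 <= k <= n)%N -> Q i j k a).
- exact: Qmon (hi j k j1 k1).
- have [j a b ab hj k k1|j j1|a ha] := unif (fun j a => forall k, (1 <= k <= n)%N -> Q i j k a).
  + exact: Qmon (hj k k1).
  + by apply: unif => [k a b|k k1]; [exact: Qmon|exact: h].
  + by exists a => j k j1 k1; exact: ha.
- by exists a => i j k i1 j1 k1; exact: ha.
Qed.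

(** GTAI bounds a conditional probability. The conditioning pair has joint tail at most [K] times
    the product of the tails, so GTAI is used with e / K. *)
Lemma gtai_bound n e : 0 < e -> exists x0, forall i j k, (1 <= i <= n)%N ->
  (1 <= j <= n)%N -> (1 <= k <= n)%N -> i <> k ->
  forall a u v, x0 <= a -> x0 <= u -> x0 <= v ->
    pr P (triple_X i k j a u v) <= e * (Fb u * Gb v) /\
    pr P (triple_Y i j k a u v) <= e * (Fb u * Gb v).
Proof.
move=> e0; have [K K1 hK] := joint_tail_le.
have K0 : 0 < K := lt_le_trans ltr01 K1.
apply: (@uniform_threshold n (fun i j k x0 => i <> k -> forall a u v,
    x0 <= a -> x0 <= u -> x0 <= v ->
    pr P (triple_X i k j a u v) <= e * (Fb u * Gb v) /\
    pr P (triple_Y i j k a u v) <= e * (Fb u * Gb v))).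
  move=> i j k x0 x1 x01 h ik a u v ha hu hv.
  by apply: h => //; exact: le_trans x01 _.
move=> i j k i1 j1 k1.
have [/eqP|/eqP ik] := boolP (i == k); first by exists 0.
have eK : 0 < e / K by rewrite divr_gt0.
have [hX hY] := gtai n.
have [a0 ha0] := cvg0_xyz (hX i k j i1 k1 j1 ik) eK.
have [b0 hb0] := cvg0_xyz (hY i k j i1 k1 j1 ik) eK.
exists (Num.max a0 b0) => _ a u v; rewrite !ge_max => /andP[a1 a2] /andP[u1 u2] /andP[v1 v2].
have quotient (Z : Omega -> R) (m m' : nat) : (1 <= m)%N -> (1 <= m')%N ->
    measurable_fun setT Z -> (forall w, 0 <= Z w) ->
    `|fine (P ([set w | a < `|Z w|] `&` [set w | u < X m w] `&` [set w | v < Y m' w]))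
      / fine (P ([set w | u < X m w] `&` [set w | v < Y m' w]))| <= e / K ->
    pr P ([set w | a < Z w] `&` ([set w | u < X m w] `&` [set w | v < Y m' w])) <=
      e * (Fb u * Gb v).
  move=> m1 m'1 mZ Z0.
  have -> : [set w | a < `|Z w|] = [set w | a < Z w].
    by apply/seteqP; split => w /=; rewrite ger0_norm.
  rewrite -setIA -!/(pr P _).
  set A := [set w | a < Z w]; set B := [set w | u < X m w] `&` [set w | v < Y m' w].
  have mA : measurable A by exact: measurable_exceed.
  have mB : measurable B by apply: measurableI; exact: measurable_exceed.
  have AB : pr P (A `&` B) <= pr P B by apply: le_pr => //; exact: measurableI.
  have BK : pr P B <= K * (Fb u * Gb v) by exact: hK.
  (* A vanishing denominator makes the quotient 0 by convention and its bound empty of content; then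
     the intersection is null as well. *)
  have [B0|B0] := eqVneq (pr P B) 0.
    by move=> _; rewrite (le_trans AB) // B0 !mulr_ge0 // ltW // ?F_inf ?G_inf.
  have Bgt0 : 0 < pr P B by rewrite lt_def B0 pr_ge0.
  rewrite ger0_norm; last by rewrite divr_ge0 // pr_ge0 //; exact: measurableI.
  rewrite ler_pdivrMr // => /le_trans; apply.
  have eK0 := ltW eK.
  apply: le_trans (ler_wpM2l eK0 BK) _.
  by rewrite mulrA divfK // gt_eqF.
have [i0 _] := andP i1; have [j0 _] := andP j1; have [k0 _] := andP k1.
split.
  exact: quotient (ha0 a u v a1 u1 v1).
exact: quotient (hb0 a u v a2 u2 v2).
Qed.

End ClaimTails.

(** * Truncation of Delta and comparison with the product of the tails *)

Section DeltaBounds.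
Context d (Omega : measurableType d) (R : realType) (P : probability Omega R).
Variable theta : nat -> Omega -> R.
Hypothesis mtheta : forall i, measurable_fun setT (theta i).
Hypothesis theta_pos : forall i w, 0 < theta i w.
Hypothesis theta_indep : indep_seq P theta.
Hypothesis theta_id : forall i (B : set R), (1 <= i)%N -> measurable B ->
  P (theta i @^-1` B) = P (theta 1%N @^-1` B).
Variables (Fb Gb : R -> R) (r C T : R).
Hypothesis Fb_gt0 : forall x, 0 < Fb x.
Hypothesis Gb_gt0 : forall x, 0 < Gb x.
Hypothesis Fb_le1 : forall x, Fb x <= 1.
Hypothesis Gb_le1 : forall x, Gb x <= 1.
Hypothesis Fb_ni : forall x y, x <= y -> Fb y <= Fb x.
Hypothesis Gb_ni : forall x y, x <= y -> Gb y <= Gb x.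
Hypothesis Fb_D : classD Fb.
Hypothesis Gb_D : classD Gb.
Hypothesis r_ge0 : 0 <= r.
Hypothesis C_gt0 : 0 < C.
Hypothesis lamT_gt0 : (0 < renewal_fun P theta T)%E.

Let pm := pair_mass P theta Fb Gb r T.

Definition pair_mass_square n x y : R :=
  \sum_(0 <= i < n) \sum_(0 <= j < n) coef C i.+1 j.+1 * pm i.+1 j.+1 x y.

Let term_ge0 i j x y : 0 <= coef C i j * pm i j x y.
Proof. by rewrite mulr_ge0 // ?(ltW (coef_gt0 _ _ _)) // pair_mass_ge0. Qed.

Let squareE n x y : pair_mass_square n x y =
  \sum_(0 <= i < n) \sum_(0 <= m < n | (m + i.+1 < n)%N)
    (pm (m + i.+2) i.+1 x y + pm i.+1 (m + i.+2) x y) +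
  C * \sum_(0 <= i < n) pm i.+1 i.+1 x y.
Proof.
rewrite /pair_mass_square.
rewrite (sum_square_split n (fun i j => coef C i.+1 j.+1 * pm i.+1 j.+1 x y)).
congr (_ + _); last first.
  by rewrite mulr_sumr; apply: eq_bigr => i _; rewrite /coef eqxx.
apply: eq_bigr => i _; apply: eq_bigr => m _.
have ne : (m + i.+2 == i.+1)%N = false := gtn_eqF (leq_addl _ _).
by rewrite -addnS /coef ne eq_sym ne !mul1r.
Qed.

(** Discarded pairs are small because P(T_k <= T) <= K 2^-k at the later index [k]. A smaller index
    and a gap both below [n] stay in the square of side 2n, whence [n.*2]. In [kap], 16 K is 8 times
    2 K for the double series and 2 C K is for the diagonal. *)
Lemma Delta_bounds : exists2 kap, 0 < kap & forall x y, 0 <= x -> 0 <= y ->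
  exists2 D, Delta (renewal_measure P theta) Fb Gb C r x y T = D%:E &
  forall n, pair_mass_square n x y <= D <=
    pair_mass_square n.*2 x y + kap * (Fb x * Gb y) * 2^-1 ^+ n.
Proof.
have half : 0 < (2^-1 : R) <= 1 by rewrite invr_gt0 ltr0n invf_le1 // ler1n.
have [K K0 hK] := arrival_superexponential mtheta theta_pos theta_indep theta_id T half.
exists (16 * K + 2 * C * K); first by rewrite addr_gt0 // !mulr_gt0.
move=> x y x0 y0; pose Phi := Fb x * Gb y.
have Phi0 : 0 < Phi by rewrite mulr_gt0.
have pm_le i m j k : (i + m <= k)%N -> (k == j.1) || (k == j.2) ->
    pm j.1 j.2 x y <= K * Phi * 2^-1 ^+ i * 2^-1 ^+ m.
  move=> imk kj.
  apply: (le_trans (pair_mass_le P mtheta theta_pos T Fb_gt0 Gb_gt0 Fb_ni Gb_ni r_ge0 x0 y0 kj)).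
  have {}hK := hK k.
  have -> : K * Phi * 2^-1 ^+ i * 2^-1 ^+ m = Phi * (K * 2^-1 ^+ (i + m)) by rewrite exprD; ring.
  rewrite ler_pM2l // (le_trans hK) // ler_pM2l //.
  by case/andP: half => /ltW h0 h1; exact: ler_wiXn2l.
have pm0 i j : 0 <= pm i j x y by exact: pair_mass_ge0.
have h1 i m : 0 <= pm (m + i.+2) i.+1 x y + pm i.+1 (m + i.+2) x y <=
    (2 * (K * Phi)) * 2^-1 ^+ i * 2^-1 ^+ m.
  rewrite addr_ge0 //=.
  have im : (i + m <= m + i.+2)%N by rewrite addnC leq_add2l ltnW.
  have := pm_le i m ((m + i.+2)%N, i.+1) _ im; rewrite eqxx => /(_ isT) /= h.
  have := pm_le i m (i.+1, (m + i.+2)%N) _ im; rewrite eqxx orbT => /(_ isT) /= h'.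
  by rewrite -!mulrA !mulrA in h h' *; lra.
have h2 i : 0 <= pm i.+1 i.+1 x y <= (K * Phi) * 2^-1 ^+ i.
  rewrite pm0 /=.
  have := pm_le i 0%N (i.+1, i.+1) i.+1; rewrite addn0 leqnSn eqxx => /(_ isT isT) /=.
  by rewrite expr0 mulr1.
have [S1 S1E hS1] := double_geometric_series_bounds h1.
have [S2 S2E hS2] := geometric_series_bounds h2.
exists (S1 + C * S2).
  rewrite (Delta_series mtheta theta_pos theta_indep theta_id C T Fb_gt0 Gb_gt0 Fb_ni Gb_ni r_ge0 x0 y0).
  by rewrite EFinD EFinM -S1E -S2E.
move=> n; apply/andP; split.
  rewrite squareE; apply: lerD; last first.
    by rewrite ler_pM2l //; have /andP[] := hS2 n.
  have /andP[+ _] := hS1 n; apply: le_trans.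
  apply: ler_sum => i _; rewrite big_mkcond; apply: ler_sum => m _.
  by case: ifP => // _; have /andP[] := h1 i m.
have tri : \sum_(0 <= i < n) \sum_(0 <= m < n) (pm (m + i.+2) i.+1 x y + pm i.+1 (m + i.+2) x y) <=
    \sum_(0 <= i < n.*2) \sum_(0 <= m < n.*2 | (m + i.+1 < n.*2)%N)
    (pm (m + i.+2) i.+1 x y + pm i.+1 (m + i.+2) x y).
  have nn : (n <= n.*2)%N by rewrite -addnn leq_addr.
  rewrite [leRHS](big_cat_nat (leq0n n) nn) /= -[leLHS]addr0; apply: lerD; last first.
    by apply: sumr_ge0 => i _; apply: sumr_ge0 => m _; rewrite addr_ge0.
  rewrite big_nat_cond [leRHS]big_nat_cond.
  apply: ler_sum => i /andP[/andP[_ ni] _].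
  rewrite [leRHS]big_mkcond [leRHS](big_cat_nat (leq0n n) nn) /= -[leLHS]addr0; apply: lerD; last first.
    by apply: sumr_ge0 => m _; case: ifP => // _; rewrite addr_ge0.
  rewrite big_nat_cond [leRHS]big_nat_cond.
  apply: ler_sum => m /andP[/andP[_ nm] _].
  by rewrite ifT // -addnn -addSn leq_add.
have diag : \sum_(0 <= i < n) pm i.+1 i.+1 x y <= \sum_(0 <= i < n.*2) pm i.+1 i.+1 x y.
  have nn : (n <= n.*2)%N by rewrite -addnn leq_addr.
  by rewrite [leRHS](big_cat_nat (leq0n n) nn) /= lerDl sumr_ge0.
rewrite squareE.
have /andP[_ hS1n] := hS1 n; have /andP[_ hS2n] := hS2 n.
have hS2n' := ler_wpM2l (ltW C_gt0) hS2n.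
have diag' := ler_wpM2l (ltW C_gt0) diag.
rewrite -/Phi mulrDr in hS2n' *.
set p := (2^-1 ^+ n) in hS1n hS2n' *.
have -> : (16 * K + 2 * C * K) * Phi * p = 8 * (2 * (K * Phi)) * p + C * (2 * (K * Phi) * p) by ring.
lra.
Qed.

(** If P(T_1 <= T) vanished, so would every P(T_i <= T), as T_1 <= T_i, and their sum lambda(T). *)
Lemma first_arrival_gt0 : 0 < pr P [set w | arrival theta 1 w <= T].
Proof.
have mA i : measurable [set w | arrival theta i w <= T].
  have := measurable_arrival mtheta i measurableT (measurable_itv `]-oo, T]).
  by rewrite setTI; congr (measurable _); apply/seteqP; split => w /=; rewrite in_itv.
rewrite lt_def pr_ge0 // andbT; apply/negP => /eqP p0.
have pA i : (1 <= i)%N -> P [set w | arrival theta i w <= T] = 0%E.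
  move=> i1; apply/eqP; rewrite eq_le measure_ge0 andbT.
  rewrite [leRHS](_ : _ = P [set w | arrival theta 1 w <= T]); last by rewrite prE // p0.
  rewrite le_measure ?inE // => w /=; apply: le_trans.
  exact: arrival_le.
move: lamT_gt0; rewrite /renewal_fun /Ncount.
pose g i w : \bar R := (if arrival theta i w <= T then 1 else 0)%:E.
have g0 i w : (0 <= g i w)%E by rewrite lee_fin; case: ifP.
have -> : (fun w => \sum_(1 <= i <oo) g i w)%E = (fun w => \sum_(0 <= i <oo) g i.+1 w)%E.
  apply/funext => w; rewrite -(@nneseries_addn _ _ 1) => [|i]; last exact: g0.
  by apply: eq_eseriesr => i _; rewrite addn1.
rewrite integral_nneseries //; last first.
  move=> i; apply/measurable_EFinP; apply: measurable_fun_ifT => //.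
  by apply: measurable_fun_ler => //; exact: measurable_arrival.
rewrite eseries0 ?ltxx // => i _ _.
rewrite (_ : g i.+1 = (fun w => (\1_[set w | arrival theta i.+1 w <= T] w)%:E)).
  by rewrite integral_indic // setIT; exact: pA.
apply/funext => w; rewrite /g indicE.
by case: ifP => h; [rewrite mem_set|rewrite memNset //= h].
Qed.

(** The term i = j = 1 alone controls the unit of error: T_1 <= T has positive probability, and the
    class D pays for thresholds raised by e^{rT}. *)
Lemma tails_le_pair_mass_square : exists2 K, 0 < K & forall n x y, (0 < n)%N ->
  0 <= x -> 0 <= y -> Fb x * Gb y <= K * pair_mass_square n x y.
Proof.
have [K1 K11 hK1] := tail_scale Fb_gt0 Fb_le1 Fb_ni (expR (r * T)) Fb_D.
have [K2 K21 hK2] := tail_scale Gb_gt0 Gb_le1 Gb_ni (expR (r * T)) Gb_D.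
have p0 := first_arrival_gt0; set p := pr P _ in p0.
have K10 := lt_le_trans ltr01 K11; have K20 := lt_le_trans ltr01 K21.
exists (K1 * K2 / p / C); first by rewrite !divr_gt0 // mulr_gt0.
move=> n x y n0 x0 y0.
have e1 : Fb x * Gb y <= K1 * K2 * (Fb (expR (r * T) * x) * Gb (expR (r * T) * y)).
  rewrite mulrACA; apply: ler_pM; rewrite ?(ltW (Fb_gt0 _)) ?(ltW (Gb_gt0 _)) //.
  - exact: hK1.
  - exact: hK2.
apply: le_trans e1 _; rewrite -!mulrA ler_pM2l // ler_pM2l // mulrCA.
rewrite ler_pdivlMl // ler_pdivlMl // mulrC.
have e2 := pair_mass_diag_ge P mtheta theta_pos T Fb_gt0 Gb_gt0 Fb_ni Gb_ni r_ge0 1 x0 y0.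
have e3 : C * pm 1 1 x y <= pair_mass_square n x y.
  rewrite /pair_mass_square big_ltn // [X in _ <= X + _]big_ltn // {1}/coef eqxx -addrA lerDl.
  by rewrite addr_ge0 // sumr_ge0 // => i _; rewrite ?sumr_ge0 // => j _.
by rewrite -mulrA; exact: le_trans (ler_wpM2l (ltW C_gt0) e2) e3.
Qed.

End DeltaBounds.

(** The integral of a non-negative function is the supremum over the simple functions below it.
    Comparison at this level applies directly to [joint_tail] evaluated along the arrival times. *)
Lemma ge0_integral_monotone d (T : measurableType d) (R : realType)
    (mu : {measure set T -> \bar R}) (f g : T -> \bar R) :
  (forall w, 0 <= f w)%E -> (forall w, f w <= g w)%E ->
  (\int[mu]_w f w <= \int[mu]_w g w)%E.
Proof.
move=> f0 fg; have g0 w : (0 <= g w)%E := le_trans (f0 w) (fg w).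
rewrite !ge0_integralTE //; apply: ereal_sup_le => _ [h hf <-].
by exists h => // w; exact: le_trans (hf w) (fg w).
Qed.

(** * Probability of a pair of large discounted claims *)

Section ClaimEstimates.
Context d (Omega : measurableType d) (R : realType) (P : probability Omega R).
Variables (X Y theta : nat -> Omega -> R) (C1 C2 : Omega -> cumulative R R) (r C T : R).
Hypothesis mX : forall i, measurable_fun setT (X i).
Hypothesis mY : forall i, measurable_fun setT (Y i).
Hypothesis mtheta : forall i, measurable_fun setT (theta i).
Hypothesis theta_pos : forall i w, 0 < theta i w.
Hypothesis indep : indep3 P (sigma_claims X Y) (sigma_premium C1 C2) (sigma_interarrival theta).
Hypothesis XY_id : forall i (B : set (R * R)), (1 <= i)%N -> measurable B ->
  P ((fun w => (X i w, Y i w)) @^-1` B) = P ((fun w => (X 1%N w, Y 1%N w)) @^-1` B).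
Hypothesis F_inf : forall x, 0 < tail P (X 1%N) x.
Hypothesis G_inf : forall y, 0 < tail P (Y 1%N) y.
Hypothesis C_gt0 : 0 < C.
Hypothesis SAI : forall i, (1 <= i)%N -> asymp (@xy_infty R)
  (fun p : R * R => fine (P [set w | p.1 < X i w /\ p.2 < Y i w]))
  (fun p : R * R => C * tail P (X 1%N) p.1 * tail P (Y 1%N) p.2).
Hypothesis XY_indep : forall i j (A B : set R), (1 <= i)%N -> (1 <= j)%N -> i <> j ->
  measurable A -> measurable B ->
  P (X i @^-1` A `&` Y j @^-1` B) = (P (X i @^-1` A) * P (Y j @^-1` B))%E.
Hypothesis r_ge0 : 0 <= r.

Let Fb := tail P (X 1%N).
Let Gb := tail P (Y 1%N).
Let pm := pair_mass P theta Fb Gb r T.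
Let Fb_ni : forall x y, x <= y -> Fb y <= Fb x. Proof. exact: tail_noninc. Qed.
Let Gb_ni : forall x y, x <= y -> Gb y <= Gb x. Proof. exact: tail_noninc. Qed.

Let exp_ge1 i w : 1 <= expR (r * arrival theta i w).
Proof. by rewrite -expR0 ler_expR mulr_ge0 ?arrival_ge0. Qed.

Let weight_ge0 i j x y w : 0 <= pair_weight theta Fb Gb r T i j x y w.
Proof. exact: pair_weight_ge0. Qed.

Let scaled_pair_mass c i j x y : 0 <= c -> 0 <= x -> 0 <= y ->
  (\int[P]_w (c * pair_weight theta Fb Gb r T i j x y w)%:E)%E = (c * pm i j x y)%:E.
Proof.
move=> c0 x0 y0; rewrite EFinM -(pair_massE P mtheta theta_pos T F_inf G_inf Fb_ni Gb_ni r_ge0) //.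
rewrite -ge0_integralZl_EFin //.
- by move=> w _; rewrite lee_fin.
- exact/measurable_EFinP/measurable_pair_weight.
Qed.

(** SAI is applied under the integral of the mixture: discounting only raises the thresholds, so one
    [x0] serves all arrival times and indices. The lower bound keeps P(B), where [B] will bound the
    premiums. *)
Lemma claim_event_bounds e : 0 < e < 1 -> exists2 x0, 0 <= x0 &
  forall i j x y B, (1 <= i)%N -> (1 <= j)%N -> x0 <= x -> x0 <= y ->
  measurable B -> sigma_premium C1 C2 B ->
  (1 - e) * pr P B * (coef C i j * pm i j x y) <= pr P (claim_event X Y theta r T i j x y `&` B)
    <= (1 + e) * (coef C i j * pm i j x y).
Proof.
case/andP=> e0 e1.
have [a ha] := joint_tail_asymp mX mY XY_id F_inf G_inf C_gt0 SAI XY_indep e0.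
exists (Num.max a 0); first by rewrite le_max lexx orbT.
move=> i j x y B i1 j1; rewrite !ge_max => /andP[ax x0] /andP[ay y0] mB sB.
have c0 : 0 < coef C i j := coef_gt0 C_gt0 i j.
pose I := (\int[P]_w (if both_arrived theta T i j w then
     joint_tail P X Y i j (x * expR (r * arrival theta i w)) (y * expR (r * arrival theta j w))
     else 0)%:E)%E.
have PE : P (claim_event X Y theta r T i j x y `&` B) = (P B * I)%E.
  exact: (claim_event_mixture (C1 := C1) (C2 := C2)).
have cw w : (1 - e) * (coef C i j * pair_weight theta Fb Gb r T i j x y w) <=
    (if both_arrived theta T i j w then joint_tail P X Y i j
      (x * expR (r * arrival theta i w)) (y * expR (r * arrival theta j w)) else 0)
    <= (1 + e) * (coef C i j * pair_weight theta Fb Gb r T i j x y w).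
  rewrite /pair_weight; case: ifP => _; last by rewrite !mulr0 lexx.
  by apply: ha => //; [apply: (le_trans ax)|apply: (le_trans ay)]; rewrite ler_peMr.
have jt0 w : 0 <= (if both_arrived theta T i j w then joint_tail P X Y i j
      (x * expR (r * arrival theta i w)) (y * expR (r * arrival theta j w)) else 0).
  by case: ifP => // _; apply: pr_ge0; exact: measurable_joint.
have e1' : 0 <= 1 - e by rewrite subr_ge0 ltW.
have I_le : (I <= ((1 + e) * (coef C i j * pm i j x y))%:E)%E.
  rewrite mulrA -scaled_pair_mass //; last by rewrite mulr_ge0 ?addr_ge0 // ltW.
  apply: ge0_integral_monotone => w; rewrite lee_fin //.
  by rewrite -mulrA; have /andP[] := cw w.
have I_ge : (((1 - e) * (coef C i j * pm i j x y))%:E <= I)%E.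
  rewrite mulrA -scaled_pair_mass //; last by rewrite mulr_ge0 // ltW.
  apply: ge0_integral_monotone => w; rewrite lee_fin.
    by rewrite !mulr_ge0 // ltW.
  by rewrite -mulrA; have /andP[] := cw w.
have I0 : (0 <= I)%E by apply: integral_ge0 => w _; rewrite lee_fin.
have If : I \is a fin_num by rewrite ge0_fin_numE // (le_lt_trans I_le) // ltry.
have -> : pr P (claim_event X Y theta r T i j x y `&` B) = pr P B * fine I.
  by rewrite /pr PE fineM // fin_num_measure.
rewrite -[I]fineK // !lee_fin in I_le I_ge I0.
apply/andP; split.
  by rewrite mulrAC mulrC ler_wpM2l // pr_ge0.
by apply: le_trans I_le; rewrite ler_piMl // pr_le1.
Qed.

Lemma claim_event_le e : 0 < e < 1 -> exists2 x0, 0 <= x0 &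
  forall i j x y, (1 <= i)%N -> (1 <= j)%N -> x0 <= x -> x0 <= y ->
  pr P (claim_event X Y theta r T i j x y) <= (1 + e) * (coef C i j * pm i j x y).
Proof.
move=> /claim_event_bounds[x0 x00 h]; exists x0 => // i j x y i1 j1 hx hy.
have [sT mT] : sigma_premium C1 C2 setT /\ @measurable _ Omega setT.
  split => //.
  exact: (@measurableT _ (g_sigma_algebraType [set A | exists t : R, 0 <= t /\
    exists B : set R, measurable B /\
    (A = (fun w => C1 w t) @^-1` B \/ A = (fun w => C2 w t) @^-1` B)])).
by have /andP[_] := h i j x y setT i1 j1 hx hy mT sT; rewrite setIT.
Qed.

Hypothesis F_L : classL (tail P (X 1%N)).
Hypothesis G_L : classL (tail P (Y 1%N)).

(** Scaling turns the shift [L] into L e^{r T_i}, at most L e^{rT}, so the class L applies with this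
    fixed shift along all arrivals. *)
Lemma pair_mass_shift L e : 0 <= L -> 0 < e -> exists2 x0, 0 <= x0 & forall i j x y, x0 <= x ->
  x0 <= y -> pm i j x y <= (1 + e) * pm i j (x + L) (y + L).
Proof.
move=> L0 e0.
have LT0 : 0 <= L * expR (r * T) by rewrite mulr_ge0 // expR_ge0.
(* Each line costs a factor 1 + h, and (1 + h)^2 <= 1 + 3 h <= 1 + e. *)
pose h := Num.min 1 (e / 3).
have h0 : 0 < h by rewrite lt_min ltr01 divr_gt0.
have h1 : h <= 1 by rewrite ge_min lexx.
have h3 : h <= e / 3 by rewrite ge_min lexx orbT.
have [a ha] := classL_shift F_inf F_L LT0 h0.
have [b hb] := classL_shift G_inf G_L LT0 h0.
exists (Num.max 0 (Num.max a b)); first by rewrite le_max lexx.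
move=> i j x y; rewrite !ge_max => /and3P[x0 ax bx] /and3P[y0 ay bY].
have e1 : 0 <= 1 + e by rewrite addr_ge0 // ltW.
rewrite -lee_fin -scaled_pair_mass ?addr_ge0 ?(ltW e0) //.
rewrite -[leLHS](pair_massE P mtheta theta_pos T F_inf G_inf Fb_ni Gb_ni r_ge0) //.
apply: ge0_integral_monotone => w; rewrite lee_fin //.
rewrite /pair_weight; case: ifP => [/andP[iT jT]|_]; last by rewrite mulr0.
have stretch (V : R -> R) c k z : (forall x y, x <= y -> V y <= V x) ->
    (forall x, c <= x -> V x <= (1 + h) * V (x + L * expR (r * T))) ->
    0 <= z -> c <= z -> arrival theta k w <= T ->
    V (z * expR (r * arrival theta k w)) <= (1 + h) * V ((z + L) * expR (r * arrival theta k w)).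
  move=> V_ni hV z0 cz kT; apply: le_trans (hV _ _) _.
    by rewrite (le_trans cz) // ler_peMr.
  rewrite ler_wpM2l ?addr_ge0 ?(ltW h0) //; apply: V_ni.
  by rewrite mulrDl lerD2l ler_wpM2l // ler_expR ler_wpM2l.
have eF := stretch Fb a i x Fb_ni ha x0 ax iT.
have eG := stretch Gb b j y Gb_ni hb y0 bY jT.
apply: le_trans (ler_pM _ _ eF eG) _; try exact/ltW/F_inf; try exact/ltW/G_inf.
rewrite mulrACA ler_wpM2r //.
  by rewrite mulr_ge0 // ltW ?F_inf ?G_inf.
have : h * h <= h by rewrite ler_piMr // ltW.
lra.
Qed.

End ClaimEstimates.

(** * Pigeonhole for finite sums *)

Section FiniteSums.
Context (R : realType).

Lemma sum_le_size (I : eqType) (s : seq I) (Q : pred I) (f : I -> R) (c : R) : 0 <= c ->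
  (forall i, i \in s -> Q i -> f i <= c) -> \sum_(i <- s | Q i) f i <= c * (size s)%:R.
Proof.
move=> c0; elim: s => [|i s IHs] h; first by rewrite big_nil mulr0.
have {}IHs : \sum_(j <- s | Q j) f j <= c * (size s)%:R.
  by apply: IHs => j js; apply: h; rewrite inE js orbT.
rewrite big_cons /= -natr1 mulrDr mulr1; case: ifP => Qi.
  by rewrite addrC lerD // h // inE eqxx.
by rewrite (le_trans IHs) // lerDl.
Qed.

Lemma sum_gt_exists (I : eqType) (s : seq I) (Q : pred I) (f : I -> R) (c : R) n : 0 <= c ->
  (size s <= n)%N -> c * n%:R < \sum_(i <- s | Q i) f i ->
  exists i, [/\ i \in s, Q i & c < f i].
Proof.
move=> c0 sn h; apply: contrapT => H; move: h; apply/negP; rewrite -leNgt.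
apply: (@le_trans _ _ (c * (size s)%:R)); last by rewrite ler_wpM2l // ler_nat.
by apply: sum_le_size => // i si Qi; rewrite leNgt; apply/negP => ?; apply: H; exists i.
Qed.

(** Some term [k] exceeds x / n; if it is at most x - L, the others still sum to more than L and one
    of them exceeds L / n. The bound [n] keeps these thresholds independent of the actual number [m]
    of terms. *)
Lemma sum_gt_one_or_two (a : nat -> R) m n x L : (forall i, 0 <= a i) -> (m <= n)%N -> (0 < n)%N ->
  0 <= x -> 0 <= L -> x < \sum_(1 <= i < m.+1) a i ->
  (exists2 i, (1 <= i <= m)%N & x - L < a i) \/
  (exists i k, [/\ (1 <= i <= m)%N, (1 <= k <= m)%N, i <> k, L / n%:R < a i & x / n%:R < a k]).
Proof.
move=> a0 mn n0 x0 L0 xa.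
have n0' : n%:R != 0 :> R by rewrite pnatr_eq0 -lt0n.
have sz : (size (index_iota 1 m.+1) <= n)%N by rewrite size_iota subn1.
have [k [km _ xk]] : exists k, [/\ k \in index_iota 1 m.+1, true & x / n%:R < a k].
  by apply: (sum_gt_exists _ sz); rewrite ?divr_ge0 // divfK.
have [kL|kL] := ltP (x - L) (a k).
  by left; exists k => //; move: km; rewrite mem_index_iota ltnS.
right; have Lk : L < \sum_(i <- index_iota 1 m.+1 | i != k) a i.
  by move: xa; rewrite (bigD1_seq k) ?iota_uniq //=; lra.
have [i [im ik Li]] : exists i, [/\ i \in index_iota 1 m.+1, i != k & L / n%:R < a i].
  by apply: (sum_gt_exists _ sz); rewrite ?divr_ge0 // divfK.
by exists i, k; rewrite !mem_index_iota !ltnS in im km *; split => //; exact/eqP.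
Qed.

End FiniteSums.

(** * Lower and upper bounds for the ruin probabilities *)

Section RuinAsymptotics.
Context d (Omega : measurableType d) (R : realType) (P : probability Omega R).
Variables (X Y theta : nat -> Omega -> R) (C1 C2 : Omega -> cumulative R R) (r C T : R).
Hypothesis mX : forall i, measurable_fun setT (X i).
Hypothesis mY : forall i, measurable_fun setT (Y i).
Hypothesis mtheta : forall i, measurable_fun setT (theta i).
Hypothesis mC1 : forall t, measurable_fun setT (fun w => C1 w t).
Hypothesis mC2 : forall t, measurable_fun setT (fun w => C2 w t).
Hypothesis C1_0 : forall w t, t <= 0 -> C1 w t = 0.
Hypothesis C2_0 : forall w t, t <= 0 -> C2 w t = 0.
Hypothesis theta_pos : forall i w, 0 < theta i w.
Hypothesis theta_indep : indep_seq P theta.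
Hypothesis theta_id : forall i (B : set R), (1 <= i)%N -> measurable B ->
  P (theta i @^-1` B) = P (theta 1%N @^-1` B).
Hypothesis indep : indep3 P (sigma_claims X Y) (sigma_premium C1 C2) (sigma_interarrival theta).
Hypothesis XY_id : forall i (B : set (R * R)), (1 <= i)%N -> measurable B ->
  P ((fun w => (X i w, Y i w)) @^-1` B) = P ((fun w => (X 1%N w, Y 1%N w)) @^-1` B).
Hypothesis X_ge0 : forall i w, 0 <= X i w.
Hypothesis Y_ge0 : forall i w, 0 <= Y i w.
Hypothesis F_inf : forall x, 0 < tail P (X 1%N) x.
Hypothesis G_inf : forall y, 0 < tail P (Y 1%N) y.
Hypothesis F_D : classD (tail P (X 1%N)).
Hypothesis F_L : classL (tail P (X 1%N)).
Hypothesis G_D : classD (tail P (Y 1%N)).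
Hypothesis G_L : classL (tail P (Y 1%N)).
Hypothesis C_gt0 : 0 < C.
Hypothesis SAI : forall i, (1 <= i)%N -> asymp (@xy_infty R)
  (fun p : R * R => fine (P [set w | p.1 < X i w /\ p.2 < Y i w]))
  (fun p : R * R => C * tail P (X 1%N) p.1 * tail P (Y 1%N) p.2).
Hypothesis XY_indep : forall i j (A B : set R), (1 <= i)%N -> (1 <= j)%N -> i <> j ->
  measurable A -> measurable B ->
  P (X i @^-1` A `&` Y j @^-1` B) = (P (X i @^-1` A) * P (Y j @^-1` B))%E.
Hypothesis gtai : forall n : nat, GTAI P n X Y.
Hypothesis r_ge0 : 0 <= r.
Hypothesis T_gt0 : 0 < T.
Hypothesis lamT_gt0 : (0 < renewal_fun P theta T)%E.

Let Fb := tail P (X 1%N).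
Let Gb := tail P (Y 1%N).
Let pm := pair_mass P theta Fb Gb r T.
Let square := pair_mass_square P theta Fb Gb r C T.
Let Fb_ni : forall x y, x <= y -> Fb y <= Fb x. Proof. exact: tail_noninc. Qed.
Let Gb_ni : forall x y, x <= y -> Gb y <= Gb x. Proof. exact: tail_noninc. Qed.
Let Fb_le1 : forall x, Fb x <= 1. Proof. by move=> x; exact: tail_le1. Qed.
Let Gb_le1 : forall x, Gb x <= 1. Proof. by move=> x; exact: tail_le1. Qed.
Let tails_ge0 x y : 0 <= Fb x * Gb y. Proof. by rewrite mulr_ge0 // ltW ?F_inf ?G_inf. Qed.

Let ruin_max x y := event_max theta r X Y C1 C2 x y T.
Let ruin_and x y := event_and theta r X Y C1 C2 x y T.
Let claims i j x y := claim_event X Y theta r T i j x y.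

Let mruin_max x y : measurable (ruin_max x y). Proof. exact: measurable_event_max. Qed.
Let mruin_and x y : measurable (ruin_and x y). Proof. exact: measurable_event_and. Qed.
Let mclaims i j x y : measurable (claims i j x y). Proof. exact: measurable_claim_event. Qed.

Let exp_ge1 i w : 1 <= expR (r * arrival theta i w).
Proof. by rewrite -expR0 ler_expR mulr_ge0 ?arrival_ge0. Qed.

Let exp_inv_le1 i w : expR (- r * arrival theta i w) <= 1.
Proof. by rewrite -expR0 ler_expR mulNr oppr_le0 mulr_ge0 ?arrival_ge0. Qed.

Let discounted_lt i w u z : (u < z * expR (- r * arrival theta i w)) =
  (u * expR (r * arrival theta i w) < z).
Proof. by rewrite mulNr expRN ltr_pdivlMr ?expR_gt0. Qed.

Let square_ge0 n x y : 0 <= square n x y.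
Proof.
apply: sumr_ge0 => i _; apply: sumr_ge0 => j _.
by rewrite mulr_ge0 ?pair_mass_ge0 // ltW // coef_gt0.
Qed.

Let square_shift L e n : 0 <= L -> 0 < e -> exists2 x0, 0 <= x0 & forall x y, x0 <= x ->
  x0 <= y -> square n x y <= (1 + e) * square n (x + L) (y + L).
Proof.
move=> L0 e0.
have [x0 x00 h] := pair_mass_shift T mX mY mtheta theta_pos F_inf G_inf r_ge0 F_L G_L L0 e0.
exists x0 => // x y hx hy; rewrite mulr_sumr; apply: ler_sum => i _.
rewrite mulr_sumr; apply: ler_sum => j _.
by rewrite mulrCA ler_wpM2l ?h // ltW // coef_gt0.
Qed.

Let premium_bounded M := [set w | C1 w T <= M] `&` [set w | C2 w T <= M].

Let mle (f : Omega -> R) M : measurable_fun setT f -> measurable [set w | f w <= M].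
Proof.
move=> mf; have := mf measurableT _ (measurable_itv `]-oo, M]).
by rewrite setTI; congr (measurable _); apply/seteqP; split => w; rewrite /= in_itv.
Qed.

Let mpremium_bounded M : measurable (premium_bounded M).
Proof. by apply: measurableI; exact: mle. Qed.

Let sigma_premium_bounded M : sigma_premium C1 C2 (premium_bounded M).
Proof.
pose S : set (set Omega) := [set A | exists t : R, 0 <= t /\ exists B : set R, measurable B /\
  (A = (fun w => C1 w t) @^-1` B \/ A = (fun w => C2 w t) @^-1` B)].
apply: (@measurableI _ (g_sigma_algebraType S)); apply: sub_sigma_algebra;
  exists T; (split; first exact: ltW); exists `]-oo, M]%classic; (split; first exact: measurable_itv);
  [left|right]; by apply/seteqP; split => w /=; rewrite in_itv.
Qed.

Let premium_tight e : 0 < e -> exists2 M, 0 <= M & 1 - e <= pr P (premium_bounded M).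
Proof.
move=> e0; pose B (n : nat) := premium_bounded n%:R.
have : P (B n) @[n --> \oo] --> P (\bigcup_n B n).
  have mB n : measurable (B n) by exact: mpremium_bounded.
  apply: nondecreasing_cvg_mu => //; first by apply: bigcup_measurable.
  move=> m n mn; apply/subsetPset => w [h1 h2].
  have mn' : (m%:R : R) <= n%:R by rewrite ler_nat.
  by split => /=; [exact: le_trans h1 mn'|exact: le_trans h2 mn'].
have -> : \bigcup_n B n = setT.
  apply/seteqP; split => // w _.
  exists (maxn (Num.bound (C1 w T)) (Num.bound (C2 w T))) => //.
  have le_bound (z : R) : z <= (Num.bound z)%:R by exact/ltW/unstable.ltr_bound.
  by split; rewrite /= (le_trans (le_bound _)) // ler_nat ?leq_maxl ?leq_maxr.
rewrite probability_setT => /fine_cvgP[_] /cvgr_ge /(_ (1 - e)).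
rewrite gtrBl => /(_ e0) [n _ /(_ n (leqnn n)) h].
by exists n%:R.
Qed.

(* Bonferroni over the first n^2 pairs of claims, on the event that the premium
   income is at most M; the pair terms are negligible by GTAI. *)
Lemma ruin_max_ge n e : 0 < e < 1 -> exists2 x0, 0 <= x0 & forall x y, x0 <= x -> x0 <= y ->
  (1 - 3 * e) * square n x y <= pr P (ruin_max x y) + e * (Fb x * Gb y).
Proof.
move=> /[dup] e01 /andP[e0 e1].
have [M M0 hM] := premium_tight e0.
have [x1 x10 hshift] := square_shift n M0 e0.
have [x2 x20 hclaim] := claim_event_bounds T mX mY mtheta theta_pos indep XY_id F_inf G_inf
  C_gt0 SAI XY_indep r_ge0 e01.
pose N : R := (n * n)%:R.
(* [N] pair events give at most N^2 ordered pairs of distinct ones; the added 1 keeps the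
   denominator positive. *)
have e'0 : 0 < e / (N * N + 1) by rewrite divr_gt0 // ltr_wpDl // mulr_ge0.
have [x3 hgtai] := gtai_bound mX mY XY_id X_ge0 Y_ge0 F_inf G_inf C_gt0 SAI XY_indep gtai n e'0.
exists (Num.max x1 (Num.max x2 x3)); first by rewrite le_max x10.
move=> x y; rewrite !ge_max => /and3P[xx1 xx2 xx3] /and3P[yx1 yx2 yx3].
have x0 : 0 <= x := le_trans x10 xx1.
have y0 : 0 <= y := le_trans x10 yx1.
have xM : x <= x + M by rewrite lerDl.
have yM : y <= y + M by rewrite lerDl.
pose s := [seq (i, j) | i <- index_iota 0 n, j <- index_iota 0 n].
pose B := premium_bounded M.
(* Thresholds raised by [M]: on [B], a discounted claim above capital plus [M] outweighs the
   premiums too. *)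
pose A (p : nat * nat) := claims p.1.+1 p.2.+1 (x + M) (y + M) `&` B.
have mA p : measurable (A p) by apply: measurableI; [exact: mclaims|exact: mpremium_bounded].
have us : uniq s.
  by apply: allpairs_uniq; [exact: iota_uniq|exact: iota_uniq|move=> [a b] [a2 b2] _ _ /= [-> ->]].
have size_s : size s = (n * n)%N by rewrite size_allpairs size_iota subn0.
have NE : N = (size s)%:R by rewrite size_s.
have AE p : A p `<=` ruin_max x y.
  move=> w [[/andP[iT jT] [hX hY]] [h1 h2]].
  apply: (event_max_claims r_ge0 X_ge0 Y_ge0 C1_0 C2_0 T_gt0 _ _ iT jT) => //.
    by rewrite discounted_lt (le_lt_trans _ hX) // ler_wpM2r ?expR_ge0 // lerD2l.
  by rewrite discounted_lt (le_lt_trans _ hY) // ler_wpM2r ?expR_ge0 // lerD2l.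
have := pr_bonferroni P us mA (mruin_max x y) AE.
have pair_term p q : p \in s -> q \in s -> q != p ->
    pr P (A p `&` A q) <= e / (N * N + 1) * (Fb x * Gb y).
  move=> /allpairsP[[i j] /= [+ + ->]] /allpairsP[[i' j'] /= [+ + ->]].
  rewrite !mem_index_iota /= => i_n j_n i'_n j'_n ne.
  have FM : Fb (x + M) * Gb (y + M) <= Fb x * Gb y.
    by apply: ler_pM; rewrite ?Fb_ni ?Gb_ni // ltW ?F_inf ?G_inf.
  have e'0' := ltW e'0.
  apply: le_trans (ler_wpM2l e'0' FM).
  have big z k w : 0 <= z -> z + M <= (z + M) * expR (r * arrival theta k w).
    by move=> z0; rewrite ler_peMr // addr_ge0.
  have x3x : x3 <= x + M := le_trans xx3 xM.
  have x3y : x3 <= y + M := le_trans yx3 yM.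
  (* Distinct pairs differ in a coordinate: a second Y-claim is large when the X-indices agree, a
     second X-claim otherwise. *)
  have [ii'|/eqP ii'] := eqVneq i i'.
    have jj' : j'.+1 <> j.+1 by case=> jj'; move: ne; rewrite ii' jj' eqxx.
    have [_ +] := hgtai j'.+1 i.+1 j.+1 j'_n i_n j_n jj' _ _ _ x3y x3x x3y.
    apply: le_trans; apply: le_pr; [exact: measurableI|exact: measurable_triple_Y|].
    move=> w [[[_ [hX hY]] _] [[_ [_ hY']] _]].
    by split; [|split]; [apply: le_lt_trans hY'|apply: le_lt_trans hX|apply: le_lt_trans hY];
      exact: big.
  have ii'' : i'.+1 <> i.+1 by case=> /esym.
  have [+ _] := hgtai i'.+1 j.+1 i.+1 i'_n j_n i_n ii'' _ _ _ x3x x3x x3y.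
  apply: le_trans; apply: le_pr; [exact: measurableI|exact: measurable_triple_X|].
  move=> w [[[_ [hX hY]] _] [[_ [hX' _]] _]].
  by split; [|split]; [apply: le_lt_trans hX'|apply: le_lt_trans hX|apply: le_lt_trans hY];
    exact: big.
have c0 : 0 <= e / (N * N + 1) * (Fb x * Gb y) by rewrite mulr_ge0 // ltW.
have pair_sum : \sum_(p <- s) \sum_(q <- s | q != p) pr P (A p `&` A q) <= e * (Fb x * Gb y).
  apply: (@le_trans _ _ (e / (N * N + 1) * (Fb x * Gb y) * N * N)).
    rewrite {4}NE; apply: sum_le_size => [|p ps _]; first by rewrite mulr_ge0.
    by rewrite {3}NE; apply: sum_le_size => // q qs qp; exact: pair_term.
  have -> : e / (N * N + 1) * (Fb x * Gb y) * N * N =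
      (e * (Fb x * Gb y)) * (N * N / (N * N + 1)) by ring.
  have eF : 0 <= e * (Fb x * Gb y) by rewrite mulr_ge0 // ltW.
  by rewrite ler_piMr // ler_pdivrMr ?ltr_wpDl ?mulr_ge0 // mul1r lerDl.
have main : (1 - e) * (1 - e) * square n (x + M) (y + M) <= \sum_(p <- s) pr P (A p).
  rewrite big_allpairs mulr_sumr; apply: ler_sum => i _.
  rewrite mulr_sumr; apply: ler_sum => j _.
  have /andP[+ _] := hclaim i.+1 j.+1 (x + M) (y + M) B isT isT (le_trans xx2 xM) (le_trans yx2 yM)
    (mpremium_bounded M) (sigma_premium_bounded M).
  apply: le_trans; rewrite ler_wpM2r //.
    by rewrite mulr_ge0 ?pair_mass_ge0 // ltW // coef_gt0.
  by rewrite ler_wpM2l // subr_ge0 ltW.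
have := hshift x y xx1 yx1.
have := square_ge0 n (x + M) (y + M).
move: pair_sum main; set S := square n (x + M) (y + M); set S0 := square n x y.
move=> pair_sum main S_ge0 S0S bonf.
have S0_ge0 : 0 <= S0 by exact: square_ge0.
(* One factor 1 - e is the SAI error, the other the probability of [B]; against the factor 1 + e of
   the shift, (1 - 3e)(1 + e) <= (1 - e)^2. For negative 1 - 3e the bound is trivial. *)
have h1 : (1 - 3 * e) * S0 <= (1 - e) * (1 - e) * S.
  have [e3|e3] := leP 0 (1 - 3 * e).
    apply: le_trans (ler_wpM2l e3 S0S) _; rewrite mulrA ler_wpM2r //.
    have : 0 <= e * e by rewrite mulr_ge0 // ltW.
    lra.
  apply: (@le_trans _ _ 0); first by rewrite nmulr_rle0.
  by rewrite !mulr_ge0 // subr_ge0 ltW.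
lra.
Qed.

Let arrived m := [set w | arrival theta m w <= T].

Let marrived m : measurable (arrived m).
Proof. by apply: mle; exact: measurable_arrival. Qed.

(** [m] is the value of N(T), found as the least index with T_(m+1) > T; for m = 0 one has T_0 = 0
    <= T. *)
Lemma last_arrival N w : T < arrival theta N.+1 w ->
  exists m, [/\ (m <= N)%N, arrival theta m w <= T & T < arrival theta m.+1 w].
Proof.
move=> hN; have ex : exists m, T < arrival theta m.+1 w by exists N.
case: (ex_minnP ex) => m hm m_min; exists m; split; [exact: m_min| |by []].
case: m hm m_min => [|m] _ m_min; first by rewrite /arrival big_geq // ltW.
by rewrite leNgt; apply/negP => /m_min; rewrite ltnn.
Qed.

Let tail_consts : exists2 K, 1 <= K & forall m x y, (0 < m)%N -> 0 <= x -> 0 <= y ->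
  Fb (x / m%:R) * Gb (y / m%:R) <= K ^+ m * (Fb x * Gb y).
Proof.
have [K1 K11 hK1] := classD_half F_inf Fb_le1 Fb_ni F_D.
have [K2 K21 hK2] := classD_half G_inf Gb_le1 Gb_ni G_D.
have K10 := le_trans ler01 K11; have K20 := le_trans ler01 K21.
exists (K1 * K2); first by rewrite -[1]mulr1 ler_pM.
move=> m x y m0 x0 y0; rewrite exprMn mulrACA.
apply: ler_pM; rewrite ?(ltW (F_inf _)) ?(ltW (G_inf _)) //.
  exact: (tail_divn Fb_ni hK1).
exact: (tail_divn Gb_ni hK2).
Qed.

(** What [m] claims on each line with discounted sums above [x] and [y] force: by pigeonhole, one
    claim on each line exceeds its share. *)
Definition large_pair x y m := \bigcup_(p in [set` [seq (i, j) | i <- iota 1 m, j <- iota 1 m]])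
  [set w | x / m%:R < X p.1 w /\ y / m%:R < Y p.2 w].

Let mlarge_pair x y m : measurable (large_pair x y m).
Proof.
by apply: fin_bigcup_measurable => [|p _]; [exact: finite_seq|exact: measurable_joint].
Qed.

(* The number of arrivals has superexponentially decaying tails, which absorbs the
   geometric factors lost when the thresholds are divided by m. *)
Lemma pr_large_pair : exists2 kap, 0 < kap & forall m x y, (0 < m)%N -> 0 <= x -> 0 <= y ->
  pr P (arrived m `&` large_pair x y m) <= kap * (Fb x * Gb y) * 2^-1 ^+ m.
Proof.
have [K K1 hK] := tail_consts; have K0 : 0 < K := lt_le_trans ltr01 K1.
have [J J1 hJ] := joint_tail_le mX mY XY_id F_inf G_inf C_gt0 SAI XY_indep.
have J0 : 0 < J := lt_le_trans ltr01 J1.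
(* Of 8 K, the factor K pays for the divided thresholds, 4 for the m^2 <= 4^m pairs, and 2 is the
   gain that remains. *)
have rho01 : 0 < (8 * K)^-1 <= 1.
  by rewrite invr_gt0 mulr_gt0 //= invf_le1 ?mulr_gt0 //; lra.
have [A A0 hA] := arrival_superexponential mtheta theta_pos theta_indep theta_id T rho01.
exists (A * J); first by rewrite mulr_gt0.
move=> m x y m0 x0 y0.
pose s := [seq (i, j) | i <- iota 1 m, j <- iota 1 m].
pose E (p : nat * nat) := [set w | x / m%:R < X p.1 w /\ y / m%:R < Y p.2 w].
have mE p : measurable (E p) by exact: measurable_joint.
have cover w : (arrived m `&` large_pair x y m) w ->
    exists2 p, p \in s & (arrived m `&` E p) w.
  by move=> [wm [p ps Ep]]; exists p.
have mAE p : measurable (arrived m `&` E p).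
  by apply: measurableI; [exact: marrived|exact: mE].
have mU : measurable (arrived m `&` large_pair x y m).
  by apply: measurableI; [exact: marrived|exact: mlarge_pair].
apply: le_trans (pr_bigcup_le P mAE mU cover) _.
have Phi0 := tails_ge0 x y.
have term p : p \in s -> true ->
    pr P (arrived m `&` E p) <= A * (8 * K)^-1 ^+ m * (J * (K ^+ m * (Fb x * Gb y))).
  move=> /allpairsP[[i j] /= [+ + ->]] _; rewrite !mem_iota => /andP[i1 _] /andP[j1 _].
  have -> : pr P (arrived m `&` E (i, j)) = pr P (arrived m) * pr P (E (i, j)).
    apply: EFin_inj; rewrite EFinM -!prE //.
    have sE : sigma_claims X Y (E (i, j)).
      have -> : E (i, j) =
          (fun w => (X i w, Y j w)) @^-1` (`]x / m%:R, +oo[ `*` `]y / m%:R, +oo[)%classic.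
        by apply/seteqP; split => w; rewrite /E /= !in_itv /= !andbT.
      by apply: sigma_claims_pair => //; apply: measurableX; exact: measurable_itv.
    have sA : sigma_interarrival theta (arrived m).
      have -> : arrived m =
          (fun w => (arrival theta m w, arrival theta m w)) @^-1` (`]-oo, T] `*` setT)%classic.
        by apply/seteqP; split => w; rewrite /arrived /= in_itv /=; [move=> ->|case].
      apply: sigma_interarrival_arrivals => //; apply: measurableX => //; exact: measurable_itv.
    have sT : sigma_premium C1 C2 setT.
      exact: (@measurableT _ (g_sigma_algebraType [set A | exists t : R, 0 <= t /\
        exists B : set R, measurable B /\
        (A = (fun w => C1 w t) @^-1` B \/ A = (fun w => C2 w t) @^-1` B)])).
    have := indep sE sT sA; rewrite setIT probability_setT mule1 setIC => ->.
    exact: muleC.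
  apply: ler_pM; rewrite ?pr_ge0 //; first exact: hA.
  by apply: le_trans (hJ i j _ _ i1 j1) _; rewrite ler_pM2l // hK.
have c0 : 0 <= A * (8 * K)^-1 ^+ m * (J * (K ^+ m * (Fb x * Gb y))).
  by rewrite !mulr_ge0 ?exprn_ge0 ?invr_ge0 ?mulr_ge0 // ltW.
apply: le_trans (sum_le_size c0 term) _.
rewrite size_allpairs size_iota natrM.
have m2 : (m%:R : R) <= 2 ^+ m by rewrite -natrX ler_nat ltnW // ltn_expl.
have mm : (m%:R : R) * m%:R <= 2 ^+ m * 2 ^+ m by apply: ler_pM.
apply: le_trans (ler_wpM2l c0 mm) _.
have -> : A * (8 * K)^-1 ^+ m * (J * (K ^+ m * (Fb x * Gb y))) * (2 ^+ m * 2 ^+ m) =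
    A * J * (Fb x * Gb y) * ((8 * K)^-1 ^+ m * K ^+ m * (2 ^+ m * 2 ^+ m)) by ring.
have AJ0 : 0 <= A * J * (Fb x * Gb y) by rewrite mulr_ge0 // mulr_ge0 // ltW.
rewrite ler_wpM2l //.
rewrite -!exprMn le_eqVlt; apply/orP; left; apply/eqP; congr (_ ^+ _).
by field; rewrite gt_eqF.
Qed.

(** Given m > n claims, ruin entails [large_pair x y m], and the bounds 2^-m over m > n sum to at
    most 2^-n. The values of m are cut at some [N]: having more than [N] claims is not bounded in
    proportion to the tails, only by an arbitrary [e], which then tends to 0. *)
Lemma ruin_and_many_claims : exists2 kap, 0 < kap & forall n x y, 0 <= x -> 0 <= y ->
  pr P (ruin_and x y `&` arrived n.+1) <= kap * (Fb x * Gb y) * 2^-1 ^+ n.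
Proof.
have [kap kap0 hkap] := pr_large_pair.
have half : 0 < (2^-1 : R) <= 1 by rewrite invr_gt0 ltr0n invf_le1 // ler1n.
have [A A0 hA] := arrival_superexponential mtheta theta_pos theta_indep theta_id T half.
exists kap => // n x y x0 y0.
have Phi0 := tails_ge0 x y.
apply/ler_addgt0Pr => e e0.
have [N [nN AN]] : exists N, (n <= N)%N /\ A * 2^-1 ^+ N.+1 <= e.
  have : A * 2^-1 ^+ N @[N --> \oo] --> A * 0.
    apply: cvgM; first exact: cvg_cst.
    by apply: cvg_expr; rewrite gtr0_norm ?invf_lt1 ?ltr1n // invr_gt0.
  rewrite mulr0 => /cvgr_le /(_ e e0) [N _ hN]; exists (maxn n N); split.
    exact: leq_maxl.
  by apply: hN => /=; rewrite ltnW // ltnS leq_maxr.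
have mE : measurable (ruin_and x y `&` arrived n.+1).
  by apply: measurableI; [exact: mruin_and|exact: marrived].
rewrite (pr_setID P mE (marrived N.+1)) addrC.
apply: lerD; last first.
  apply: le_trans (le_trans (hA N.+1) AN).
  apply: le_pr; [by apply: measurableI => //; exact: marrived|exact: marrived|by move=> w []].
have mB m : measurable (arrived m `&` large_pair x y m).
  by apply: measurableI; [exact: marrived|exact: mlarge_pair].
have mD : measurable ((ruin_and x y `&` arrived n.+1) `\` arrived N.+1).
  by apply: measurableD => //; exact: marrived.
have cover w : ((ruin_and x y `&` arrived n.+1) `\` arrived N.+1) w ->
    exists2 m, m \in index_iota n.+1 N.+1 & (arrived m `&` large_pair x y m) w.
  move=> [[wE wn] /negP]; rewrite -ltNge => /last_arrival[m [mN wm mw]].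
  have nm : (n < m)%N.
    rewrite ltnNge; apply/negP => mn; move: mw; apply/negP; rewrite -leNgt.
    by apply: le_trans wn; exact: arrival_le.
  exists m; first by rewrite mem_index_iota nm ltnS.
  have m0 : (0 < m)%N by case: (m) nm.
  have [hx hy] := event_and_claims theta_pos r_ge0 X_ge0 Y_ge0 C1_0 C2_0 wE wm mw.
  have m0' : m%:R != 0 :> R by rewrite pnatr_eq0 -lt0n.
  have large (Z : nat -> Omega -> R) u : (forall i w, 0 <= Z i w) -> 0 <= u ->
      u < \sum_(1 <= i < m.+1) Z i w * expR (- r * arrival theta i w) ->
      exists2 i, i \in iota 1 m & u / m%:R < Z i w.
    move=> Z0 u0 hu.
    have sz : (size (index_iota 1 m.+1) <= m)%N by rewrite size_iota subn1.
    have [i [im _ ui]] : exists i, [/\ i \in index_iota 1 m.+1, true &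
        u / m%:R < Z i w * expR (- r * arrival theta i w)].
      by apply: (sum_gt_exists _ sz); rewrite ?divr_ge0 // divfK.
    exists i; first by move: im; rewrite /index_iota subn1.
    by rewrite (lt_le_trans ui) // ler_piMr.
  have [i im xi] := large X x X_ge0 x0 hx; have [j jm yj] := large Y y Y_ge0 y0 hy.
  by split => //; exists (i, j) => //=; apply/allpairsP; exists (i, j).
apply: le_trans (pr_bigcup_le P mB mD cover) _.
apply: (@le_trans _ _ (kap * (Fb x * Gb y) * \sum_(n.+1 <= m < N.+1) 2^-1 ^+ m)).
  rewrite mulr_sumr big_nat_cond [leRHS]big_nat_cond; apply: ler_sum => m /andP[/andP[nm _] _].
  by apply: hkap => //; case: (m) nm.
have kPhi : 0 <= kap * (Fb x * Gb y) by rewrite mulr_ge0 // ltW.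
rewrite ler_wpM2l //.
rewrite -{1}[n.+1]add0n big_addn.
apply: (@le_trans _ _ (2^-1 ^+ n.+1 * \sum_(0 <= m < N.+1 - n.+1) 2^-1 ^+ m)).
  by rewrite mulr_sumr; apply: ler_sum => m _; rewrite exprD mulrC.
have := ler_wpM2l (exprn_ge0 n.+1 (ltW (proj1 (andP half)))) (@sum_half_le R (N.+1 - n.+1)).
by rewrite exprS => /le_trans; apply; lra.
Qed.

(* With at most n claims, either a single X_i and a single Y_j nearly exceed the initial
   capitals, or two claims of the same line are large together with one of the other line. *)
Lemma ruin_and_few_claims n e : (0 < n)%N -> 0 < e < 1 -> exists2 x0, 0 <= x0 &
  forall x y, x0 <= x -> x0 <= y ->
  pr P (ruin_and x y `\` arrived n.+1) <= (1 + e) * (1 + e) * square n x y + e * (Fb x * Gb y).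
Proof.
move=> n0 /[dup] e01 /andP[e0 e1].
have n0' : n%:R != 0 :> R by rewrite pnatr_eq0 -lt0n.
have [K K1 hK] := tail_consts; have K0 : 0 < K := lt_le_trans ltr01 K1.
pose N : R := (n * n * n)%:R.
have N0 : 0 < N by rewrite ltr0n !muln_gt0 n0.
have q0 : 0 < 2 * N * K ^+ n by rewrite !mulr_gt0 // exprn_gt0.
(* There are 2 N triples, N for each line, and [K ^+ n] pays for the thresholds divided by [n]. *)
have e'0 : 0 < e / (2 * N * K ^+ n) by rewrite divr_gt0.
have [a hgtai] := gtai_bound mX mY XY_id X_ge0 Y_ge0 F_inf G_inf C_gt0 SAI XY_indep gtai n e'0.
(* Chosen so that L / n reaches the GTAI threshold [a]; the maximum with 0 keeps the shift
   non-negative. *)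
pose L := n%:R * Num.max a 0.
have L0 : 0 <= L by rewrite mulr_ge0 // le_max lexx orbT.
have aL : a <= L / n%:R by rewrite /L mulrC mulKf // le_max lexx.
have [x1 x10 hshift] := square_shift n L0 e0.
have [x2 x20 hclaim] := claim_event_le T mX mY mtheta theta_pos indep XY_id F_inf G_inf
  C_gt0 SAI XY_indep r_ge0 e01.
exists (Num.max x1 x2 + L); first by rewrite addr_ge0 // le_max x10.
move=> x y; rewrite -!lerBrDr !ge_max => /andP[xx1 xx2] /andP[yx1 yx2].
have xL : L <= x by rewrite -subr_ge0 (le_trans x10).
have yL : L <= y by rewrite -subr_ge0 (le_trans x10).
have x0 := le_trans L0 xL; have y0 := le_trans L0 yL.
have ax : a <= x / n%:R by rewrite (le_trans aL) // ler_wpM2r // invr_ge0.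
have ay : a <= y / n%:R by rewrite (le_trans aL) // ler_wpM2r // invr_ge0.
pose s2 := [seq (i, j) | i <- index_iota 0 n, j <- index_iota 0 n].
pose s3 := [seq (p, k) | p <- [seq (i, j) | i <- index_iota 1 n.+1, j <- index_iota 1 n.+1],
  k <- index_iota 1 n.+1].
(* The cover consists of pair events at capitals lowered by [L], with indices from 0 as in [square],
   and of triple events, the boolean telling which line has two large claims. A repeated index gives
   the empty set, as GTAI concerns distinct ones. *)
pose E (z : (nat * nat) + bool * ((nat * nat) * nat)) : set Omega := match z with
  | inl (i, j) => claims i.+1 j.+1 (x - L) (y - L)
  | inr (b, ((i, j), k)) => if i == k then set0 else
      if b then triple_X X Y i k j (L / n%:R) (x / n%:R) (y / n%:R)
      else triple_Y X Y i j k (L / n%:R) (x / n%:R) (y / n%:R)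
  end.
pose s := [seq inl p | p <- s2] ++ [seq inr (true, p) | p <- s3] ++ [seq inr (false, p) | p <- s3].
have mE z : measurable (E z).
  case: z => [[i j]|[b [[i j] k]]] /=; first exact: mclaims.
  case: eqP => // _; case: b; first exact: measurable_triple_X.
  exact: measurable_triple_Y.
have mD : measurable (ruin_and x y `\` arrived n.+1).
  by apply: measurableD; [exact: mruin_and|exact: marrived].
have s3P i j k : (1 <= i <= n)%N -> (1 <= j <= n)%N -> (1 <= k <= n)%N -> (i, j, k) \in s3.
  move=> hi hj hk; apply/allpairsP; exists ((i, j), k); split => //=.
    by apply/allpairsP; exists (i, j); rewrite !mem_index_iota !ltnS.
  by rewrite mem_index_iota ltnS.
have cover w : (ruin_and x y `\` arrived n.+1) w -> exists2 z, z \in s & E z w.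
  move=> [wE /negP]; rewrite -ltNge => /last_arrival[m [mn wm mw]].
  have [hx hy] := event_and_claims theta_pos r_ge0 X_ge0 Y_ge0 C1_0 C2_0 wE wm mw.
  have c0 (Z : nat -> Omega -> R) i : (forall i w, 0 <= Z i w) ->
      0 <= Z i w * expR (- r * arrival theta i w) by move=> Z0; rewrite mulr_ge0 ?expR_ge0.
  have le_n i : (1 <= i <= m)%N -> (1 <= i <= n)%N.
    by move=> /andP[-> im]; rewrite (leq_trans im).
  have sz : (size (index_iota 1 m.+1) <= n)%N by rewrite size_iota subn1.
  have disc (Z : nat -> Omega -> R) i u : (forall i w, 0 <= Z i w) ->
      u < Z i w * expR (- r * arrival theta i w) -> u < Z i w.
    by move=> Z0 /lt_le_trans; apply; rewrite ler_piMr.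
  have one (Z : nat -> Omega -> R) u : (forall i w, 0 <= Z i w) -> 0 <= u ->
      u < \sum_(1 <= i < m.+1) Z i w * expR (- r * arrival theta i w) ->
      exists2 i, (1 <= i <= m)%N & u / n%:R < Z i w.
    move=> Z0 u0 hu.
    have [i [im _ ui]] : exists i, [/\ i \in index_iota 1 m.+1, true &
        u / n%:R < Z i w * expR (- r * arrival theta i w)].
      by apply: (sum_gt_exists _ sz); rewrite ?divr_ge0 // divfK.
    exists i; first by move: im; rewrite mem_index_iota ltnS.
    exact: disc ui.
  have [xi xim xiL] := one X x X_ge0 x0 hx; have [yj yjm yjL] := one Y y Y_ge0 y0 hy.
  have [[i im hi]|[i [k [im km ik hi hk]]]] :=
      sum_gt_one_or_two (fun i => c0 X i X_ge0) mn n0 x0 L0 hx; last first.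
    exists (inr (true, (i, yj, k))).
      by rewrite !mem_cat (map_f (fun p => inr (true, p))) ?orbT // s3P ?le_n.
    rewrite /=; case: eqP => // _; split; first exact: disc hi.
    by split => //; exact: disc hk.
  have [[j jm hj]|[j [k [jm km jk hj hk]]]] :=
      sum_gt_one_or_two (fun i => c0 Y i Y_ge0) mn n0 y0 L0 hy; last first.
    exists (inr (false, (j, xi, k))).
      by rewrite !mem_cat (map_f (fun p => inr (false, p))) ?orbT // s3P ?le_n.
    rewrite /=; case: eqP => // _; split; first exact: disc hj.
    by split => //; exact: disc hk.
  have arrT l : (1 <= l <= m)%N -> arrival theta l w <= T.
    by move=> /andP[_ lm]; apply: le_trans wm; exact: arrival_le.
  exists (inl (i.-1, j.-1)).
    rewrite mem_cat map_f //; apply/allpairsP; exists (i.-1, j.-1).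
    have [i1 i2] := andP (le_n _ im); have [j1 j2] := andP (le_n _ jm).
    by rewrite !mem_index_iota /= !prednK.
  have [i1 _] := andP im; have [j1 _] := andP jm.
  rewrite /= !prednK //; split; first by rewrite /both_arrived !arrT.
  by rewrite -!discounted_lt.
apply: le_trans (pr_bigcup_le P mE mD cover) _.
rewrite !big_cat !big_map /=; apply: lerD.
  apply: (@le_trans _ _ ((1 + e) * square n (x - L) (y - L))).
    rewrite big_allpairs mulr_sumr; apply: ler_sum => i _.
    rewrite mulr_sumr; apply: ler_sum => j _.
    exact: hclaim.
  have e10 : 0 <= 1 + e by rewrite addr_ge0 // ltW.
  rewrite -mulrA ler_wpM2l //.
  by have := hshift _ _ xx1 yx1; rewrite !subrK.
have size3 : N = (size s3)%:R by rewrite !size_allpairs !size_iota subn1.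
have Phi0 := tails_ge0 x y.
pose c := e / (2 * N * K ^+ n) * (K ^+ n * (Fb x * Gb y)).
have e'0' := ltW e'0.
have c0 : 0 <= c by rewrite mulr_ge0 // mulr_ge0 // exprn_ge0 // ltW.
have term b p : p \in s3 -> true -> pr P (E (inr (b, p))) <= c.
  move=> /allpairsP[[q k] [/= /allpairsP[[i j] [/= + + ->]] + ->]] _.
  rewrite !mem_index_iota !ltnS => hi hj hk.
  case: eqP => [_|ik]; first by rewrite pr_set0.
  have [hX hY] := hgtai i j k hi hj hk ik _ _ _ aL ax ay.
  have := ler_wpM2l e'0' (hK n x y n0 x0 y0).
  by case: b => /=; apply: le_trans.
have sum3 b : \sum_(p <- s3) pr P (E (inr (b, p))) <= c * N.
  by rewrite size3; exact: sum_le_size (term b).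
have cN : c * N = e * (Fb x * Gb y) / 2.
  have Kn0 : 0 < K ^+ n by rewrite exprn_gt0.
  by rewrite /c; field; rewrite n0' gt_eqF.
apply: le_trans (lerD (sum3 true) (sum3 false)) _.
by rewrite cN; lra.
Qed.

Let DeltaT x y := Delta (renewal_measure P theta) Fb Gb C r x y T.

Let Delta_fine : exists2 kap, 0 < kap & forall x y, 0 <= x -> 0 <= y ->
  0 < fine (DeltaT x y) /\ forall n,
  square n x y <= fine (DeltaT x y) <= square n.*2 x y + kap * (Fb x * Gb y) * 2^-1 ^+ n.
Proof.
have [kap kap0 h] := Delta_bounds mtheta theta_pos theta_indep theta_id T F_inf G_inf Fb_ni Gb_ni
  r_ge0 C_gt0.
exists kap => // x y x0 y0; have [D DE hD] := h x y x0 y0.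
rewrite /DeltaT DE /=; split => //.
have [K K0 hK] := tails_le_pair_mass_square mtheta theta_pos F_inf G_inf Fb_le1 Gb_le1 Fb_ni Gb_ni
  F_D G_D r_ge0 C_gt0 lamT_gt0.
have /andP[+ _] := hD 1%N; apply: lt_le_trans.
have : 0 < K * square 1 x y.
  by apply: lt_le_trans (hK 1%N x y isT x0 y0); rewrite mulr_gt0 ?F_inf ?G_inf.
by rewrite pmulr_rgt0.
Qed.

Lemma Delta_gt0 x y : 0 <= x -> 0 <= y -> 0 < fine (DeltaT x y).
Proof. by have [kap _ h] := Delta_fine; move=> x0 y0; have [] := h x y x0 y0. Qed.

Let tails_le_Delta : exists2 K, 0 < K & forall x y, 0 <= x -> 0 <= y ->
  Fb x * Gb y <= K * fine (DeltaT x y).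
Proof.
have [kap _ h] := Delta_fine.
have [K K0 hK] := tails_le_pair_mass_square mtheta theta_pos F_inf G_inf Fb_le1 Gb_le1 Fb_ni Gb_ni
  F_D G_D r_ge0 C_gt0 lamT_gt0.
exists K => // x y x0 y0; apply: le_trans (hK 1%N x y isT x0 y0) _.
by rewrite ler_pM2l //; have [_ /(_ 1%N)/andP[]] := h x y x0 y0.
Qed.

Let small_pow (k eps : R) : 0 < eps -> exists2 n, (0 < n)%N & k * 2^-1 ^+ n <= eps.
Proof.
move=> eps0.
have : k * 2^-1 ^+ n @[n --> \oo] --> k * 0.
  apply: cvgM; first exact: cvg_cst.
    by apply: cvg_expr; rewrite gtr0_norm ?invf_lt1 ?ltr1n // invr_gt0.
rewrite mulr0 => /cvgr_le /(_ eps eps0) [n _ hn].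
by exists n.+1 => //; exact: hn (leqnSn n).
Qed.

(** The order of choices is [eps], then [e], then the truncation level, and only then the threshold
    for x and y. *)
Lemma ruin_bounds eps : 0 < eps -> exists2 x0, 0 <= x0 & forall x y, x0 <= x -> x0 <= y ->
  (1 - eps) * fine (DeltaT x y) <= pr P (ruin_max x y) /\
  pr P (ruin_and x y) <= (1 + eps) * fine (DeltaT x y).
Proof.
move=> eps0.
have [kap kap0 hD] := Delta_fine; have [K K0 hK] := tails_le_Delta.
have [kap' kap'0 hmany] := ruin_and_many_claims.
(* Each side loses at most 3 e Delta and twice e Fbar(x) Gbar(y), the latter at most K e Delta each;
   6 leaves a margin, and 1/2 keeps [e] below 1. *)
pose e := Num.min (1 / 2) (eps / (6 + 2 * K)).
have den : 0 < 6 + 2 * K by rewrite addr_gt0 // mulr_gt0.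
have e0 : 0 < e by rewrite lt_min !divr_gt0.
have e01 : 0 < e < 1.
  by rewrite e0 (@le_lt_trans _ _ (1 / 2)) //; [rewrite ge_min lexx|lra].
have e_eps : 6 * e + 2 * (K * e) <= eps.
  have : e <= eps / (6 + 2 * K) by rewrite ge_min lexx orbT.
  by rewrite ler_pdivlMr //; lra.
(* Sized for two errors at once: the truncation of Delta ([kap]) and the event of more than [n1]
   arrivals ([kap']). The lower bound then uses the square of side [n1.*2], which is the one in the
   upper estimate of Delta. *)
have [n1 n10 hn1] := small_pow (kap + kap') e0.
have [x1 x10 hlow] := ruin_max_ge n1.*2 e01.
have [x2 x20 hfew] := ruin_and_few_claims n10 e01.
exists (Num.max x1 x2); first by rewrite le_max x10.
move=> x y; rewrite !ge_max => /andP[xx1 xx2] /andP[yx1 yx2].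
have x0 := le_trans x10 xx1; have y0 := le_trans x10 yx1.
have [D0 Dn] := hD x y x0 y0.
have := hlow x y xx1 yx1; have := hfew x y xx2 yx2; have := hmany n1 x y x0 y0.
have := hK x y x0 y0; have := tails_ge0 x y.
have /andP[Dn1 Dn2] := Dn n1; have /andP[Dn3 _] := Dn n1.*2.
have := square_ge0 n1.*2 x y.
rewrite (pr_setID P (mruin_and x y) (marrived n1.+1)).
move: Dn1 Dn2 Dn3 D0.
set D := fine _; set Phi := Fb x * Gb y; set S1 := square n1 x y; set S2 := square n1.*2 x y.
set p1 := pr P _; set p2 := pr P _; set p3 := pr P _.
move=> Dn1 Dn2 Dn3 D0 S20 Phi0 PhiK p1_le p2_le p3_ge.
have pw0 : 0 <= (2^-1 : R) ^+ n1 by rewrite exprn_ge0 // invr_ge0.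
have t1 : kap * Phi * 2^-1 ^+ n1 <= e * Phi.
  rewrite mulrAC ler_wpM2r //; apply: le_trans hn1.
  by rewrite ler_wpM2r // lerDl ltW.
have t2 : kap' * Phi * 2^-1 ^+ n1 <= e * Phi.
  rewrite mulrAC ler_wpM2r //; apply: le_trans hn1.
  by rewrite ler_wpM2r // lerDr ltW.
have t3 : e * Phi <= K * e * D by rewrite [K * e]mulrC -mulrA ler_wpM2l // ltW.
have t4 : e * S2 <= e * D by rewrite ler_wpM2l // ltW.
have t5 : (6 * e + 2 * (K * e)) * D <= eps * D by rewrite ler_wpM2r // ltW.
have ee : e * e <= e by rewrite ler_piMl ?ltW //; case/andP: e01.
have t6 : (1 + e) * (1 + e) * S1 <= (1 + 3 * e) * D.
  have e13 : (1 + e) * (1 + e) <= 1 + 3 * e by lra.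
  have ge0' : 0 <= (1 + e) * (1 + e) by rewrite mulr_ge0 // addr_ge0 // ltW.
  apply: le_trans (ler_wpM2l ge0' Dn1) _.
  by rewrite ler_wpM2r // ltW.
have eD : 0 <= e * D by rewrite mulr_ge0 // ltW.
split; lra.
Qed.

End RuinAsymptotics.

Unset Implicit Arguments. Set Strict Implicit. Set Printing Implicit Defensive.

Theorem theorem3p1 (d : measure_display) (Omega : measurableType d) (R : realType)
  (P : probability Omega R)
  (X Y theta : nat -> Omega -> R) (C1 C2 : Omega -> cumulative R R)
  (r C T : R)
  (* random variables *)
  (mX : forall i, measurable_fun setT (X i))
  (mY : forall i, measurable_fun setT (Y i))
  (mtheta : forall i, measurable_fun setT (theta i))
  (mC1 : forall t, measurable_fun setT (fun w => C1 w t))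
  (mC2 : forall t, measurable_fun setT (fun w => C2 w t))
  (* premium processes: nondecreasing cadlag paths, C(0) = 0 (and C(0-) = 0) *)
  (C1_0 : forall w t, t <= 0 -> C1 w t = 0)
  (C2_0 : forall w t, t <= 0 -> C2 w t = 0)
  (* interarrival times: i.i.d. positive *)
  (theta_pos : forall i w, 0 < theta i w)
  (theta_indep : indep_seq P theta)
  (theta_id : forall i (B : set R), (1 <= i)%N -> measurable B ->
     P (theta i @^-1` B) = P (theta 1%N @^-1` B))
  (* mutual independence of {(X_i,Y_i)}, {(C_1,C_2)}, {N} *)
  (indep : indep3 P (sigma_claims X Y) (sigma_premium C1 C2) (sigma_interarrival theta))
  (* (X_i, Y_i) identically distributed, non-negative *)
  (XY_id : forall i (B : set (R * R)), (1 <= i)%N -> measurable B ->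
     P ((fun w => (X i w, Y i w)) @^-1` B) = P ((fun w => (X 1%N w, Y 1%N w)) @^-1` B))
  (X_ge0 : forall i w, 0 <= X i w)
  (Y_ge0 : forall i w, 0 <= Y i w)
  (* F = law of X_1, G = law of Y_1: infinite right endpoint, in D /\ L *)
  (F_inf : forall x, 0 < tail P (X 1%N) x)
  (G_inf : forall y, 0 < tail P (Y 1%N) y)
  (F_D : classD (tail P (X 1%N))) (F_L : classL (tail P (X 1%N)))
  (G_D : classD (tail P (Y 1%N))) (G_L : classL (tail P (Y 1%N)))
  (* SAI with common constant C > 0 *)
  (C_gt0 : 0 < C)
  (SAI : forall i, (1 <= i)%N ->
     asymp xy_infty
       (fun p : R * R => fine (P [set w | p.1 < X i w /\ p.2 < Y i w]))
       (fun p : R * R => C * tail P (X 1%N) p.1 * tail P (Y 1%N) p.2))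
  (* X_i, Y_j independent for i <> j *)
  (XY_indep : forall i j (A B : set R), (1 <= i)%N -> (1 <= j)%N -> i <> j ->
     measurable A -> measurable B ->
     P (X i @^-1` A `&` Y j @^-1` B) = (P (X i @^-1` A) * P (Y j @^-1` B))%E)
  (* GTAI for every n *)
  (gtai : forall n : nat, GTAI P n X Y)
  (r_ge0 : 0 <= r)
  (T_gt0 : 0 < T)
  (lamT_gt0 : (0 < renewal_fun P theta T)%E) :
  asymp xy_infty (fun p : R * R => psi_max P p.1 p.2 r C1 C2 X Y theta T)
    (fun p : R * R => fine (Delta (renewal_measure P theta)
                               (tail P (X 1%N)) (tail P (Y 1%N)) C r p.1 p.2 T)) /\
  asymp xy_infty (fun p : R * R => psi_and P p.1 p.2 r C1 C2 X Y theta T)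
    (fun p : R * R => fine (Delta (renewal_measure P theta)
                               (tail P (X 1%N)) (tail P (Y 1%N)) C r p.1 p.2 T)).
Proof.
have bounds := ruin_bounds mX mY mtheta mC1 mC2 C1_0 C2_0 theta_pos theta_indep theta_id indep
  XY_id X_ge0 Y_ge0 F_inf G_inf F_D F_L G_D G_L C_gt0 SAI XY_indep gtai r_ge0 T_gt0 lamT_gt0.
have mmax x y := measurable_event_max mtheta theta_pos r_ge0 mX mY mC1 mC2 X_ge0 Y_ge0 C1_0 C2_0
  x y T.
have mand x y := measurable_event_and mtheta theta_pos r_ge0 mX mY mC1 mC2 X_ge0 Y_ge0 C1_0 C2_0
  x y T.
(* The inclusion of events orders the two ruin probabilities, so the lower bound for one and the
   upper bound for the other enclose both. *)
have max_and x y := le_pr P (mmax x y) (mand x y) (@event_max_sub_and _ _ _ _ _ _ _ _ _ _ _ _).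
have D_gt0 := Delta_gt0 mX mY mtheta theta_pos theta_indep theta_id F_inf G_inf F_D G_D C_gt0
  r_ge0 lamT_gt0.
split; apply/asymp_xyP => [x y x0 y0|e e0]; try exact: D_gt0;
  have [x0 x00 h] := bounds e e0; exists x0 => x y hx hy;
  have [lower upper] := h x y hx hy; have := max_and x y;
  rewrite mulrBl mulrDl mul1r in lower upper => le_and;
  rewrite ler_distl; apply/andP; split.
- exact: lower.
- exact: le_trans le_and upper.
- exact: le_trans lower le_and.
- exact: upper.
Qed.
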